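(* Let $1\le k\le n$ and $f:\Lambda^k(\mathbb{R}^n)\to\mathbb{R}$. The following statements are equivalent. (i) $f$ is ext. polyaffine. (ii) $f$ is ext. quasiaffine. (iii) $f$ is ext. one affine. (iv) For every $0\le s\le [n/k]$ there exists $c_s\in\Lambda^{ks}(\mathbb{R}^n)$ such that $$f(\xi)=\sum_{s=0}^{[n/k]}\langle c_s;\xi^s\rangle\quad\text{for every }\xi\in\Lambda^k(\mathbb{R}^n).$$
   Context: $\Lambda^k=\Lambda^k(\mathbb{R}^n)$ is the vector space of alternating $k$-linear forms on $\mathbb{R}^n$ (with $\Lambda^0=\mathbb{R}$), $\wedge$ is the exterior product, $\langle\cdot;\cdot\rangle$ the standard scalar product on forms (for which the $e^{i_1}\wedge\cdots\wedge e^{i_k}$, $i_1<\cdots<i_k$, are orthonormal), $d$ the exterior derivative, $\xi^s=\xi\wedge\cdots\wedge\xi$ ($s$ times, with $\xi^0=1$), and $[n/k]$ the integer part of $n/k$. $W_0^{1,\infty}(\Omega;\Lambda^{k-1})$ is the usual Sobolev space of $(k-1)$-forms with $W^{1,\infty}$ coefficients vanishing on $\partial\Omega$ (i.e. $W^{1,\infty}\cap W^{1,1}_0$). Let $f:\Lambda^k\to\mathbb{R}$. - $f$ is ext. one affine if for every $\xi\in\Lambda^k$, $\alpha\in\Lambda^{k-1}$, $\beta\in\Lambda^1$ the function $t\mapsto f(\xi+t\,\alpha\wedge\beta)$ is affine on $\mathbb{R}$. - $f$ is ext. quasiaffine if $f$ is Borel measurable, locally bounded, and $\int_\Omega f(\xi+d\omega)=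 f(\xi)\operatorname{meas}\Omega$ for every bounded open set $\Omega\subset\mathbb{R}^n$, every $\xi\in\Lambda^k$ and every $\omega\in W_0^{1,\infty}(\Omega;\Lambda^{k-1})$. - $f$ is ext. polyaffine if there is an affine function $F:\Lambda^k\times\Lambda^{2k}\times\cdots\times\Lambda^{[n/k]k}\to\mathbb{R}$ such that $f(\xi)=F(\xi,\xi^2,\ldots,\xi^{[n/k]})$ for all $\xi\in\Lambda^k$. *)

(* Defs.v *)
From HB Require Import structures.
From mathcomp Require Import all_boot all_order all_algebra all_fingroup.
From mathcomp Require Import all_classical all_reals all_analysis.

Set Implicit Arguments.
Unset Strict Implicit.
Unset Printing Implicit Defensive.

Import Order.TTheory GRing.Theory Num.Theory.
Import numFieldNormedType.Exports.

Local Open Scope classical_set_scope.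
Local Open Scope ring_scope.

(** * Alternating forms on R^n *)

Section forms.
Context {R : realType} {n : nat}.

(* A k-tuple of vectors of R^n is the k x n matrix whose rows are the vectors. *)
Definition multilinear k (phi : 'M[R]_(k, n) -> R) : Prop :=
  forall (i : 'I_k) (A B C : 'M[R]_(k, n)) (b c : R),
    row i A = b *: row i B + c *: row i C ->
    (forall j, j != i -> row j B = row j A) ->
    (forall j, j != i -> row j C = row j A) ->
    phi A = b * phi B + c * phi C.

Definition alternating k (phi : 'M[R]_(k, n) -> R) : Prop :=
  forall (i j : 'I_k) (A : 'M[R]_(k, n)),
    i != j -> row i A = row j A -> phi A = 0.

Definition alt_pred k : {pred 'M[R]_(k, n) -> R^o} :=
  fun phi => `[< multilinear phi /\ alternating phi >].

Lemma alt_pred_submod k : submod_closed (@alt_pred k).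
Proof.
split.
  apply/asboolP; split=> [i A B C b c _ _ _|i j A _ _].
    by change (0 = b * 0 + c * 0 :> R); rewrite !mulr0 addr0.
  by [].
move=> a u v /asboolP[um ua] /asboolP[vm va]; apply/asboolP.
split=> [i A B C b c E1 E2 E3|i j A ij E].
  change (a * u A + v A = b * (a * u B + v B) + c * (a * u C + v C)).
  rewrite (um i A B C b c E1 E2 E3) (vm i A B C b c E1 E2 E3) !mulrDr.
  by rewrite !(mulrCA a) addrACA.
change (a * u A + v A = 0).
by rewrite (ua i j A ij E) (va i j A ij E) mulr0 addr0.
Qed.

HB.instance Definition _ k := GRing.isSubmodClosed.Build R
  ('M[R]_(k, n) -> R^o) (@alt_pred k) (@alt_pred_submod k).

Record ext_form k := ExtForm {
  ext_form_fun :> 'M[R]_(k, n) -> R^o;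
  ext_form_subproof : ext_form_fun \in @alt_pred k }.

HB.instance Definition _ k := [isSub for @ext_form_fun k].
HB.instance Definition _ k := [Choice of ext_form k by <:].
HB.instance Definition _ k := [SubChoice_isSubLmodule of ext_form k by <:].
HB.instance Definition _ k := isPointed.Build (ext_form k) 0.

(* For k = 0 every function on the one-point type 'M_(0, n) is a form. *)
Lemma cst_form_subproof (a : R) : (fun=> a) \in @alt_pred 0.
Proof. by apply/asboolP; split=> [[]|[]]. Qed.

Definition cst_form (a : R) : ext_form 0 := ExtForm (cst_form_subproof a).

(* e^i *)
Lemma dual_form_subproof (i : 'I_n) :
  (fun A : 'M[R]_(1, n) => A 0 i) \in @alt_pred 1.
Proof.
apply/asboolP; split=> [j A B C b c E _ _|j l A].
  by have := congr1 (fun v : 'rV_n => v 0 i) E; rewrite !mxE (ord1 j).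
by rewrite (ord1 j) (ord1 l) eqxx.
Qed.

Definition dual_form (i : 'I_n) : ext_form 1 :=
  ExtForm (dual_form_subproof i).

(* (a /\ b)(v_1, ..., v_(p+q)) is 1/(p! q!) times the sum over s of
   sgn(s) a(v_s(1), ..., v_s(p)) b(v_s(p+1), ..., v_s(p+q)); with this
   normalization e^i1 /\ ... /\ e^ik takes the value 1 on (e_i1, ..., e_ik). *)
Definition wedge_fun p q (a : ext_form p) (b : ext_form q)
    (A : 'M[R]_(p + q, n)) : R :=
  (p`! * q`!)%:R^-1 *
  \sum_(s : 'S_(p + q)) (-1) ^+ s *
    (a (usubmx (row_perm s A)) * b (dsubmx (row_perm s A))).

Lemma wedge_subproof p q (a : ext_form p) (b : ext_form q) :
  (wedge_fun a b : _ -> R^o) \in @alt_pred (p + q).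
Proof.
have /asboolP[am _] := ext_form_subproof a.
have /asboolP[bm _] := ext_form_subproof b.
apply/asboolP; split=> [i A B C x y E EB EC|i j A ij E].
  rewrite /wedge_fun !(mulrCA _ (_^-1)) -mulrDr; congr (_ * _).
  rewrite !mulr_sumr -big_split /=; apply: eq_bigr => s _.
  rewrite !(mulrCA _ ((-1) ^+ s)) -mulrDr; congr (_ * _).
  have rp (X : 'M[R]_(p + q, n)) l : row l (row_perm s X) = row (s l) X.
    by apply/rowP => m; rewrite !mxE.
  have ru (X : 'M[R]_(p + q, n)) l : row l (usubmx X) = row (lshift q l) X.
    by apply/rowP => m; rewrite !mxE.
  have rd (X : 'M[R]_(p + q, n)) l : row l (dsubmx X) = row (rshift p l) X.
    by apply/rowP => m; rewrite !mxE.
  have [l il] : exists l, i = s l by exists ((s^-1)%g i); rewrite permKV.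
  rewrite {}il in E EB EC.
  have [l' El|l' El] := split_ordP l; rewrite {}El in E EB EC.
    have dE (X : 'M[R]_(p + q, n)) :
        (forall j, j != s (lshift q l') -> row j X = row j A) ->
        dsubmx (row_perm s X) = dsubmx (row_perm s A).
      move=> EX; apply/row_matrixP => m; rewrite !rd !rp EX//.
      by rewrite (inj_eq perm_inj) eq_rlshift.
    rewrite (dE B)// (dE C)// !mulrA -mulrDl; congr (_ * _).
    apply: (am l'); rewrite ?ru ?rp// => m ml; rewrite !ru !rp.
      by rewrite EB// (inj_eq perm_inj) eq_lshift.
    by rewrite EC// (inj_eq perm_inj) eq_lshift.
  have uE (X : 'M[R]_(p + q, n)) :
      (forall j, j != s (rshift p l') -> row j X = row j A) ->
      usubmx (row_perm s X) = usubmx (row_perm s A).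
    move=> EX; apply/row_matrixP => m; rewrite !ru !rp EX//.
    by rewrite (inj_eq perm_inj) eq_lrshift.
  rewrite (uE B)// (uE C)// !(mulrCA _ (a _)) -mulrDr; congr (_ * _).
  apply: (bm l'); rewrite ?rd ?rp// => m ml; rewrite !rd !rp.
    by rewrite EB// (inj_eq perm_inj) eq_rshift.
  by rewrite EC// (inj_eq perm_inj) eq_rshift.
rewrite /wedge_fun; set S := (X in _ * X).
suff : S = - S.
  by move/eqP; rewrite -addr_eq0 -mulr2n mulrn_eq0 /= => /eqP->; rewrite mulr0.
rewrite /S -sumrN (reindex_inj (mulIg (tperm i j))) /=.
apply: eq_bigr => s _; rewrite odd_permM odd_tperm ij addbT signrN mulNr.
suff -> : row_perm (s * tperm i j)%g A = row_perm s A by [].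
apply/row_matrixP => l; apply/rowP => m; rewrite !mxE permM.
by case: tpermP => // ->; have /rowP/(_ m) := E; rewrite !mxE.
Qed.

Definition wedge p q (a : ext_form p) (b : ext_form q) : ext_form (p + q) :=
  ExtForm (wedge_subproof a b).

(* xi^s, of degree s * k *)
Fixpoint wedge_exp k (xi : ext_form k) (s : nat) : ext_form (s * k) :=
  if s is s'.+1 then wedge xi (wedge_exp xi s') else cst_form 1.

Definition increasing k (I : {ffun 'I_k -> 'I_n}) : bool :=
  [forall i : 'I_k, forall j : 'I_k, (i < j)%N ==> (I i < I j)%N].

(* The coefficient of e^I(1) /\ ... /\ e^I(k) in xi, for I increasing. *)
Definition ext_coef k (I : {ffun 'I_k -> 'I_n}) (xi : ext_form k) : R :=
  xi (\matrix_(i < k) delta_mx 0 (I i)).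

Definition ext_dot k (xi eta : ext_form k) : R :=
  \sum_(I : {ffun 'I_k -> 'I_n} | increasing I) ext_coef I xi * ext_coef I eta.

Definition ext_norm k (xi : ext_form k) : R := Num.sqrt (ext_dot xi xi).

Definition ext_open k : set (set (ext_form k)) :=
  [set U | forall xi, U xi ->
     exists2 r, 0 < r & forall eta, ext_norm (eta - xi) < r -> U eta].

End forms.
Arguments ext_form R n k : clear implicits.

(** * Lebesgue measure on R^n *)

Section lebesgue.
Context {R : realType}.

Definition rV_coord n (i : 'I_n) (x : 'rV[R]_n) : measurableTypeR R := x 0 i.

(* The product sigma-algebra, which is the Borel sigma-algebra of R^n. *)
HB.instance Definition _ n := @isMeasurable.Build default_measure_display
  'rV[R]_n (g_sigma_preimage (@rV_coord n)) (@sigma_algebra0 _ _ _)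
  (@sigma_algebraC _ _) (@sigma_algebra_bigcup _ _ _).

Lemma measurable_rV_coord n (i : 'I_n) : measurable_fun setT (@rV_coord n i).
Proof.
move=> _ Y mY; rewrite setTI; apply: sub_sigma_algebra => /=.
rewrite -bigcup_seq/=; exists i => /=; first by rewrite mem_index_enum.
by exists Y => //; rewrite setTI.
Qed.

Lemma measurable_fun_rV d (T : measurableType d) n (f : T -> 'rV[R]_n) :
  (forall i, measurable_fun setT (rV_coord i \o f)) -> measurable_fun setT f.
Proof.
move=> fS.
suff : g_sigma_preimage (fun i => rV_coord i \o f) `<=` measurable.
  rewrite g_sigma_preimage_comp => prefS _ A mA.
  by apply: prefS; exists A.
apply: smallest_sub; first exact: sigma_algebra_measurable.
case: n => [|n] in f fS *; first by rewrite big_ord0.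
rewrite -bigcup_mkord_ord; apply: bigcup_sub => i Ii.
by move=> A [B mB <-]; exact: fS.
Qed.

Definition rV_cons n (p : measurableTypeR R * 'rV[R]_n) : 'rV[R]_n.+1 :=
  \row_(i < n.+1) if unlift 0 i is Some j then p.2 0 j else p.1.

Definition rV_uncons n (x : 'rV[R]_n.+1) : measurableTypeR R * 'rV[R]_n :=
  (x 0 0, \row_j x 0 (lift 0 j)).

Lemma rV_consK n : cancel (@rV_cons n) (@rV_uncons n).
Proof.
case=> a x; congr (_, _); first by rewrite mxE unlift_none.
by apply/rowP => j; rewrite !mxE liftK.
Qed.

Lemma measurable_rV_cons n : measurable_fun setT (@rV_cons n).
Proof.
apply: measurable_fun_rV => i; case: (unliftP 0 i) => [j ->|->].
  rewrite (_ : _ \o _ = rV_coord j \o snd).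
    apply: measurableT_comp; first exact: measurable_rV_coord.
    exact: measurable_snd.
  by apply/funext => -[a x]; rewrite /rV_coord/= mxE liftK.
rewrite (_ : _ \o _ = fst); first exact: measurable_fst.
by apply/funext => -[a x]; rewrite /rV_coord/= mxE unlift_none.
Qed.

Lemma measurable_rV_uncons n : measurable_fun setT (@rV_uncons n).
Proof.
apply/measurable_fun_pairP; split; first exact: measurable_rV_coord.
apply: measurable_fun_rV => i.
rewrite (_ : _ \o _ = rV_coord (lift 0 i)); first exact: measurable_rV_coord.
by apply/funext => x; rewrite /rV_coord/= mxE.
Qed.

Section step.
Local Open Scope ereal_scope.
Context n (mu : {sigma_finite_measure set 'rV[R]_n -> \bar R}).

Definition lebesgue_step : set 'rV[R]_n.+1 -> \bar R :=
  pushforward (lebesgue_measure \x mu) (@rV_cons n).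

Let meas (A : set 'rV[R]_n.+1) :
  measurable A -> measurable (@rV_cons n @^-1` A).
Proof.
by move=> mA; rewrite -[X in measurable X]setTI; exact: measurable_rV_cons.
Qed.

Let step0 : lebesgue_step set0 = 0.
Proof. by rewrite /lebesgue_step /pushforward preimage_set0 measure0. Qed.

Let step_ge0 A : 0 <= lebesgue_step A.
Proof. by rewrite /lebesgue_step /pushforward measure_ge0. Qed.

Let step_sigma_additive : semi_sigma_additive lebesgue_step.
Proof.
move=> F mF tF mUF; rewrite /lebesgue_step /pushforward preimage_bigcup.
apply: measure_semi_sigma_additive => //.
- by move=> m; exact: meas.
- apply/trivIsetP => /= i j _ _ ij; rewrite -preimage_setI.
  by move/trivIsetP : tF => /(_ _ _ _ _ ij) ->//; rewrite preimage_set0.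
- by rewrite -preimage_bigcup; exact: meas.
Qed.

HB.instance Definition _ := isMeasure.Build _ _ _ lebesgue_step
  step0 step_ge0 step_sigma_additive.

Let step_sigma_finite : sigma_finite setT lebesgue_step.
Proof.
have /sigma_finiteP[F [TF ndF Foo]] := sigma_finiteT (@lebesgue_measure R).
have /sigma_finiteP[G [TG ndG Goo]] := sigma_finiteT mu.
exists (fun m => @rV_uncons n @^-1` (F m `*` G m)).
  rewrite -preimage_bigcup (_ : \bigcup_i _ = setT) ?preimage_setT//.
  rewrite -setXTT TF TG predeqE => -[x y]; split.
    by move=> [m _ [/= ? ?]]; split; exists m.
  move=> [/= [m _ Fx] [l _ Gy]]; exists (maxn m l) => //; split.
  - by move: x Fx; exact/subsetPset/ndF/leq_maxl.
  - by move: y Gy; exact/subsetPset/ndG/leq_maxr.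
move=> m; have [? ?] := Foo m; have [? ?] := Goo m; split.
  rewrite -[X in measurable X]setTI; apply: measurable_rV_uncons => //.
  exact: measurableX.
rewrite /lebesgue_step /pushforward -comp_preimage (_ : _ \o _ = id); last first.
  by apply/funext => p /=; rewrite rV_consK.
by rewrite preimage_id product_measure1E// lte_mul_pinfty// ge0_fin_numE.
Qed.

HB.instance Definition _ := Measure_isSigmaFinite.Build _ _ _ lebesgue_step
  step_sigma_finite.

End step.

(* Lebesgue measure on R^0 is the unit mass at its only point; on R^(n+1) it is
   the image of the product of the Lebesgue measures on R and on R^n. *)
Fixpoint lebesgue_rV n : {sigma_finite_measure set 'rV[R]_n -> \bar R} :=
  if n is n'.+1 then lebesgue_step (lebesgue_rV n') else \d_(0 : 'rV[R]_0).

End lebesgue.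

(** * Sobolev spaces of forms *)

Section sobolev.
Context {R : realType} {n : nat}.
Implicit Types (W : set 'rV[R]_n) (u : 'rV[R]_n -> R) (i : 'I_n).

Definition pderiv i u : 'rV[R]_n -> R := 'D_(delta_mx 0 i) u.

Definition smooth u : Prop :=
  forall (s : seq 'I_n) (x : 'rV[R]_n), differentiable (foldr pderiv u s) x.

Definition test_function W u : Prop :=
  [/\ smooth u, compact (closure [set x | u x != 0])
    & closure [set x | u x != 0] `<=` W].

Definition Linfty W u : Prop :=
  measurable_fun W u /\
  exists M : R, {ae lebesgue_rV n, forall x, W x -> `|u x| <= M}.

Definition L1 W u : Prop := (lebesgue_rV n).-integrable W (EFin \o u).

(* g is the i-th weak partial derivative of u on W *)
Definition weak_pderiv W i u (g : 'rV[R]_n -> R) : Prop :=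
  forall phi, test_function W phi ->
    \int[lebesgue_rV n]_(x in W) (u x * pderiv i phi x) =
    - \int[lebesgue_rV n]_(x in W) (g x * phi x).

(* In the next three definitions g is a representative of the weak gradient
   of u. *)
Definition W1infty W u (g : 'I_n -> 'rV[R]_n -> R) : Prop :=
  Linfty W u /\ forall i, Linfty W (g i) /\ weak_pderiv W i u (g i).

Definition W11 W u (g : 'I_n -> 'rV[R]_n -> R) : Prop :=
  L1 W u /\ forall i, L1 W (g i) /\ weak_pderiv W i u (g i).

(* closure of the test functions in W^{1,1}(W) *)
Definition W110 W u (g : 'I_n -> 'rV[R]_n -> R) : Prop :=
  W11 W u g /\
  exists phi : nat -> 'rV[R]_n -> R,
    [/\ forall m, test_function W (phi m),
        (\int[lebesgue_rV n]_(x in W) `|phi m x - u x|%:E)%E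
          @[m --> \oo] --> 0%E
      & forall i,
        (\int[lebesgue_rV n]_(x in W) `|pderiv i (phi m) x - g i x|%:E)%E
          @[m --> \oo] --> 0%E].

(* A field w of p-forms lies in W_0^{1,oo}(W; Lambda^p), with weak partial
   derivatives dw i. *)
Definition W1infty0_form p W (w : 'rV[R]_n -> ext_form R n p)
    (dw : 'I_n -> 'rV[R]_n -> ext_form R n p) : Prop :=
  forall I : {ffun 'I_p -> 'I_n}, increasing I ->
    let u x := ext_coef I (w x) in
    let g i x := ext_coef I (dw i x) in
    W1infty W u g /\ W110 W u g.

(* exterior derivative sum_i e^i /\ d_i w, from the partial derivatives d_i w *)
Definition ext_d p (dw : 'I_n -> 'rV[R]_n -> ext_form R n p) (x : 'rV[R]_n) :
  ext_form R n p.+1 := \sum_(i < n) wedge (dual_form i) (dw i x).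

End sobolev.

Section ext_affine.
Context {R : realType} {n k : nat}.
Implicit Types f : ext_form R n k -> R.

Definition ext_cast p q (e : p = q) (xi : ext_form R n p) : ext_form R n q :=
  ecast m (ext_form R n m) e xi.

Lemma pred_addn1 : (0 < k)%N -> (k.-1 + 1)%N = k.
Proof. by move=> k0; rewrite addn1 prednK. Qed.

Definition ext_one_affine (k_gt0 : (0 < k)%N) f : Prop :=
  forall (xi : ext_form R n k) (a : ext_form R n k.-1) (b : ext_form R n 1),
    exists c0 c1 : R, forall t : R,
      f (xi + t *: ext_cast (pred_addn1 k_gt0) (wedge a b)) = c0 + c1 * t.

Definition locally_bounded f : Prop :=
  forall xi, exists r M : R, 0 < r /\
    forall eta, ext_norm (eta - xi) < r -> `|f eta| <= M.

Definition borel_measurable f : Prop :=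
  measurable_fun setT (f : g_sigma_algebraType (@ext_open R n k) -> R).

Definition ext_quasiaffine (k_gt0 : (0 < k)%N) f : Prop :=
  [/\ borel_measurable f, locally_bounded f &
    forall (W : set 'rV[R]_n), open W -> bounded_set W ->
    forall (xi : ext_form R n k) (w : 'rV[R]_n -> ext_form R n k.-1)
      (dw : 'I_n -> 'rV[R]_n -> ext_form R n k.-1),
    W1infty0_form W w dw ->
    (\int[lebesgue_rV n]_(x in W)
       (f (xi + ext_cast (prednK k_gt0) (ext_d dw x)))%:E =
     (f xi)%:E * lebesgue_rV n W)%E].

Definition affine_fun (m : nat) (V : 'I_m -> lmodType R)
    (F : (forall s, V s) -> R) : Prop :=
  forall (t : R) (x y : forall s, V s),
    F (fun s => (1 - t) *: x s + t *: y s) = (1 - t) * F x + t * F y.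

(* The factors Lambda^k, Lambda^2k, ..., Lambda^[n/k]k are indexed from 0. *)
Definition ext_polyaffine f : Prop :=
  exists F : (forall s : 'I_(n %/ k), ext_form R n (s.+1 * k)) -> R,
    affine_fun F /\ forall xi, f xi = F (fun s => wedge_exp xi s.+1).

End ext_affine.

(* Main.v *)
(* (iii) => (iv): one-affinity makes the iterated differences of f at 0 along basis
   k-forms vanish or change sign so that the s-th one is an alternating tensor
   of degree sk.  Hence the Taylor expansion of f at 0 in the coordinates of xi
   is finite, and its s-th term is the contraction of that tensor with xi^s.

   (iv) => (ii): it suffices to show int C(eta^s) = C(xi^s) |W| for eta = xi + d w and
   every alternating C.  By induction on s, eta^s is closed in the weak sense;
   expanding one factor of eta^(s+1) and approximating w by test functions psi,
   Schwarz gives d psi /\ d phi /\ eta^s = +- d (psi d phi) /\ eta^s, which integrates to 0.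

   (ii) => (iii): for a fixed (k-1)-form a, p(v) = f(xi + v /\ a) satisfies
   int p(v + grad phi) = p(v) |W| for scalar test functions phi.  Any v interior to a
   simplex is the slope of a pyramid-like phi for which v + grad phi takes, off a
   set of small measure, only the vertices as values; comparing p with its affine
   interpolation at the vertices shows that p is affine on the simplex.

   (i) <=> (iv): linear functionals on forms are scalar products. *)
From mathcomp Require Import all_boot all_order all_algebra all_fingroup.
From mathcomp Require Import all_classical all_reals all_analysis.
From mathcomp Require Import measurable_realfun.
From mathcomp Require Import zify ring lra.
Require Import Defs.

Set Implicit Arguments.
Unset Strict Implicit.
Unset Printing Implicit Defensive.

Import Order.TTheory GRing.Theory Num.Theory.
Import numFieldNormedType.Exports.

Local Open Scope classical_set_scope.
Local Open Scope ring_scope.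

(** * Contraction of forms with alternating tensors *)

(** In neither hard implication is [f] known to be continuous. One-affinity is a purely algebraic
    condition, so finite differences stand in for derivatives, and the degree bound comes from the
    fact that a word of more than [n] letters repeats one. Quasiaffinity gives measurability and
    local bounds only, so slopes merely close to the vertices of the simplex would say nothing: they
    have to equal the vertices exactly. The exceptional set is harmless because the bound on the
    gradients of the pyramids is fixed before its measure is made small. Test functions are smooth,
    hence the replacement of max(0, t) by functions built from exp(-1/x).

    For powers of closed forms the obstacle is that the gradients of the approximating test
    functions converge in L^1 only, while all other factors are merely bounded. A single factor at a
    time can thus be passed to the limit, which is why [eta^s] itself is never approximated and why
    the induction on [s] treats all alternating tensors simultaneously. *)

Section contraction.
Context {R : realType} {n : nat}.
Implicit Types C : seq 'I_n -> R.

(* An alternating tensor, in all degrees at once, is given by its values on words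
   of basis indices: interior products become prefixing, and no cast between
   the types ext_form R n p is needed. *)
Definition altseq C := forall p i j r, C (p ++ i :: j :: r) = - C (p ++ j :: i :: r).

Lemma altseq_catl C p : altseq C -> altseq (fun l => C (p ++ l)).
Proof. by move=> aC p' i j r; rewrite !catA aC. Qed.

(** Exchanging two letters across [m] takes [2 * size m + 1] adjacent swaps, an odd number. *)
Lemma altseq_swap C p i m j r : altseq C ->
  C (p ++ i :: m ++ j :: r) = - C (p ++ j :: m ++ i :: r).
Proof.
move=> aC; elim: m p => [|x m IH] p /=; first exact: aC.
by rewrite aC -(cat_rcons x p) IH cat_rcons -(aC p).
Qed.

Lemma altseq_move C p i m r : altseq C ->
  C (p ++ i :: m ++ r) = (-1) ^+ size m * C (p ++ m ++ i :: r).
Proof.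
move=> aC; elim: m p => [|x m IH] p /=; first by rewrite expr0 mul1r.
by rewrite aC -(cat_rcons x p) IH cat_rcons exprS mulN1r mulNr.
Qed.

(** The enumeration of ['I_p] is duplicate-free, so composing with the transposition exchanges
    exactly the letters at the two positions and [altseq_swap] applies. *)
Lemma altseq_map_tperm C p (J : 'I_p -> 'I_n) i j : altseq C -> i != j ->
  C [seq J (tperm i j l) | l <- enum 'I_p] = - C [seq J l | l <- enum 'I_p].
Proof.
move=> aC ij.
have swap (q1 q2 q3 : seq 'I_p) x y : uniq (q1 ++ x :: q2 ++ y :: q3) ->
    C [seq J (tperm x y l) | l <- q1 ++ x :: q2 ++ y :: q3] =
    - C [seq J l | l <- q1 ++ x :: q2 ++ y :: q3].
  rewrite (@perm_uniq _ _ (x :: y :: (q1 ++ q2 ++ q3))); last first.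
    by apply/seq.permP => a; rewrite /= !count_cat /= !count_cat /=; lia.
  rewrite /= inE negb_or => /andP[/andP[_ xq] /andP[yq _]].
  have E (q : seq 'I_p) : {subset q <= q1 ++ q2 ++ q3} ->
      [seq J (tperm x y l) | l <- q] = [seq J l | l <- q].
    move=> qS; apply/eq_in_map => z /qS zq; rewrite tpermD //.
      by apply: contraNneq xq => ->.
    by apply: contraNneq yq => ->.
  rewrite !map_cat /= !map_cat /= tpermL tpermR !E => [|z|z|z];
    rewrite ?mem_cat; do ?[by move=> ->; rewrite ?orbT].
  exact: altseq_swap.
have iP : i \in enum 'I_p by rewrite mem_enum.
have jP : j \in enum 'I_p by rewrite mem_enum.
have := enum_uniq 'I_p; case/splitPr: iP jP => p1 p2.
rewrite mem_cat inE eq_sym (negPf ij) /= => /orP[] jP.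
  case/splitPr: jP => q1 q2; rewrite -catA /= tpermC; exact: swap.
by case/splitPr: jP => q1 q2; exact: swap.
Qed.

Lemma altseq_perm C p (J : 'I_p -> 'I_n) (s : 'S_p) : altseq C ->
  C (codom (J \o s)) = (-1) ^+ s * C (codom J).
Proof.
move=> aC; have [ts -> dts] := prod_tpermP s.
elim: ts J dts => [|t ts IH] J /=.
  rewrite big_nil odd_perm1 expr0 mul1r => _; congr C.
  by apply: eq_codom => l /=; rewrite perm1.
case/andP => dt dts; rewrite big_cons odd_permM odd_tperm dt signr_addb.
rewrite expr1 mulN1r mulNr -(IH J dts) -(altseq_map_tperm _ aC dt).
by congr C; apply: eq_map => l /=; rewrite permM.
Qed.

Lemma eq_opp0 (x : R) : x = - x -> x = 0.
Proof. by move=> E; lra. Qed.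

Lemma altseq_Ninj C p (J : 'I_p -> 'I_n) : altseq C ->
  ~~ injectiveb J -> C (codom J) = 0.
Proof.
move=> aC /injectivePn[i [j ij E]]; apply: eq_opp0.
rewrite -[RHS](altseq_map_tperm _ aC ij); congr C; apply: eq_map => l.
by case: tpermP => // ->.
Qed.

(** The scalar product of [C] with the coefficients of [a], written over all words with weight 1/p!.
    Such a sum can be reindexed by permutations and split along concatenations, which a sum over
    increasing words cannot; [ctr_increasing] shows that the two agree. *)
Definition ctr p C (a : ext_form R n p) : R :=
  p`!%:R^-1 * \sum_(J : {ffun 'I_p -> 'I_n}) C (codom J) * ext_coef J a.

Lemma row_ext p (J : 'I_p -> 'I_n) i :
  row i (\matrix_(l < p) (delta_mx 0 (J l) : 'rV[R]_n)) = delta_mx 0 (J i).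
Proof. by apply/rowP => j; rewrite !mxE. Qed.

Lemma ext_form_alt p (a : ext_form R n p) (A : 'M[R]_(p, n)) i j :
  i != j -> row i A = row j A -> a A = 0.
Proof. by have /asboolP[_] := ext_form_subproof a; exact. Qed.

Lemma ext_form_lin p (a : ext_form R n p) i (A B C : 'M[R]_(p, n)) (b c : R) :
    row i A = b *: row i B + c *: row i C ->
    (forall j, j != i -> row j B = row j A) ->
    (forall j, j != i -> row j C = row j A) ->
    a A = b * a B + c * a C.
Proof. by have /asboolP[+ _] := ext_form_subproof a; exact. Qed.

Let subst2 p (A : 'M[R]_(p, n)) (i j : 'I_p) (u v : 'rV[R]_n) : 'M[R]_(p, n) :=
  \matrix_(l < p) if l == i then u else if l == j then v else row l A.

(** Polarization: [a] vanishes when the slots [i] and [j] both contain [u + v], and expanding leaves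
    the two mixed terms. *)
Lemma ext_form_tperm p (a : ext_form R n p) (A : 'M[R]_(p, n)) i j :
  i != j -> a (row_perm (tperm i j) A) = - a A.
Proof.
move=> ij; pose u := row i A; pose v := row j A.
have ji : j != i by rewrite eq_sym.
have addl x y z : a (subst2 A i j (x + y) z) =
    a (subst2 A i j x z) + a (subst2 A i j y z).
  rewrite -[X in _ = X + _]mul1r -[X in _ = _ + X]mul1r.
  apply: (@ext_form_lin _ _ i) => [|l li|l li]; rewrite !rowK.
  - by rewrite eqxx !scale1r.
  - by rewrite (negPf li).
  - by rewrite (negPf li).
have addr x y z : a (subst2 A i j z (x + y)) =
    a (subst2 A i j z x) + a (subst2 A i j z y).
  rewrite -[X in _ = X + _]mul1r -[X in _ = _ + X]mul1r.
  apply: (@ext_form_lin _ _ j) => [|l li|l li]; rewrite !rowK.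
  - by rewrite eqxx (negPf ji) !scale1r.
  - by rewrite (negPf li).
  - by rewrite (negPf li).
have dup x : a (subst2 A i j x x) = 0.
  by apply: (ext_form_alt _ ij); rewrite !rowK !eqxx (negPf ji).
have := dup (u + v); rewrite addl !addr !dup addr0 add0r => /eqP.
rewrite addrC addr_eq0 => /eqP E.
have -> : row_perm (tperm i j) A = subst2 A i j v u.
  apply/row_matrixP => l; rewrite rowK; apply/rowP => m; rewrite !mxE.
  by case: tpermP => [->|->|/eqP/negPf-> /eqP/negPf->];
    rewrite ?eqxx ?(negPf ji) ?mxE.
rewrite E; congr (- a _).
apply/row_matrixP => l; rewrite rowK; case: eqP => [->//|_].
by case: eqP => [->//|].
Qed.

Lemma ext_form_perm p (a : ext_form R n p) (A : 'M[R]_(p, n)) (s : 'S_p) :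
  a (row_perm s A) = (-1) ^+ s * a A.
Proof.
have [ts -> dts] := prod_tpermP s.
elim: ts A dts => [|t ts IH] A /=.
  by rewrite big_nil odd_perm1 row_perm1 mul1r.
case/andP => dt dts; rewrite big_cons odd_permM odd_tperm dt signr_addb.
by rewrite row_permM ext_form_tperm // IH // expr1 mulN1r mulNr.
Qed.

Lemma ext_coef_perm p (a : ext_form R n p) (J : {ffun 'I_p -> 'I_n}) (s : 'S_p) :
  ext_coef ([ffun i => J (s i)]) a = (-1) ^+ s * ext_coef J a.
Proof.
rewrite /ext_coef -ext_form_perm; congr (ext_form_fun a _).
by apply/row_matrixP => i; rewrite rowK ffunE; apply/rowP => j; rewrite !mxE.
Qed.

Lemma ext_coef_Ninj p (a : ext_form R n p) (J : {ffun 'I_p -> 'I_n}) :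
  ~~ injectiveb J -> ext_coef J a = 0.
Proof.
move=> /injectivePn[i [j ij E]]; apply: (ext_form_alt _ ij).
by rewrite !row_ext E.
Qed.

(* The inverse of C |-> (J |-> C (codom J)) on p-forms; zero off the length p *)
Definition seqform p (c : ext_form R n p) (l : seq 'I_n) : R :=
  if insub l is Some t then ext_coef [ffun i : 'I_p => tnth t i] c else 0.

Lemma seqform_codom p (c : ext_form R n p) (J : {ffun 'I_p -> 'I_n}) :
  seqform c (codom J) = ext_coef J c.
Proof.
have sJ : size (codom J) == p by rewrite size_codom card_ord.
rewrite /seqform (insubT (fun l => size l == p) sJ); congr ext_coef; apply/ffunP => i.
rewrite ffunE (tnth_nth (J i)) /=.
by rewrite (nth_map i) ?size_enum_ord // nth_ord_enum.
Qed.

Lemma seqform_size p (c : ext_form R n p) l : size l != p -> seqform c l = 0.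
Proof. by move=> sl; rewrite /seqform insubF //; exact/negbTE. Qed.

Lemma altseq_seqform p (c : ext_form R n p) : altseq (seqform c).
Proof.
move=> q i j r; have sE : size (q ++ i :: j :: r) = size (q ++ j :: i :: r).
  by rewrite !size_cat.
have [sl|sl] := eqVneq (size (q ++ i :: j :: r)) p; last first.
  by rewrite !seqform_size ?oppr0 // -sE.
have sl' := etrans (esym sE) sl; rewrite /seqform.
rewrite (insubT (fun l => size l == p) (introT eqP sl)).
rewrite (insubT (fun l => size l == p) (introT eqP sl')).
have ap : (size q < p)%N by rewrite -sl size_cat /=; lia.
have bp : ((size q).+1 < p)%N by rewrite -sl size_cat /=; lia.
have ab : Ordinal ap != Ordinal bp by rewrite -val_eqE /= neq_ltn ltnSn.
have := ext_coef_perm c [ffun l => tnth (Tuple (introT eqP sl')) l]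
  (tperm (Ordinal ap) (Ordinal bp)).
rewrite odd_tperm ab expr1 mulN1r => <-; congr ext_coef; apply/ffunP => l.
rewrite !ffunE !(tnth_nth i) /= !nth_cat.
case: tpermP => [->|->|/eqP la /eqP lb] /=.
- by rewrite ltnn subnn ltnNge leqnSn /= subSn // subnn.
- by rewrite ltnn subnn ltnNge leqnSn /= subSn // subnn.
case: ltnP => // ql; rewrite -val_eqE /= in la; rewrite -val_eqE /= in lb.
by have -> : (l - size q = (l - (size q).+2).+2)%N by lia.
Qed.

End contraction.

(** * Sorting words of basis indices *)

Section sorting.
Context {R : realType} {n : nat}.
Implicit Types C : seq 'I_n -> R.

Lemma increasing_inj p (I : {ffun 'I_p -> 'I_n}) : increasing I -> injective I.
Proof.
move=> /forallP iI i j E; apply/val_inj/eqP; rewrite eqn_leq.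
apply/andP; split; rewrite leqNgt; apply/negP => ij.
  by have /forallP/(_ i)/implyP/(_ ij) := iI j; rewrite E ltnn.
by have /forallP/(_ j)/implyP/(_ ij) := iI i; rewrite E ltnn.
Qed.

Lemma nth_codom_ord p (J : 'I_p -> 'I_n) x (i : 'I_p) : nth x (codom J) i = J i.
Proof. by rewrite (nth_map i) ?size_enum_ord // nth_ord_enum. Qed.

Lemma increasing_sorted p (I : {ffun 'I_p -> 'I_n}) : increasing I ->
  sorted (relpre val ltn) (codom I).
Proof.
move=> iI; apply: (@homo_sorted _ _ _ (relpre val ltn)).
  by move=> i j ij; have /forallP/(_ i)/forallP/(_ j)/implyP/(_ ij) := iI.
by rewrite -sorted_map val_enum_ord iota_ltn_sorted.
Qed.

(** Two strictly increasing words with the same letters are equal, and an injective word determines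
    the permutation applied to it. *)
Lemma increasing_perm_uniq p (I I' : {ffun 'I_p -> 'I_n}) (s s' : 'S_p) :
  increasing I -> increasing I' -> I \o s =1 I' \o s' -> (I, s) = (I', s').
Proof.
move=> iI iI' E.
have II' : codom I = codom I'.
  apply: (@irr_sorted_eq _ (relpre val ltn)); rewrite ?increasing_sorted //.
  - by move=> ? ? ?; exact: ltn_trans.
  - by move=> ?; rewrite /= ltnn.
  move=> x; apply/codomP/codomP => -[i ->].
    by exists (s' ((s^-1)%g i)); have /= := E ((s^-1)%g i); rewrite permKV.
  by exists (s ((s'^-1)%g i)); have /= := E ((s'^-1)%g i); rewrite permKV.
have {}II' : I = I'.
  by apply/ffunP => i; rewrite -(nth_codom_ord I (I i)) II' nth_codom_ord.
rewrite -II' in E iI' *; congr (_, _); apply/permP => i.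
exact: increasing_inj (E i).
Qed.

Lemma increasing_permP p (J : {ffun 'I_p -> 'I_n}) : injective J ->
  exists I : {ffun 'I_p -> 'I_n}, exists s : 'S_p,
    increasing I /\ J = [ffun i => I (s i)].
Proof.
move=> Jinj; pose t := [tuple J i | i < p].
have tE : val t = codom J by [].
have : perm_eq (sort (relpre val leq) t) t by rewrite perm_sort.
case/tuple_permP => s sE; exists [ffun i => J (s i)], (s^-1)%g; split; last first.
  by apply/ffunP => i; rewrite !ffunE permKV.
have S : sorted ltn [seq val i | i <- sort (relpre val leq) t].
  rewrite ltn_sorted_uniq_leq (map_inj_uniq val_inj) sort_uniq tE.
  rewrite map_inj_uniq ?enum_uniq // sorted_map sort_sorted // => x y /=.
  exact: leq_total.
apply/forallP => i; apply/forallP => j; apply/implyP => ij.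
rewrite !ffunE.
have /= := sorted_ltn_nth ltn_trans 0%N S.
rewrite sE => /(_ i j); rewrite !inE size_map. rewrite size_tuple !ltn_ord => /(_ isT isT ij).
by rewrite !(nth_map (J i)) ?size_tuple ?ltn_ord // -!tnth_nth !tnth_mktuple.
Qed.

(** Sorting partitions the injective words into classes, one for each increasing word; a class has
    p! members and [F] is constant on it. *)
Lemma sum_injective_sorted p (F : {ffun 'I_p -> 'I_n} -> R) :
  (forall (J : {ffun 'I_p -> 'I_n}) (s : 'S_p), F ([ffun i => J (s i)]) = F J) ->
  \sum_(J : {ffun 'I_p -> 'I_n} | injectiveb J) F J = p`!%:R * \sum_(I | increasing I) F I.
Proof.
move=> FP; pose h (Is : {ffun 'I_p -> 'I_n} * 'S_p) := [ffun i => Is.1 (Is.2 i)].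
(* The default pair is returned only for words with a repeated letter, which do not occur in the
   sum. *)
pose h' (J : {ffun 'I_p -> 'I_n}) := odflt (J, 1%g)
  [pick Is : {ffun 'I_p -> 'I_n} * 'S_p | increasing Is.1 && (J == h Is)].
rewrite (reindex_onto h h') => [|J /injectiveP /increasing_permP[I [s [iI JE]]]].
  rewrite (eq_bigl (fun Is => increasing Is.1 && true)) => [|[I s]].
    rewrite -(pair_big (@increasing n p) xpredT (fun I s => F (h (I, s)))) /=.
    rewrite mulr_sumr; apply: eq_bigr => I _.
    rewrite (eq_bigr (fun _ => F I)) => [|s _]; last exact: FP.
    by rewrite sumr_const card_Sn mulr_natl.
  rewrite /= andbT; apply/andP/idP => [[/injectiveP hinj /eqP]|iI].
    rewrite /h'; case: pickP => [Is /andP[iI _] /= E|E]; first by rewrite E in iI.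
    have [I' [s' [iI' hE]]] := increasing_permP hinj.
    by have := E (I', s'); rewrite /= iI' hE eqxx.
  split; first by apply/injectiveP => i j; rewrite !ffunE => /(increasing_inj iI)/perm_inj.
  rewrite /h'; case: pickP => [[I' s'] /andP[/= iI' /eqP E]|/(_ (I, s))].
    apply/eqP/increasing_perm_uniq => // i.
    by move/ffunP/(_ i): E; rewrite !ffunE.
  by rewrite /= iI eqxx.
rewrite /h'; case: pickP => [Is /andP[_ /eqP]//|/(_ (I, s))].
by rewrite /= iI JE eqxx.
Qed.

(** Words with a repetition have coefficient zero; on the others [C] and the coefficient change by
    the same sign under a permutation, so the p! rearrangements of a word contribute equally. *)
Lemma ctr_increasing p C (a : ext_form R n p) : altseq C ->
  ctr C a = \sum_(I : {ffun 'I_p -> 'I_n} | increasing I) C (codom I) * ext_coef I a.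
Proof.
move=> aC; rewrite /ctr (bigID (fun J : {ffun 'I_p -> 'I_n} => injectiveb J)) /=.
rewrite [X in _ + X]big1 ?addr0 => [|J Jinj]; last by rewrite ext_coef_Ninj ?mulr0.
rewrite sum_injective_sorted => [|J s].
  by rewrite mulKf // pnatr_eq0 -lt0n fact_gt0.
rewrite ext_coef_perm (eq_codom (ffunE _)) altseq_perm // mulrACA -expr2.
by rewrite sqrr_sign mul1r.
Qed.

Lemma ext_dot_ctr p (c a : ext_form R n p) : ext_dot c a = ctr (seqform c) a.
Proof.
rewrite ctr_increasing; last exact: altseq_seqform.
by apply: eq_bigr => I _; rewrite seqform_codom.
Qed.

End sorting.

(** * Contraction against exterior products *)

Section pairing.
Context {R : realType} {n : nat}.
Implicit Types C : seq 'I_n -> R.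

Lemma enum_ordD p q :
  enum 'I_(p + q) = map (lshift q) (enum 'I_p) ++ map (@rshift p q) (enum 'I_q).
Proof.
have vE m : map (@nat_of_ord m) (enum 'I_m) = iota 0 m := val_enum_ord m.
apply: (inj_map (@ord_inj _)); rewrite vE map_cat -(map_comp _ (lshift q)) -(map_comp _ (@rshift p q)) iotaD.
congr (_ ++ _); first by rewrite -vE; exact: eq_map.
by rewrite add0n -[p in LHS]addn0 iotaDl -vE -map_comp; exact: eq_map.
Qed.

Lemma codom_split p q (J : 'I_(p + q) -> 'I_n) :
  codom J = codom (J \o lshift q) ++ codom (J \o @rshift p q).
Proof. by rewrite /codom /image_mem enum_ordD map_cat -(map_comp _ (lshift q))
  -(map_comp _ (@rshift p q)). Qed.

Lemma ext_coef_wedge p q (a : ext_form R n p) (b : ext_form R n q)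
    (J : {ffun 'I_(p + q) -> 'I_n}) :
  ext_coef J (wedge a b) = (p`! * q`!)%:R^-1 * \sum_(s : 'S_(p + q)) (-1) ^+ s *
    (ext_coef [ffun i => J (s (lshift q i))] a *
     ext_coef [ffun i => J (s (rshift p i))] b).
Proof.
rewrite /ext_coef /= /wedge_fun; congr (_ * _); apply: eq_bigr => s _.
congr (_ * (ext_form_fun a _ * ext_form_fun b _));
  by apply/matrixP => i j; rewrite !mxE ffunE.
Qed.

Lemma sum_ffun_split p q (F : {ffun 'I_(p + q) -> 'I_n} -> R) :
  \sum_J F J = \sum_(J1 : {ffun 'I_p -> 'I_n}) \sum_(J2 : {ffun 'I_q -> 'I_n})
    F [ffun i => match fintype.split i with inl j => J1 j | inr j => J2 j end].
Proof.
rewrite pair_big /=.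
rewrite (reindex (fun J12 : {ffun 'I_p -> 'I_n} * {ffun 'I_q -> 'I_n} =>
  [ffun i => match fintype.split i with inl j => J12.1 j | inr j => J12.2 j end])) //=.
exists (fun J : {ffun 'I_(p + q) -> 'I_n} =>
  ([ffun i => J (lshift q i)], [ffun i => J (rshift p i)])).
  move=> [J1 J2] _ /=; congr (_, _); apply/ffunP => i; rewrite !ffunE.
    by rewrite (unsplitK (inl _ i)).
  by rewrite (unsplitK (inr _ i)).
move=> J _; apply/ffunP => i; rewrite !ffunE; case: split_ordP => j ->;
by rewrite ffunE.
Qed.

(** Reindexing the words by each permutation [s] from the definition of [wedge], the sign of [s]
    cancels the sign that [C] produces. The (p+q)! equal terms then absorb the weight of [ctr], and
    the weight 1/(p! q!) left over is that of the two successive contractions. *)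
Lemma ctr_wedge p q C (a : ext_form R n p) (b : ext_form R n q) : altseq C ->
  ctr C (wedge a b) = ctr (fun l => ctr (fun l' => C (l ++ l')) b) a.
Proof.
move=> aC; pose G (J : {ffun 'I_(p + q) -> 'I_n}) :=
  ext_coef [ffun i => J (lshift q i)] a * ext_coef [ffun i => J (rshift p i)] b.
have -> : ctr C (wedge a b) =
    (p`! * q`!)%:R^-1 * \sum_(J : {ffun 'I_(p + q) -> 'I_n}) C (codom J) * G J.
  rewrite /ctr; under eq_bigr => J _ do
    rewrite ext_coef_wedge mulrCA mulr_sumr.
  rewrite -mulr_sumr exchange_big /= mulrCA; congr (_ * _).
  under eq_bigr => s _.
    rewrite (_ : \sum_J _ = \sum_(J : {ffun 'I_(p + q) -> 'I_n}) C (codom J) * G J).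
      over.
    rewrite [RHS](reindex (fun J : {ffun 'I_(p + q) -> 'I_n} =>
      [ffun i => J (s i)])) /=; last first.
      exists (fun J : {ffun 'I_(p + q) -> 'I_n} => [ffun i => J ((s^-1)%g i)]).
        by move=> J _; apply/ffunP => i; rewrite !ffunE permKV.
      by move=> J _; apply/ffunP => i; rewrite !ffunE permK.
    apply: eq_bigr => J _; rewrite (eq_codom (ffunE _)) altseq_perm // mulrA.
    rewrite [C _ * _]mulrC; congr (_ * (ext_coef _ a * ext_coef _ b));
      by apply/ffunP => i; rewrite !ffunE.
  rewrite sumr_const card_Sn -(mulr_natl (\sum_J _)) mulKf //.
rewrite sum_ffun_split /ctr natrM invfM -mulrA; congr (_ * _); rewrite mulr_sumr.
apply: eq_bigr => J1 _; rewrite -[RHS]mulrA; congr (_ * _); rewrite mulr_suml.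
apply: eq_bigr => J2 _; rewrite codom_split mulrA mulrAC; congr (_ * _); last first.
  by congr ext_coef; apply/ffunP => i; rewrite !ffunE (unsplitK (inl _ i)).
congr (C (_ ++ _) * ext_coef _ b).
- by apply: eq_codom => i; rewrite /= ffunE (unsplitK (inl _ i)).
- by apply: eq_codom => i; rewrite /= ffunE (unsplitK (inr _ i)).
- by apply/ffunP => i; rewrite !ffunE (unsplitK (inr _ i)).
Qed.

Lemma eq_ctr p C C' (a : ext_form R n p) :
  (forall l, size l = p -> C l = C' l) -> ctr C a = ctr C' a.
Proof.
move=> E; rewrite /ctr; congr (_ * _); apply: eq_bigr => J _; rewrite E //.
by rewrite size_codom card_ord.
Qed.

Lemma ctrDr p C (a b : ext_form R n p) : ctr C (a + b) = ctr C a + ctr C b.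
Proof.
rewrite /ctr -mulrDr -big_split /=; congr (_ * _); apply: eq_bigr => J _.
by rewrite -mulrDr.
Qed.

Lemma ctrZr p C (a : ext_form R n p) x : ctr C (x *: a) = x * ctr C a.
Proof.
rewrite /ctr [RHS]mulrCA; congr (_ * _); rewrite mulr_sumr; apply: eq_bigr => J _.
by rewrite mulrCA.
Qed.

Lemma ctr0r p C : ctr C (0 : ext_form R n p) = 0.
Proof. by rewrite -[X in ctr _ X](scale0r 0) ctrZr mul0r. Qed.

Lemma ctr_sumr p C I (r : seq I) (P : pred I) (a : I -> ext_form R n p) :
  ctr C (\sum_(i <- r | P i) a i) = \sum_(i <- r | P i) ctr C (a i).
Proof. by apply: big_morph; [exact: ctrDr|exact: ctr0r]. Qed.

Lemma ctrDl p C C' (a : ext_form R n p) :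
  ctr (fun l => C l + C' l) a = ctr C a + ctr C' a.
Proof.
rewrite /ctr -mulrDr -big_split /=; congr (_ * _); apply: eq_bigr => J _.
by rewrite -mulrDl.
Qed.

Lemma ctrZl p C (a : ext_form R n p) x : ctr (fun l => x * C l) a = x * ctr C a.
Proof.
rewrite /ctr [RHS]mulrCA; congr (_ * _); rewrite mulr_sumr; apply: eq_bigr => J _.
by rewrite mulrA.
Qed.

Lemma ctrNl p C (a : ext_form R n p) : ctr (fun l => - C l) a = - ctr C a.
Proof. by rewrite -mulN1r -ctrZl; apply: eq_ctr => l _; rewrite mulN1r. Qed.

Lemma ctr_suml p I (r : seq I) (P : pred I) (C : I -> seq 'I_n -> R) (a : ext_form R n p) :
  ctr (fun l => \sum_(i <- r | P i) C i l) a = \sum_(i <- r | P i) ctr (C i) a.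
Proof.
elim: r => [|i r IH].
  rewrite big_nil /ctr big1 ?mulr0 // => J _; by rewrite big_nil mul0r.
rewrite big_cons -IH; case: ifP => Pi.
  by rewrite -ctrDl; apply: eq_ctr => l _; rewrite big_cons Pi.
by apply: eq_ctr => l _; rewrite big_cons Pi.
Qed.

Lemma altseq_ctr p C (a : ext_form R n p) : altseq C ->
  altseq (fun l => ctr (fun l' => C (l ++ l')) a).
Proof.
by move=> aC q i j r; rewrite -ctrNl; apply: eq_ctr => l _; rewrite -!catA aC.
Qed.

Lemma ctr_ext_cast p q (e : p = q) C (a : ext_form R n p) :
  ctr C (ext_cast e a) = ctr C a.
Proof. by case: q / e. Qed.

Lemma ffun_ord0_eq (T : Type) (J J' : {ffun 'I_0 -> T}) : J = J'.
Proof. by apply/ffunP => -[]. Qed.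

Lemma ctr_cst C x : ctr C (cst_form x : ext_form R n 0) = C [::] * x.
Proof.
pose J0 : {ffun 'I_0 -> 'I_n} := [ffun i : 'I_0 =>
  False_rect 'I_n (notF (ltn_ord i))].
rewrite /ctr fact0 invr1 mul1r (big_pred1 J0) => [|J]; last first.
  by rewrite /= (ffun_ord0_eq J J0) eqxx.
congr (C _ * _); apply: size0nil; by rewrite size_codom card_ord.
Qed.

Lemma ctr_dual C i : ctr C (dual_form i : ext_form R n 1) = C [:: i].
Proof.
have cE (J : {ffun 'I_1 -> 'I_n}) : codom J = [:: J 0].
  by rewrite /codom /image_mem enum_ordSl enum_ord0.
rewrite /ctr invr1 mul1r (bigD1 [ffun=> i]) //= big1 ?addr0 => [|J Ji].
  by rewrite /ext_coef /= !mxE ffunE !eqxx mulr1 cE ffunE.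
rewrite /ext_coef /= !mxE eqxx /=; case: eqP => [E|]; rewrite ?mulr0 //.
by case/eqP: Ji; apply/ffunP => j; rewrite ffunE (ord1 j).
Qed.

(* By multilinearity one may replace the rows by basis vectors one at a time;
   m counts the rows already known to be arbitrary. *)
Lemma ext_form_eq0 p (a : ext_form R n p) : (forall J, ext_coef J a = 0) -> a = 0.
Proof.
move=> a0.
suff H m (A : 'M[R]_(p, n)) :
    (forall i : 'I_p, (m <= i)%N -> exists j, row i A = delta_mx 0 j) -> a A = 0.
  by apply/val_inj/funext => A; apply: (H p) => i; rewrite leqNgt ltn_ord.
elim: m A => [|m IH] A Am.
  have /(_ _ (leq0n _))/cid-/all_sig[J JE] := Am.
  rewrite -(a0 [ffun i => J i]); congr (ext_form_fun a _).
  by apply/row_matrixP => i; rewrite JE rowK ffunE.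
have [mp|pm] := ltnP m p; last first.
  by apply: IH => i mi; have := leq_trans pm mi; rewrite leqNgt ltn_ord.
pose i0 := Ordinal mp.
pose B (u : 'rV[R]_n) : 'M[R]_(p, n) := \matrix_(i < p) if i == i0 then u else row i A.
have BA : B (row i0 A) = A.
  by apply/row_matrixP => i; rewrite rowK; case: eqP => // ->.
have BD (x : R) u v : a (B (x *: u + v)) = x * a (B u) + a (B v).
  rewrite -[a (B v)]mul1r; apply: (@ext_form_lin _ _ _ _ i0) => [|j ji|j ji].
  - by rewrite !rowK eqxx scale1r.
  - by rewrite !rowK (negPf ji).
  - by rewrite !rowK (negPf ji).
have B0 : a (B 0) = 0.
  by have := BD (-1) 0 0; rewrite scaler0 addr0 mulN1r addNr.
rewrite -BA (row_sum_delta (row i0 A)).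
elim/big_ind : _ => [//|u v u0 v0|j _].
  by rewrite -[u]scale1r BD mul1r u0 v0 addr0.
rewrite -[_ *: _]addr0 BD B0 addr0 IH ?mulr0 // => i mi; rewrite rowK.
have [_|ii0] := eqVneq i i0; first by exists j.
apply: Am; rewrite ltn_neqAle mi andbT; apply: contraNneq ii0 => mE.
exact/eqP/val_inj.
Qed.

(** For [d = a - b], contraction with [seqform d] is 1/p! times the sum of the squares of all
    coefficients of [d]. Identities between forms are reduced below to this test, under which degree
    casts disappear by [ctr_ext_cast]. *)
Lemma ctr_inj p (a b : ext_form R n p) :
  (forall C, altseq C -> ctr C a = ctr C b) -> a = b.
Proof.
move=> E; apply/eqP; rewrite -subr_eq0; apply/eqP/ext_form_eq0 => J.
set d := a - b.
have /eqP : ctr (seqform d) d = 0.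
  by rewrite ctrDr -scaleN1r ctrZr E ?mulN1r ?subrr //; exact: altseq_seqform.
rewrite mulf_eq0 invr_eq0 pnatr_eq0 -[_ == 0%N]negbK -lt0n fact_gt0 /=.
rewrite psumr_eq0 => [/allP/(_ J)|K _]; last by rewrite seqform_codom -expr2 sqr_ge0.
by rewrite mem_index_enum seqform_codom mulf_eq0 orbb => /(_ isT)/eqP.
Qed.

Fixpoint ebasis (l : seq 'I_n) : ext_form R n (size l) :=
  if l is i :: l' then wedge (dual_form i) (ebasis l') else cst_form 1.

Lemma ctr_ebasis C l : altseq C -> ctr C (ebasis l) = C l.
Proof.
elim: l C => [|i l IH] C aC /=; first by rewrite ctr_cst mulr1.
rewrite [LHS](ctr_wedge (dual_form i) (ebasis l) aC) ctr_dual.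
by rewrite (IH (fun l' => C ([:: i] ++ l'))) //; exact: altseq_catl.
Qed.

End pairing.

(** * One affine functions are polynomials in the powers *)

Section affine_algebra.
Context {R : realType} {n : nat}.
Implicit Types C : seq 'I_n -> R.

(** Zero on words of the wrong length, so that a word can be used in degree [m] without carrying a
    proof about its size. *)
Definition ebasisn m (l : seq 'I_n) : ext_form R n m :=
  if pselect (size l = m) is left e then ext_cast e (ebasis l) else 0.

Lemma ctr_ebasisn m C l : altseq C -> size l = m -> ctr C (ebasisn m l) = C l.
Proof.
move=> aC sl; rewrite /ebasisn; case: pselect => // e.
by rewrite ctr_ext_cast ctr_ebasis.
Qed.

Lemma ext_form_sum_ebasis m (a : ext_form R n m) :
  a = \sum_(J : {ffun 'I_m -> 'I_n}) (m`!%:R^-1 * ext_coef J a) *: ebasisn m (codom J).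
Proof.
apply: ctr_inj => C aC; rewrite ctr_sumr [LHS]/ctr mulr_sumr; apply: eq_bigr => J _.
rewrite ctrZr ctr_ebasisn //; last by rewrite size_codom card_ord.
by rewrite -!mulrA [C _ * _]mulrC.
Qed.

Lemma ext_dotC m (a b : ext_form R n m) : ext_dot a b = ext_dot b a.
Proof. by apply: eq_bigr => I _; rewrite mulrC. Qed.

Lemma ext_dot_riesz m (L : ext_form R n m -> R) :
    (forall a b, L (a + b) = L a + L b) -> (forall t a, L (t *: a) = t * L a) ->
  exists c, forall a, ext_dot c a = L a.
Proof.
move=> LD LZ; have L0 : L 0 = 0 by rewrite -(scale0r 0) LZ mul0r.
exists (\sum_(J : {ffun 'I_m -> 'I_n})
  (m`!%:R^-1 * L (ebasisn m (codom J))) *: ebasisn m (codom J)) => a.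
rewrite ext_dotC ext_dot_ctr ctr_sumr [in RHS](ext_form_sum_ebasis a).
rewrite (big_morph L LD L0); apply: eq_bigr => J _.
rewrite ctrZr LZ ctr_ebasisn ?size_codom ?card_ord //; last exact: altseq_seqform.
by rewrite seqform_codom mulrAC.
Qed.

Lemma ext_dot_cst (x y : R) : ext_dot (cst_form x : ext_form R n 0) (cst_form y) = x * y.
Proof.
rewrite ext_dot_ctr ctr_cst; congr (_ * _).
by rewrite /seqform; case: insubP => [t _ _|/negP[]].
Qed.

Section one_affine.
Context {k : nat} (k_gt0 : (0 < k)%N).
Implicit Types (f : ext_form R n k -> R) (x y z : ext_form R n k).

Definition wdg (a : ext_form R n k.-1) (b : ext_form R n 1) : ext_form R n k :=
  ext_cast (pred_addn1 k_gt0) (wedge a b).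

Lemma ctr_wdg C a b : altseq C ->
  ctr C (wdg a b) = ctr (fun l => ctr (fun l' => C (l ++ l')) b) a.
Proof. by move=> aC; rewrite ctr_ext_cast ctr_wedge. Qed.

(** Combinations of two products sharing a factor are again products. This, on either side, is what
    supplies the planes of admissible directions required by [diff2_eq0]. *)
Lemma wdgZDl s t a a' b : s *: wdg a b + t *: wdg a' b = wdg (s *: a + t *: a') b.
Proof.
by apply: ctr_inj => C aC; rewrite ctrDr !ctrZr !ctr_wdg // ctrDr !ctrZr.
Qed.

Lemma wdgZDr s t a b b' : s *: wdg a b + t *: wdg a b' = wdg a (s *: b + t *: b').
Proof.
apply: ctr_inj => C aC; rewrite ctrDr !ctrZr !ctr_wdg // -!ctrZl -ctrDl.
by apply: eq_ctr => l _; rewrite ctrDr !ctrZr.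
Qed.

Lemma wdgDr a b b' : wdg a (b + b') = wdg a b + wdg a b'.
Proof. by have := wdgZDr 1 1 a b b'; rewrite !scale1r. Qed.

(** Splitting off the last letter here, and the first one in [ebasisn_cons], makes the two letters
    on either side of a block boundary appear as the 1-form factors that [diff2_swap] exchanges. *)
Lemma ebasisn_rcons p i : size p = k.-1 ->
  ebasisn k (rcons p i) = wdg (ebasisn k.-1 p) (dual_form i).
Proof.
move=> sp; apply: ctr_inj => C aC; rewrite ctr_wdg // ctr_ebasisn //; last first.
  by rewrite size_rcons sp prednK.
rewrite -(@ctr_ebasisn k.-1 (fun l => C (rcons l i))) //; last first.
  by move=> q j j' r; rewrite !rcons_cat /= aC.
by apply: eq_ctr => l _; rewrite ctr_dual cats1.
Qed.

Lemma ebasisn_cons p i : size p = k.-1 ->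
  ebasisn k (i :: p) = wdg ((-1) ^+ k.-1 *: ebasisn k.-1 p) (dual_form i).
Proof.
move=> sp; apply: ctr_inj => C aC; rewrite ctr_wdg // ctr_ebasisn //; last first.
  by rewrite /= sp prednK.
rewrite ctrZr; have := @altseq_move _ _ C [::] i p [::] aC.
rewrite /= !cats0 cats1 sp => ->; congr (_ * _).
rewrite -(@ctr_ebasisn k.-1 (fun l => C (rcons l i))) //; last first.
  by move=> q j j' r; rewrite !rcons_cat /= aC.
by apply: eq_ctr => l _; rewrite ctr_dual cats1.
Qed.

Lemma ebasisn_swap p i j r : ebasisn k (p ++ i :: j :: r) = - ebasisn k (p ++ j :: i :: r).
Proof.
have [sl|sl] := eqVneq (size (p ++ i :: j :: r)) k; last first.
  by rewrite /ebasisn; do 2![case: pselect => [e|_];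
    [by rewrite -e !size_cat eqxx in sl|]]; rewrite oppr0.
apply: ctr_inj => C aC; rewrite -scaleN1r ctrZr !ctr_ebasisn //.
  by rewrite aC mulN1r.
by rewrite -sl !size_cat.
Qed.

Lemma ebasisn_wdg l : exists a b, ebasisn k l = wdg a b.
Proof.
have [sl|sl] := eqVneq (size l) k; last first.
  exists 0, 0; rewrite /ebasisn; case: pselect => [e|_]; first by rewrite e eqxx in sl.
  by have := wdgZDr 0 0 0 0 0; rewrite !scale0r !addr0.
case: l sl => [k0|i p /= sp]; first by exfalso; move: (k_gt0); rewrite -k0.
exists ((-1) ^+ k.-1 *: ebasisn k.-1 p), (dual_form i).
by rewrite -ebasisn_cons // -sp.
Qed.

Definition diff v f : ext_form R n k -> R := fun x => f (x + v) - f x.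

Lemma diffC v w f : diff v (diff w f) = diff w (diff v f).
Proof. by apply/funext => x; rewrite /diff (addrAC x); ring. Qed.

Lemma one_affine_diff v f : ext_one_affine k_gt0 f -> ext_one_affine k_gt0 (diff v f).
Proof.
move=> fa x a b; have [c0 [c1 E]] := fa (x + v) a b; have [d0 [d1 E']] := fa x a b.
exists (c0 - d0), (c1 - d1) => t; rewrite /diff (addrAC x) E E'; ring.
Qed.

Lemma one_affine_shift v f : ext_one_affine k_gt0 f ->
  ext_one_affine k_gt0 (fun x => f (v + x)).
Proof.
move=> fa x a b; have [c0 [c1 E]] := fa (v + x) a b.
by exists c0, c1 => t; rewrite addrA E.
Qed.

Lemma diff_scale f t a b : ext_one_affine k_gt0 f ->
  diff (t *: wdg a b) f = fun x => t * diff (wdg a b) f x.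
Proof.
move=> fa; apply/funext => x; have [c0 [c1 E]] := fa x a b.
have := E 1; have := E 0; have := E t; rewrite scale0r scale1r addr0 /diff.
by rewrite -/(wdg a b) => -> -> ->; ring.
Qed.

(** [f] is affine on the three sides of the triangle [x], [x + 2u], [x + 2v], whose midpoints are
    [x + u], [x + v] and [x + u + v]; the three midpoint relations combine to the vanishing of the
    second difference. *)
Lemma diff2_eq0 f u v : ext_one_affine k_gt0 f ->
  (forall s t, exists a b, s *: u + t *: v = wdg a b) -> diff u (diff v f) = fun=> 0.
Proof.
move=> fa uv; apply/funext => x; rewrite /diff.
have [a [b E1]] := uv 2 0; have [a' [b' E2]] := uv (-2) 2.
have [a'' [b'' E3]] := uv 0 2.
have [c0 [c1 F1]] := fa x a b; have [d0 [d1 F2]] := fa (x + 2 *: u) a' b'.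
have [e0 [e1 F3]] := fa x a'' b''.
rewrite -/(wdg a b) -E1 scale0r addr0 in F1.
rewrite -/(wdg a' b') -E2 in F2.
rewrite -/(wdg a'' b'') -E3 scale0r add0r in F3.
have half (w : ext_form R n k) : 2^-1 *: (2 *: w) = w.
  by rewrite scalerA mulVf ?scale1r // pnatr_eq0.
have E (w : ext_form R n k) : x + 2 *: u + (- (2 *: u) + w) = x + w.
  by rewrite addrA addrK.
have E' : x + 2 *: u + 2^-1 *: (- (2 *: u) + 2 *: v) = x + u + v.
  rewrite scalerDr scalerN !half (_ : 2 *: u = u + u) ?scaler_nat ?mulr2n //.
  by rewrite addrA (addrA x u u) addrK.
move: (F1 0) (F1 2^-1) (F1 1) (F2 0) (F2 2^-1) (F2 1) (F3 0) (F3 2^-1) (F3 1).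
rewrite scaleNr E' !half !scale1r E !scale0r !addr0; lra.
Qed.

Lemma diffD f a b b' : ext_one_affine k_gt0 f ->
  diff (wdg a (b + b')) f = fun x => diff (wdg a b) f x + diff (wdg a b') f x.
Proof.
move=> fa; apply/funext => x.
have /(congr1 (@^~ x)) : diff (wdg a b) (diff (wdg a b') f) = fun=> 0.
  by apply: diff2_eq0 => // s t; rewrite wdgZDr; exists a, (s *: b + t *: b').
by rewrite /diff wdgDr addrA => E; rewrite -[RHS]addr0 -E; ring.
Qed.

(* Polarizing b |-> diff (a /\ b) (diff (a' /\ b) f) = 0. *)
Lemma diff2_swap f a a' b b' : ext_one_affine k_gt0 f ->
  diff (wdg a' b') (diff (wdg a b) f) =
  fun x => - diff (wdg a' b) (diff (wdg a b') f) x.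
Proof.
move=> fa; apply/funext => x.
have D0 c : diff (wdg a' c) (diff (wdg a c) f) = fun=> 0.
  by apply: diff2_eq0 => // s t; rewrite wdgZDl; exists (s *: a' + t *: a), c.
have dD w g h y : diff w (fun z => g z + h z) y = diff w g y + diff w h y.
  by rewrite /diff; ring.
have := congr1 (@^~ x) (D0 (b + b')).
rewrite diffD; last exact: one_affine_diff.
rewrite (diffD a b b' fa); cbv beta.
by rewrite (dD (wdg a' b)) (dD (wdg a' b')) !D0 addr0 add0r => /eqP;
  rewrite addr_eq0 => /eqP ->; rewrite opprK.
Qed.

(* On a concatenation of s basis k-forms, the iterated difference of f at 0. *)
Fixpoint polar s f (l : seq 'I_n) : R :=
  if s is s'.+1 then polar s' (diff (ebasisn k (take k l)) f) (drop k l) else f 0.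

Definition polarn s f (l : seq 'I_n) : R := if size l == (s * k)%N then polar s f l else 0.

Lemma polarN s f l : polar s (fun x => - f x) l = - polar s f l.
Proof.
elim: s f l => //= s IH f l; rewrite -IH; congr polar; apply/funext => x.
by rewrite /diff; ring.
Qed.

Lemma polar_cat s f (J : {ffun 'I_k -> 'I_n}) l :
  polar s.+1 f (codom J ++ l) = polar s (diff (ebasisn k (codom J)) f) l.
Proof.
by rewrite /= take_size_cat ?drop_size_cat // size_codom card_ord.
Qed.

(** The swapped pair lies beyond the first block (induction), inside it (the basis form changes
    sign, and the difference with it), or across its right boundary. The last case is the
    substantial one and rests on [diff2_swap]. *)
Lemma polar_swap s f p i j r : ext_one_affine k_gt0 f ->
  size (p ++ i :: j :: r) = (s * k)%N ->
  polar s f (p ++ i :: j :: r) = - polar s f (p ++ j :: i :: r).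
Proof.
elim: s f p => [|s IH] f p fa /=; first by rewrite size_cat /= !addnS.
rewrite mulSn => sl.
have [kp|pk] := leqP k (size p).
  rewrite !takel_cat // !drop_cat; case: ltnP => kp'.
    by apply: IH; [exact: one_affine_diff|move: sl; rewrite !size_cat size_drop /=; lia].
  have -> : (k - size p)%N = 0%N by apply/eqP; rewrite subn_eq0.
  rewrite !drop0; apply: (IH _ [::]); first exact: one_affine_diff.
  by move: sl; rewrite size_cat /=; lia.
rewrite !take_cat !drop_cat ltnNge (ltnW pk) /=.
have [kp1|kp1] := eqVneq (size p).+1 k; last first.
  have -> : (k - size p = (k - size p - 2).+2)%N by move: kp1; lia.
  rewrite /= ebasisn_swap; have [a [b ->]] := ebasisn_wdg (p ++ j :: i :: take (k - size p - 2) r).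
  rewrite -scaleN1r diff_scale // -polarN; congr polar; apply/funext => x.
  by rewrite mulN1r.
have -> : (k - size p = 1)%N by rewrite -kp1; lia.
(* A pair across the boundary requires a second block; with a single block the length is too
   large. *)
rewrite /= ?take0 ?drop0; case: s IH sl => [|s] _ sl.
  by move: sl; rewrite size_cat /=; lia.
have sr : size (take k.-1 r) = k.-1.
  by rewrite size_takel //; move: sl; rewrite size_cat /= mulSn; lia.
have tE i' : take k (i' :: r) = i' :: take k.-1 r by rewrite -[k]prednK.
have dE i' : drop k (i' :: r) = drop k.-1 r by rewrite -[k]prednK.
rewrite /= !tE !dE !cats1.
have sp : size p = k.-1 by rewrite -kp1.
rewrite !ebasisn_cons // !ebasisn_rcons // -polarN diff2_swap //.
Qed.

Lemma altseq_polarn s f : ext_one_affine k_gt0 f -> altseq (polarn s f).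
Proof.
move=> fa p i j r; rewrite /polarn !size_cat /=; case: eqP => [E|]; last by rewrite oppr0.
by apply: polar_swap => //; rewrite size_cat.
Qed.

End one_affine.
End affine_algebra.

(** * Finite Taylor expansion of a one affine function *)

Section taylor.
Context {R : realType} {n k : nat} (k_gt0 : (0 < k)%N).
Implicit Types (f : ext_form R n k -> R) (y : {ffun 'I_k -> 'I_n} -> R).

Definition basis_comb y : ext_form R n k := \sum_J y J *: ebasisn k (codom J).

(* The s-th term of the Taylor expansion of f at 0, times s!, in the
   (redundant) coordinates y of basis_comb. *)
Fixpoint taylor s f y : R :=
  if s is s'.+1 then \sum_J y J * taylor s' (diff (ebasisn k (codom J)) f) y
  else f 0.

Lemma taylorS s f y :
  taylor s.+1 f y = \sum_J y J * taylor s (diff (ebasisn k (codom J)) f) y.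
Proof. by []. Qed.

Definition bump1 (J : {ffun 'I_k -> 'I_n}) (t : R) y := fun K => y K + (t *+ (K == J)).

Lemma basis_comb_bump J t y :
  basis_comb (bump1 J t y) = basis_comb y + t *: ebasisn k (codom J).
Proof.
rewrite /basis_comb /bump1; under eq_bigr => K _ do rewrite scalerDl.
rewrite big_split /=; congr (_ + _); rewrite (bigD1 J) //= eqxx big1 ?addr0 // => K KJ.
by rewrite (negPf KJ) scale0r.
Qed.

Lemma taylor0 s y : taylor s (fun=> 0) y = 0.
Proof.
elim: s => //= s IH; rewrite big1 // => J _.
by rewrite (_ : diff _ _ = fun=> 0) ?IH ?mulr0 //; apply/funext => x; rewrite /diff subrr.
Qed.

(** Consequently [f] is affine in each coordinate separately: no coordinate occurs squared in its
    expansion. *)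
Lemma diff2_ebasisn l f : ext_one_affine k_gt0 f ->
  diff (ebasisn k l) (diff (ebasisn k l) f) = fun=> 0.
Proof.
move=> fa; apply: (diff2_eq0 (k_gt0 := k_gt0)) => // s t; have [a [b ->]] := @ebasisn_wdg R n k k_gt0 l.
by rewrite wdgZDl; exists (s *: a + t *: a), b.
Qed.

(** The Taylor term is homogeneous of degree [s.+1], symmetric by [diffC], and affine in the
    coordinate [J] because repeated differences along one basis form vanish. Its increment is
    therefore exactly linear in [t], and the factor [s.+1] counts the positions at which [J] may
    occur. *)
Lemma taylor_bump s f J t y : ext_one_affine k_gt0 f ->
  taylor s.+1 f (bump1 J t y) =
  taylor s.+1 f y + s.+1%:R * t * taylor s (diff (ebasisn k (codom J)) f) y.
Proof.
elim: s f => [|s IH] f fa.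
  rewrite /= mul1r /bump1; under eq_bigr => K _ do rewrite mulrDl.
  rewrite big_split /=; congr (_ + _); rewrite (bigD1 J) //= eqxx big1 ?addr0 // => K KJ.
  by rewrite (negPf KJ) mul0r.
pose D (K : {ffun 'I_k -> 'I_n}) := diff (ebasisn k (codom K)) f.
pose B (K : {ffun 'I_k -> 'I_n}) := taylor s (diff (ebasisn k (codom J)) (D K)) y.
transitivity (\sum_K (y K * taylor s.+1 (D K) y + s.+1%:R * t * (y K * B K) +
    (t *+ (K == J)) * (taylor s.+1 (D K) y + s.+1%:R * t * B K))).
  rewrite taylorS; apply: eq_bigr => K _; rewrite IH; last exact: one_affine_diff.
  by rewrite [bump1 _ _ _ _]/bump1 -/(D K) -/(B K); ring.
rewrite !big_split /= -!mulr_sumr [X in _ + X](bigD1 J) //= eqxx.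
rewrite [X in _ + (_ + X)]big1 ?addr0 => [|K /negPf ->]; last by rewrite mul0r.
rewrite [B J]/B diff2_ebasisn // taylor0 mulr0 addr0 -addrA; congr (_ + _).
under eq_bigr => K _ do rewrite /B /D diffC.
rewrite -!taylorS mulr1n -[s.+2]addn1 natrD. ring.
Qed.

(** Changing one coordinate leaves the remainder unchanged, by the induction hypothesis for the
    difference of [f] along that basis form; switching the coordinates on one after the other from
    zero shows that the remainder vanishes. The hypothesis is made at every base point [x] because
    for [m = 0] it must give [f = 0] everywhere. *)
Lemma taylor_expansion m f y : ext_one_affine k_gt0 f ->
    (forall x l, size l = (m * k)%N -> polar m (fun z => f (x + z)) l = 0) ->
  f (basis_comb y) = \sum_(s < m) s`!%:R^-1 * taylor s f y.
Proof.
elim: m f y => [|m IH] f y fa fm.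
  by have := fm (basis_comb y) [::] erefl; rewrite big_ord0 /= addr0.
pose g y := f (basis_comb y) - \sum_(s < m.+1) s`!%:R^-1 * taylor s f y.
have gbump J t z : g (bump1 J t z) = g z.
  have fJ : f (basis_comb (bump1 J t z)) =
      f (basis_comb z) + t * diff (ebasisn k (codom J)) f (basis_comb z).
    have [a [b ab]] := @ebasisn_wdg R n k k_gt0 (codom J).
    rewrite basis_comb_bump ab.
    by have /(congr1 (@^~ (basis_comb z))) <- := diff_scale t a b fa; rewrite /diff [RHS]addrC subrK.
  rewrite /g fJ (IH (diff (ebasisn k (codom J)) f)); last 2 first.
  - exact: one_affine_diff.
  - move=> x l sl; rewrite -[RHS](fm x (codom J ++ l)); last first.
      by rewrite size_cat size_codom card_ord sl.
    rewrite polar_cat; congr polar; apply/funext => w.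
    by rewrite /diff addrA.
  rewrite !big_ord_recl mulr_sumr.
  under [X in _ - (_ + X) = _]eq_bigr => s _ do
    rewrite lift0 (taylor_bump s J t z fa) mulrDr.
  under [X in _ = _ - (_ + X)]eq_bigr => s _ do rewrite lift0.
  rewrite big_split /= [X in _ - (_ + (_ + X))](eq_bigr (fun s : 'I_m =>
    t * (s`!%:R^-1 * taylor s (diff (ebasisn k (codom J)) f) z))).
    by ring.
  move=> s _; rewrite factS natrM; field.
  by rewrite nat1r !pnatr_eq0 -lt0n fact_gt0.
have gr (r : seq {ffun 'I_k -> 'I_n}) : uniq r ->
    g (fun K => if K \in r then y K else 0) = g (fun=> 0).
  elim: r => // J r IHr /= /andP[Jr /IHr <-]; rewrite -[RHS](gbump J (y J)); congr g.
  apply/funext => K; rewrite /bump1 inE; have [->|KJ] := eqVneq K J.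
    by rewrite (negPf Jr) add0r.
  by rewrite addr0.
have g0 : g (fun=> 0) = 0.
  rewrite /g big_ord_recl /= big1 ?addr0 => [|s _]; last by rewrite big1 ?mulr0 // => J _; rewrite mul0r.
  by rewrite invr1 mul1r /basis_comb big1 ?subrr // => J _; rewrite scale0r.
have := gr _ (index_enum_uniq _); rewrite g0.
rewrite (_ : (fun _ => _) = y) => [/eqP|]; first by rewrite subr_eq0 => /eqP.
by apply/funext => K; rewrite mem_index_enum.
Qed.

End taylor.

(** * Representation by scalar products with powers *)

Section equivalences.
Context {R : realType} {n k : nat} (k_gt0 : (0 < k)%N).
Implicit Types (f : ext_form R n k -> R).

Lemma ctr_wedge_expS s C (xi : ext_form R n k) : altseq C ->
  ctr C (wedge_exp xi s.+1) =
  ctr (fun l => ctr (fun l' => C (l ++ l')) (wedge_exp xi s)) xi.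
Proof. by move=> aC; exact: ctr_wedge. Qed.

(** Each factor [xi] of the power contracts one block of the word, just as each sum in [taylor] runs
    over one block. The coordinates are those of [xi] in [ext_form_sum_ebasis]. *)
Lemma ctr_polarn s f xi : ext_one_affine k_gt0 f ->
  ctr (polarn s f) (wedge_exp xi s) = taylor s f (fun J => k`!%:R^-1 * ext_coef J xi).
Proof.
elim: s f => [|s IH] f fa; first by rewrite /= ctr_cst mulr1 /polarn mul0n eqxx.
rewrite ctr_wedge_expS; last exact: altseq_polarn.
rewrite [LHS]/ctr mulr_sumr /=; apply: eq_bigr => J _.
rewrite -IH; last exact: one_affine_diff.
rewrite [ctr _ _ * _]mulrC mulrA; congr (_ * _); apply: eq_ctr => l sl.
rewrite /polarn size_cat size_codom card_ord sl mulSn !eqxx.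
exact: polar_cat.
Qed.

Lemma one_affine_sum f : ext_one_affine k_gt0 f ->
  exists c : forall s : 'I_(n %/ k).+1, ext_form R n (s * k),
    forall xi, f xi = \sum_(s < (n %/ k).+1) ext_dot (c s) (wedge_exp xi s).
Proof.
move=> fa.
have cP (s : 'I_(n %/ k).+1) : exists c : ext_form R n (s * k), forall a,
    ext_dot c a = s`!%:R^-1 * ctr (polarn s f) a.
  apply: ext_dot_riesz => [a b|t a]; first by rewrite ctrDr mulrDr.
  by rewrite ctrZr mulrCA.
exists (fun s => projT1 (cid (cP s))) => xi.
rewrite [in LHS](ext_form_sum_ebasis xi) -/(basis_comb (fun J => k`!%:R^-1 * ext_coef J xi)).
rewrite (@taylor_expansion _ _ _ k_gt0 (n %/ k).+1) //.
  apply: eq_bigr => s _; case: cid => c /= ->.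
  by rewrite ctr_polarn.
(* The expansion stops here: a word of [(n %/ k).+1 * k > n] letters repeats one, and the polar
   tensor of every translate of [f] is alternating. *)
move=> x l sl; have -> : polar (n %/ k).+1 (fun z => f (x + z)) l =
    polarn (n %/ k).+1 (fun z => f (x + z)) l by rewrite /polarn sl eqxx.
have /(one_affine_shift x) /(altseq_polarn (n %/ k).+1) aP := fa.
have -> : l = codom (tnth (in_tuple l)) by rewrite /codom /image_mem map_tnth_enum.
apply: altseq_Ninj aP _; apply/injectiveP => /leq_card; rewrite !card_ord sl leqNgt.
by rewrite ltn_ceil.
Qed.

(** [F - F o] is linear, hence a sum of linear functionals on the separate factors, each of which is
    a scalar product. The constant [F o] becomes the coefficient of degree 0, since [xi^0 = 1]. *)
Lemma ext_polyaffine_sum f : ext_polyaffine f ->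
  exists c : forall s : 'I_(n %/ k).+1, ext_form R n (s * k),
    forall xi, f xi = \sum_(s < (n %/ k).+1) ext_dot (c s) (wedge_exp xi s).
Proof.
move=> [F [Faff fF]].
pose V (s : 'I_(n %/ k)) := ext_form R n (s.+1 * k).
pose o : forall s, V s := fun=> 0.
pose L x := F x - F o.
have ext (x y : forall s, V s) : (forall s, x s = y s) -> x = y.
  exact: functional_extensionality_dep.
have LZ t x : L (fun s => t *: x s) = t * L x.
  rewrite /L (_ : (fun s => t *: x s) = fun s => (1 - t) *: o s + t *: x s).
    by rewrite Faff; ring.
  by apply: ext => s; rewrite scaler0 add0r.
(* Additivity is affinity at 1/2 between the doubled points. *)
have LD x y : L (fun s => x s + y s) = L x + L y.
  have half (s : 'I_(n %/ k)) (v : V s) : 2^-1 *: (2 *: v) = v.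
    by rewrite scalerA mulVf ?scale1r // pnatr_eq0.
  have := LZ 2 x; have := LZ 2 y.
  have := Faff 2^-1 (fun s => 2 *: x s) (fun s => 2 *: y s).
  rewrite (_ : (fun s => _) = fun s => x s + y s); first by rewrite /L; lra.
  by apply: ext => s; rewrite (_ : 1 - 2^-1 = 2^-1) ?half //; lra.
have L0 : L o = 0 by rewrite /L subrr.
pose e s (v : V s) : forall s', V s' := @eqtype.dfwith _ V o s v.
have eZ s t (v : V s) : e s (t *: v) = fun s' => t *: e s v s'.
  apply: ext => s'; rewrite /e; have [->|ss'] := eqVneq s' s; first by rewrite !dfwith_in.
  by rewrite !dfwith_out ?scaler0 // eq_sym.
have eD s (v w : V s) : e s (v + w) = fun s' => e s v s' + e s w s'.
  apply: ext => s'; rewrite /e; have [->|ss'] := eqVneq s' s; first by rewrite !dfwith_in.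
  by rewrite !dfwith_out ?addr0 // eq_sym.
have Lsum x : L x = \sum_s L (e s (x s)).
  have H (r : seq 'I_(n %/ k)) : uniq r ->
      L (fun s => if s \in r then x s else 0) = \sum_(s <- r) L (e s (x s)).
    elim: r => [|s r IH] /=; first by rewrite big_nil.
    case/andP => sr /IH Hr; rewrite big_cons -Hr -LD; congr L.
    apply: ext => s'; rewrite inE /e; have [->|ss'] := eqVneq s' s.
      by rewrite (negPf sr) dfwith_in addr0.
    by rewrite dfwith_out ?add0r // eq_sym.
  rewrite -(H _ (index_enum_uniq _)); congr L.
  by apply: ext => s; rewrite mem_index_enum.
have cP (s : 'I_(n %/ k).+1) : exists c : ext_form R n (s * k), forall xi,
    ext_dot c (wedge_exp xi s) =
    if unlift ord0 s is Some s' then L (e s' (wedge_exp xi s'.+1)) else F o.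
  have [s' ->|->] := unliftP ord0 s; last first.
    by exists (cst_form (F o)) => xi; rewrite ext_dot_cst mulr1.
  have [v w|t v|c cE] := @ext_dot_riesz R n _ (fun v => L (e s' v)).
  - by rewrite eD LD.
  - by rewrite eZ LZ.
  - by exists c => xi; rewrite -cE.
exists (fun s => projT1 (cid (cP s))) => xi.
rewrite fF -[F _](subrK (F o)) -/(L _) Lsum big_ord_recl addrC; congr (_ + _).
  by case: cid => c /= /(_ xi) ->; rewrite unlift_none.
by apply: eq_bigr => s _; case: cid => c /= /(_ xi) ->; rewrite liftK.
Qed.

Lemma sum_ext_polyaffine f :
  (exists c : forall s : 'I_(n %/ k).+1, ext_form R n (s * k),
    forall xi, f xi = \sum_(s < (n %/ k).+1) ext_dot (c s) (wedge_exp xi s)) ->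
  ext_polyaffine f.
Proof.
move=> [c fc].
pose c0 := ext_dot (c ord0) (cst_form 1 : ext_form R n 0).
exists (fun x => c0 + \sum_(s < n %/ k) ext_dot (c (lift ord0 s)) (x s)); split.
  move=> t x y; pose S z := \sum_(s < n %/ k) ext_dot (c (lift ord0 s)) (z s).
  have -> : \sum_(s < n %/ k) ext_dot (c (lift ord0 s)) ((1 - t) *: x s + t *: y s) =
      (1 - t) * S x + t * S y.
    rewrite !mulr_sumr -big_split; apply: eq_bigr => s _ /=.
    by rewrite !ext_dot_ctr ctrDr !ctrZr.
  by rewrite -/(S x) -/(S y); ring.
by move=> xi; rewrite fc big_ord_recl.
Qed.

End equivalences.

(** * Integration on R^n *)

Section rowvectors.
Context {R : realType}.

Lemma rV_norm_coord n (x : 'rV[R]_n) i : `|x 0 i| <= `|x|.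
Proof.
rewrite [leRHS]/Num.norm /= mx_normrE; apply/bigmax_geP; right => /=.
by exists (0, i).
Qed.

Lemma rV_norm_le n (x : 'rV[R]_n) M : 0 <= M -> (forall i, `|x 0 i| <= M) -> `|x| <= M.
Proof.
move=> M0 xM; rewrite [leLHS]/Num.norm /= mx_normrE; apply/bigmax_leP; split => //.
by move=> [j i] _ /=; rewrite (ord1 j).
Qed.

Lemma rV_norm_lt n (x : 'rV[R]_n) M : 0 < M -> (forall i, `|x 0 i| < M) -> `|x| < M.
Proof.
move=> M0 xM; rewrite [ltLHS]/Num.norm /= mx_normrE; apply/bigmax_ltP; split => //.
by move=> [j i] _ /=; rewrite (ord1 j).
Qed.

Lemma rV_coord_continuous n (i : 'I_n) : continuous (fun x : 'rV[R]_n => x 0 i).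
Proof. exact: coord_continuous. Qed.

Definition rV_box n (c : 'rV[R]_n) (r : R) : set 'rV[R]_n :=
  [set x | forall i, `|x 0 i - c 0 i| < r].

Lemma measurable_rV_box n (c : 'rV[R]_n) r : measurable (rV_box c r).
Proof.
rewrite (_ : rV_box c r =
    \bigcap_(i in [set: 'I_n]) (@rV_coord R n i @^-1` ball (c 0 i) r)); last first.
  apply/seteqP; split => x /= H i; rewrite /ball /=.
    by move=> _; rewrite distrC; exact: H.
  by rewrite distrC; exact: H.
apply: fin_bigcap_measurable => // i _.
rewrite -[X in measurable X]setTI; apply: measurable_rV_coord => //.
by rewrite ball_itv; exact: measurable_itv.
Qed.

(** The sigma-algebra is generated by the coordinates, so boxes are measurable; an open set is the
    union of the countably many boxes with rational centre and radius 1/(m+1) contained in it. *)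
Lemma open_rV_measurable n (A : set 'rV[R]_n) : open A -> measurable A.
Proof.
move=> oA; pose B (cm : 'rV[rat]_n * nat) : set 'rV[R]_n :=
  rV_box (map_mx ratr cm.1) cm.2.+1%:R^-1.
rewrite (_ : A = \bigcup_cm (if `[< B cm `<=` A >] then B cm else set0)).
  apply: countable_bigcupT_measurable; first exact: countableP.
  by move=> cm; case: ifP => // _; exact: measurable_rV_box.
apply/seteqP; split => x /=; last first.
  by move=> [cm _]; case: ifP => // /asboolP; exact.
move=> Ax; have /nbhs_ballP[e /= e0 eA] : nbhs x A by exact: open_nbhs_nbhs.
have [m me] : exists m, (m.+1%:R^-1 : R) < e / 2.
  have e20 : 0 < e / 2 by rewrite divr_gt0.
  near \oo => m; exists m; rewrite -[e / 2]/(PosNum e20)%:num.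
  by near: m; exact: near_infty_natSinv_lt.
have qP i : exists q : rat, `|x 0 i - ratr q| < m.+1%:R^-1.
  have [|q] := @rat_in_itvoo R (x 0 i - m.+1%:R^-1) (x 0 i + m.+1%:R^-1).
    by rewrite ltrD2l gtrN // invr_gt0.
  rewrite in_itv /= => /andP[q1 q2]; exists q.
  by rewrite distrC ltr_distl q1 q2.
have /all_sig[q qE] i := cid (qP i).
exists (\row_i q i, m) => //; case: asboolP => [_|[]].
  by move=> i; rewrite !mxE.
move=> y yB; apply: eA; rewrite mx_norm_ball /ball_ /=; apply: rV_norm_lt => // i.
have := yB i; have := qE i; rewrite !mxE /= => xq yq.
apply: le_lt_trans (ler_distD (ratr (q i)) _ _) _; rewrite (distrC (ratr _)) [ltRHS](splitr e).
by rewrite ltrD //; exact: lt_trans me.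
Unshelve. all: by end_near. Qed.

Lemma continuous_rV_measurable n (f : 'rV[R]_n -> R) : continuous f ->
  measurable_fun setT f.
Proof.
move=> /continuousP cf; apply: (measurability _ (measurable_realfun.RGenOpens.measurableE R)).
move=> _ [_ [a [b ->] <-]]; rewrite setTI; apply: open_rV_measurable.
exact/cf/interval_open.
Qed.

Lemma rV_box0E n M : (@rV_cons R n) @^-1` (rV_box 0 M) = `]-M, M[%classic `*` rV_box 0 M.
Proof.
apply/seteqP; split => [[a y] /= H|[a y] /= [] H1 H2 i].
  split=> [|i].
    by have := H 0; rewrite !mxE unlift_none subr0 /= in_itv /= ltr_norml.
  by have := H (lift 0 i); rewrite !mxE liftK.
rewrite !mxE subr0; case: unliftP => [j _|_] /=.
  by have := H2 j; rewrite !mxE subr0.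
by move: H1; rewrite in_itv /= ltr_norml.
Qed.

Lemma lebesgue_rV_box n (M : R) : 0 <= M ->
  lebesgue_rV n (rV_box 0 M) = ((M *+ 2) ^+ n)%:E.
Proof.
move=> M0; elim: n => [|n IH].
  rewrite expr0 /= diracE mem_set //; by case.
have -> : lebesgue_rV n.+1 (rV_box 0 M) =
  (lebesgue_measure \x lebesgue_rV n)%E ((@rV_cons R n) @^-1` (rV_box 0 M)) by [].
rewrite rV_box0E product_measure1E //; last exact: measurable_rV_box.
rewrite IH [X in (X * _)%E](lebesgue_measure_itv `]-M, M[) /= lte_fin exprS.
case: ltP => [_|]; first by rewrite opprK mulr2n.
rewrite leNgt => MM; rewrite (_ : M = 0) ?mul0rn ?mul0r ?mul0e //.
by move: MM; rewrite -leNgt; lra.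
Qed.

End rowvectors.

(** * Fubini and integrals of partial derivatives *)

Section rV_integration.
Context {R : realType}.

Lemma rV_continuous (T : topologicalType) n (f : T -> 'rV[R]_n) :
  (forall i, continuous (fun t => f t 0 i)) -> continuous f.
Proof.
move=> fc t; apply/cvgrPdist_lt => e e0.
have : \forall s \near t, forall i, `|f t 0 i - f s 0 i| < e.
  by apply: filter_forall => i; move/cvgrPdist_lt : (fc i t) => /(_ e e0).
apply: filterS => s H; apply: rV_norm_lt => // i; rewrite !mxE; exact: H.
Qed.

(** A form of compact support, in the cube of half-side [M], that is inherited by coordinate slices
    and by partial derivatives. [M] may be negative, whence [|M|] in the bounds. *)
Definition vanishes_off n (M : R) (u : 'rV[R]_n -> R) :=
  forall (x : 'rV[R]_n) i, M < `|x 0 i| -> u x = 0.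

Lemma vanishes_off_pderiv n M (u : 'rV[R]_n -> R) j :
  vanishes_off M u -> vanishes_off M (pderiv j u).
Proof.
move=> uM x i xi; rewrite /pderiv -[RHS](@derive_cst R _ _ 0 x (delta_mx 0 j)).
apply: near_eq_derive.
have : \forall y \near x, M < `|(y : 'rV[R]_n) 0 i|.
  have /cvgr_gt : (fun y : 'rV[R]_n => `|y 0 i|) @ x --> `|x 0 i|.
    apply: (@continuous_comp _ _ _ (fun y : 'rV[R]_n => y 0 i) Num.norm).
      exact: coord_continuous.
    exact: norm_continuous.
  exact.
by apply: filterS => y; exact: uM.
Qed.

Lemma vanishes_off_bounded n M (u : 'rV[R]_n -> R) : continuous u ->
  vanishes_off M u -> exists B, forall x, `|u x| <= B.
Proof.
move=> uc uM; pose K := [set x : 'rV[R]_n | forall i, x 0 i \in `[- `|M|, `|M|]].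
have cK : compact K by apply: (@rV_compact _ _ (fun=> `[- `|M|, `|M|]%classic)) => _; exact: segment_compact.
have /compact_bounded[B [Br Bu]] : compact (u @` K).
  by apply: continuous_compact => //; exact: continuous_subspaceT.
exists (`|B| + 1) => x; have [xK|/existsNP[i]] := pselect (K x).
  by apply: Bu; [rewrite (le_lt_trans (ler_norm B)) // ltrDl|exists x].
rewrite /= in_itv /= -ler_norml => /negP; rewrite -ltNge => xi.
by rewrite (uM x i) ?normr0 ?addr_ge0 // (le_lt_trans (ler_norm M)).
Qed.

Lemma vanishes_off_integrable n M (u : 'rV[R]_n -> R) : continuous u ->
  vanishes_off M u -> (lebesgue_rV n).-integrable setT (EFin \o u).
Proof.
move=> uc uM; have [B uB] := vanishes_off_bounded uc uM.
pose W := rV_box (0 : 'rV[R]_n) (`|M| + 1).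
have mW : measurable W by exact: measurable_rV_box.
have -> : EFin \o u = (EFin \o u) \_ W.
  apply/funext => x; rewrite patchE; case: ifPn => // /negP xW; congr EFin.
  have /existsNP[i xi] : ~ W x by move=> Wx; apply: xW; rewrite inE.
  apply: (uM x i); move/negP: xi; rewrite mxE subr0 -leNgt; apply: lt_le_trans.
  by rewrite (le_lt_trans (ler_norm M)) // ltrDl.
apply: (iffLR (integrable_mkcond (EFin \o u) mW)).
apply: measurable_bounded_integrable => //.
- have M0 : 0 <= `|M| + 1 by rewrite addr_ge0.
  have : (lebesgue_rV n W < +oo)%E by rewrite /W lebesgue_rV_box // ltry.
  exact.
- by apply: measurable_funTS; exact: continuous_rV_measurable.
- exists `|B|; split => // C BC x _; apply: le_trans (uB x) _.
  by rewrite (le_trans (ler_norm B)) // ltW.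
Qed.

Section iterated.
Local Open Scope ereal_scope.
Context n (f : 'rV[R]_n.+1 -> \bar R).
Hypothesis fi : (lebesgue_rV n.+1).-integrable setT f.

Let mf := measurable_int _ fi.

Let pi : (lebesgue_measure \x lebesgue_rV n).-integrable setT (f \o @rV_cons R n).
Proof.
apply/integrableP; split.
  exact: (measurableT_comp (T3 := measurable_realfun.constructive_ereal_extended__canonical__measurable_structure_Measurable R) mf (@measurable_rV_cons R n)).
have /integrableP[_] := fi; apply: le_lt_trans.
rewrite le_eqVlt; apply/orP; left; apply/eqP; apply/esym.
rewrite [LHS](ge0_integral_pushforward (@measurable_rV_cons R n)
  (lebesgue_measure \x lebesgue_rV n)) //.
exact: (measurable_int _ (integrable_abse fi)).
Qed.

Lemma integral_rV_cons :
  \int[lebesgue_rV n.+1]_x f x = \int[lebesgue_measure \x lebesgue_rV n]_z f (rV_cons z).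
Proof.
exact: (integral_pushforward (@measurable_rV_cons R n)).
Qed.

Lemma integral_rV_consl :
  \int[lebesgue_rV n.+1]_x f x =
  \int[lebesgue_measure]_a \int[lebesgue_rV n]_y f (rV_cons (a, y)).
Proof. by rewrite integral_rV_cons -integral12_prod_meas1. Qed.

Lemma integral_rV_consr :
  \int[lebesgue_rV n.+1]_x f x =
  \int[lebesgue_rV n]_y \int[lebesgue_measure]_a f (rV_cons (a, y)).
Proof. by rewrite integral_rV_cons -integral21_prod_meas1. Qed.

End iterated.

(** The two difference quotients are the same function of [h], so existence and value of the
    derivative transfer together. *)
Lemma derive_affine_comp (V W : normedModType R) (L : V -> W) (u : W -> R) v w x :
  (forall h : R, L (h *: v + x) = h *: w + L x) ->
  ('D_v (u \o L) x = 'D_w u (L x)) * (derivable u (L x) w -> derivable (u \o L) x v).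
Proof.
move=> Lh; have E : (fun h : R => h^-1 *: (((u \o L) \o shift x) (h *: v) - (u \o L) x)) =
    fun h => h^-1 *: ((u \o shift (L x)) (h *: w) - u (L x)).
  by apply/funext => h /=; rewrite Lh.
by rewrite /derive /derivable E.
Qed.

Lemma integral_derive1_eq0 M (g : R -> R) : (forall x, derivable g x 1) ->
  continuous (derive1 g) -> (forall x, M < `|x| -> g x = 0) ->
  (\int[lebesgue_measure]_x ((derive1 g) x)%:E = 0)%E.
Proof.
move=> gd gc gM; pose N := `|M| + 1; have N0 : 0 < N by rewrite ltr_wpDl.
have MN : M < N by rewrite (le_lt_trans (ler_norm M)) // ltrDl.
have g'0 x : N < `|x| -> (derive1 g) x = 0.
  move=> Nx; rewrite derive1E -[RHS](@derive_cst R _ _ 0 x 1).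
  apply: near_eq_derive; have : \forall y \near x, N < `|y|.
    have /cvgr_gt : Num.norm @ x --> `|x| by exact: norm_continuous.
    exact.
  by apply: filterS => y Ny; apply: gM; exact: lt_trans Ny.
have -> : (\int[lebesgue_measure]_x ((derive1 g) x)%:E =
    \int[lebesgue_measure]_(x in `[(- N)%R, N]) ((derive1 g) x)%:E)%E.
  rewrite [RHS]integral_mkcond; apply: eq_integral => x _; rewrite patchE.
  case: ifPn => // /negP xN; rewrite g'0 // ltNge; apply/negP => Nx; apply: xN.
  by rewrite inE /= in_itv /= -ler_norml.
rewrite (@continuous_FTC2 _ _ g) //.
- by rewrite !gM ?normrN ?gtr0_norm // subee.
- by rewrite gtrN.
- exact: continuous_subspaceT.
- have gct : continuous g by move=> x; apply/differentiable_continuous/derivable1_diffP.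
  by split=> [x _||]; [exact: gd|apply: cvg_at_right_filter|apply: cvg_at_left_filter]; exact: gct.
Qed.

(** By Fubini, with the order of integration dictated by [i]. For the first coordinate the inner
    integral is one-dimensional and vanishes by the fundamental theorem of calculus; otherwise it
    runs over the remaining coordinates and vanishes by induction. The hypotheses are coordinatewise
    so as to restrict to slices. *)
Lemma integral_pderiv_eq0 n M i (u : 'rV[R]_n -> R) :
  (forall x j, derivable u x (delta_mx 0 j)) -> (forall j, continuous (pderiv j u)) ->
  vanishes_off M u -> (\int[lebesgue_rV n]_x (pderiv i u x)%:E = 0)%E.
Proof.
elim: n i u => [|n IH] i u ud uc uM; first by case: i.
have ui : (lebesgue_rV n.+1).-integrable setT (EFin \o pderiv i u).
  by apply: (@vanishes_off_integrable _ M) => //; exact: vanishes_off_pderiv.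
have consE (a b : R) (x y : 'rV[R]_n) h : rV_cons (h * a + b, h *: x + y) =
    h *: rV_cons (a, x) + rV_cons (b, y).
  by apply/rowP => j; rewrite !mxE /=; case: unlift => [k|]; rewrite ?mxE.
have cons_cont1 (y : 'rV[R]_n) : continuous (fun a : R => rV_cons (a, y)).
  apply: rV_continuous => j; case: (unliftP 0 j) => [k ->|->] a.
    by under eq_fun => b do rewrite mxE liftK /=; exact: cst_continuous.
  by under eq_fun => b do rewrite mxE unlift_none /=; exact: cvg_id.
have cons_cont2 a : continuous (fun y : 'rV[R]_n => rV_cons (a, y)).
  apply: rV_continuous => j; case: (unliftP 0 j) => [k ->|->] y.
    by under eq_fun => b do rewrite mxE liftK /=; exact: coord_continuous.
  by under eq_fun => b do rewrite mxE unlift_none /=; exact: cst_continuous.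
case: (unliftP 0 i) => [j iE|iE].
  rewrite (integral_rV_consl ui) /= integral0_eq // => a _.
  pose v (y : 'rV[R]_n) := u (rV_cons (a, y)).
  have aff (k : 'I_n) h (y : 'rV[R]_n) : rV_cons (a, h *: delta_mx 0 k + y) =
      h *: delta_mx 0 (lift 0 k) + rV_cons (a, y).
    have := consE 0 a (delta_mx 0 k) y h; rewrite mulr0 add0r => ->; congr (_ *: _ + _).
    apply/rowP => l; rewrite !mxE /=; case: unliftP => [m ->|->]; rewrite ?mxE.
      by rewrite (inj_eq (@lift_inj _ _)).
    by rewrite (negPf (neq_lift _ _)).
  have vE k y : pderiv k v y = pderiv (lift 0 k) u (rV_cons (a, y)).
    exact: (derive_affine_comp u (fun h => aff k h y)).1.
  rewrite (eq_integral (fun y => (pderiv j v y)%:E)) => [|y _]; last by rewrite vE -iE.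
  apply: IH => [y k|k|y k ky].
  - by apply: (derive_affine_comp u (fun h => aff k h y)).2; exact: ud.
  - rewrite (_ : pderiv k v = pderiv (lift 0 k) u \o (fun y => rV_cons (a, y))); last first.
      by apply/funext => y; rewrite vE.
    by move=> y; apply: continuous_comp; [exact: cons_cont2|exact: uc].
  - by apply: (uM _ (lift 0 k)); rewrite mxE liftK.
rewrite (integral_rV_consr ui) /= integral0_eq // => y _.
pose g a := u (rV_cons (a, y)).
have aff (h a : R) : rV_cons (h *: (1 : R) + a, y) =
    h *: delta_mx 0 0 + rV_cons (a, y).
  have := consE 1 a 0 y h; rewrite scaler0 add0r => ->; congr (_ *: _ + _).
  apply/rowP => l; rewrite !mxE /=; case: unliftP => [m ->|->]; rewrite ?mxE ?eqxx //.
have gE a : (derive1 g) a = pderiv 0 u (rV_cons (a, y)).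
  rewrite derive1E; exact: (derive_affine_comp u (fun h => aff h a)).1.
rewrite (eq_integral (fun a : measurableTypeR R => (derive1 g a)%:E)) => [|a _]; last by rewrite gE -iE.
apply: (@integral_derive1_eq0 M) => [a||a aM].
- by apply: (derive_affine_comp u (fun h => aff h a)).2; exact: ud.
- rewrite (_ : (derive1 g) = pderiv 0 u \o (fun a => rV_cons (a, y))); last first.
    by apply/funext => a; rewrite gE.
  by move=> a; apply: continuous_comp; [exact: cons_cont1|exact: uc].
- by apply: (uM _ 0); rewrite mxE unlift_none.
Qed.

End rV_integration.

(** * Smooth functions *)

Section smooth_functions.
Context {R : realType}.

(** The exponent [m] makes the family stable under differentiation, see [is_derive_flat]. *)
Definition flat m (x : R) : R := if 0 < x then x^-1 ^+ m * expR (- x^-1) else 0.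

Lemma flat_le0 m x : x <= 0 -> flat m x = 0.
Proof. by rewrite /flat leNgt => /negPf ->. Qed.

Lemma flat_ge0 m x : 0 <= flat m x.
Proof.
rewrite /flat; case: ltP => // x0; rewrite mulr_ge0 ?expR_ge0 //.
by rewrite exprn_ge0 // invr_ge0 ltW.
Qed.

(** From exp y >= y^(m+2)/(m+2)! at y = 1/x. A quadratic bound is what gives the derivative 0 at the
    origin. *)
Lemma flat_le m x : flat m x <= m.+2`!%:R * x ^+ 2.
Proof.
rewrite /flat; case: ltP => [x0|_]; last by rewrite mulr_ge0 ?sqr_ge0 ?ler0n.
have y0 : 0 < x^-1 by rewrite invr_gt0.
rewrite expRN ler_pdivrMr ?expR_gt0 //.
have -> : x^-1 ^+ m = m.+2`!%:R * x ^+ 2 * (x^-1 ^+ m.+2 / m.+2`!%:R).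
  rewrite -[in x^-1 ^+ m.+2]addn2 exprD exprVn exprVn; field.
  by rewrite pnatr_eq0 -lt0n fact_gt0 expf_neq0 ?(lt0r_neq0 x0).
apply: ler_wpM2l; first by apply: mulr_ge0; rewrite ?ler0n ?sqr_ge0.
by apply: le_trans (expR_ge1Dxn m.+1 (ltW y0)); rewrite lerDr.
Qed.

Lemma is_derive_flat m (x : R) :
  is_derive x 1 (flat m) (flat m.+2 x - m%:R * flat m.+1 x).
Proof.
have [x0|x0|->] := ltgtP x 0.
- rewrite !flat_le0 ?(ltW x0) // mulr0 subr0.
  apply: (@near_eq_is_derive _ _ _ (cst 0)).
    near=> y; rewrite flat_le0 //; apply: ltW; near: y; exact: lt_nbhsl.
- have E : is_derive x 1 (fun y => y^-1 ^+ m * expR (- y^-1)) (flat m.+2 x - m%:R * flat m.+1 x).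
    have x0' := lt0r_neq0 x0.
    have dV : is_derive x 1 (fun y : R => y^-1) (- x ^- 2).
      by apply: is_derive_eq; [exact: is_deriveV x0' (is_derive_id _ _)|rewrite [LHS]mulr1].
    have dE : is_derive x 1 (fun y : R => expR (- y^-1)) (expR (- x^-1) * x ^- 2).
      apply: (is_derive1_comp (f := expR) (g := fun y : R => - y^-1)).
      by have := is_deriveN dV; rewrite opprK.
    have dX : is_derive x 1 (fun y : R => y^-1 ^+ m) (m%:R * x^-1 ^+ m.-1 * - x ^- 2).
      have := is_deriveX m dV; rewrite (_ : _ ^+ m = fun y : R => y^-1 ^+ m) //.
      by apply/funext => y; rewrite fctE.
    apply: (is_derive_eq (is_deriveM dX dE)).
    rewrite /flat x0 /GRing.scale /=; case: (m) => [|m'] /=.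
      by rewrite !exprVn; field.
    by rewrite -!exprVn !exprS; ring.
  apply: (near_eq_is_derive _ E); near=> y; rewrite /flat ifT //.
  near: y; exact: lt_nbhsr.
- rewrite !flat_le0 // mulr0 subr0.
  set C : R := m.+2`!%:R.
  have C0 : 0 < C by rewrite ltr0n fact_gt0.
  have cv : (fun h : R => h^-1 *: ((flat m \o shift 0) (h *: 1) - flat m 0)) @ 0^' --> (0 : R).
    apply/cvgr0Pnorm_lt => e e0; near=> h; rewrite /= addr0 (flat_le0 m (lexx 0)) subr0.
    have h0 : h != 0 by near: h; exact: nbhs_dnbhs_neq.
    rewrite [h *: 1]mulr1 normrM normfV (ger0_norm (flat_ge0 _ _)).
    rewrite mulrC ltr_pdivrMr ?normr_gt0 //.
    apply: (le_lt_trans (flat_le m h)).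
    have -> : h ^+ 2 = `|h| * `|h| by rewrite -normrM -expr2 ger0_norm ?sqr_ge0.
    rewrite mulrA ltr_pM2r ?normr_gt0 // mulrC -/C -ltr_pdivlMr //.
    by near: h; apply: dnbhs0_lt; exact: divr_gt0.
  by apply: DeriveDef; [apply/cvg_ex; exists 0|exact: cvg_lim].
Unshelve. all: by end_near. Qed.

Context {n : nat}.
Implicit Types u v : 'rV[R]_n -> R.

Lemma smooth_diff u x : smooth u -> differentiable u x.
Proof. by move=> /(_ [::]). Qed.

Lemma smooth_pderiv u i : smooth u -> smooth (pderiv i u).
Proof. by move=> us s x; rewrite -foldr_rcons; exact: us. Qed.

Lemma smooth_continuous u : smooth u -> continuous u.
Proof. by move=> us x; apply/differentiable_continuous/smooth_diff. Qed.

Lemma smooth_derivable u x (w : 'rV[R]_n) : smooth u -> derivable u x w.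
Proof. by move=> us; apply/diff_derivable/smooth_diff. Qed.

(** A class of expressions closed under [pderiv]. Smoothness of products and composites follows by
    structural induction, without formulas for their iterated derivatives. *)
Inductive smooth_expr : ('rV[R]_n -> R) -> Prop :=
| Smooth_base u : smooth u -> smooth_expr u
| Smooth_cst c : smooth_expr (cst c)
| Smooth_coord i : smooth_expr (fun x => x 0 i)
| Smooth_add u v : smooth_expr u -> smooth_expr v -> smooth_expr (u + v)
| Smooth_mul u v : smooth_expr u -> smooth_expr v -> smooth_expr (u * v)
| Smooth_flat m u : smooth_expr u -> smooth_expr (flat m \o u).

Lemma derive_comp1 (g g' : R -> R) u x (w : 'rV[R]_n) : differentiable u x ->
  is_derive (u x) 1 g (g' (u x)) -> 'D_w (g \o u) x = g' (u x) * 'D_w u x.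
Proof.
move=> du dg; have dgu : differentiable g (u x) by apply/derivable1_diffP.
rewrite deriveE; last exact: differentiable_comp.
rewrite diff_comp // diff1E //= derive1E.
by rewrite (deriveE _ du) mulrC; congr (_ * _); rewrite derive_val.
Qed.

Lemma smooth_expr_diff u : smooth_expr u -> forall x, differentiable u x.
Proof.
elim=> [{}u us x|c x|i x|{}u v _ du _ dv x|{}u v _ du _ dv x|m {}u _ du x].
- exact: smooth_diff.
- exact: differentiable_cst.
- exact: differentiable_coord.
- exact: differentiableD.
- exact: differentiableM.
- by apply: differentiable_comp => //; apply/derivable1_diffP; have [] := is_derive_flat m (u x).
Qed.

Lemma smooth_expr_pderiv u i : smooth_expr u -> smooth_expr (pderiv i u).
Proof.
elim=> [{}u us|c|j|{}u v ue du ve dv|{}u v ue du ve dv|m {}u ue du].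
- exact/Smooth_base/smooth_pderiv.
- rewrite (_ : pderiv i _ = cst 0); first exact: Smooth_cst.
  by apply/funext => x; rewrite /pderiv derive_cst.
- rewrite (_ : pderiv i _ = cst (j == i)%:R); first exact: Smooth_cst.
  apply/funext => x; rewrite /pderiv.
  have Lh (h : R) : ((h *: delta_mx 0 i + x : 'rV[R]_n) 0 j : R^o) =
      h *: ((j == i)%:R : R^o) + x 0 j by rewrite !mxE eqxx.
  by have [+ _] := derive_affine_comp (L := fun y : 'rV[R]_n => y 0 j : R^o) id Lh; rewrite derive_id.
- rewrite (_ : pderiv i _ = pderiv i u + pderiv i v); first exact: Smooth_add.
  by apply/funext => x; rewrite /pderiv deriveD //; exact/diff_derivable/smooth_expr_diff.
- rewrite (_ : pderiv i _ = u * pderiv i v + v * pderiv i u).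
    by do ![apply: Smooth_add|apply: Smooth_mul].
  by apply/funext => x; rewrite /pderiv deriveM //; exact/diff_derivable/smooth_expr_diff.
- rewrite (_ : pderiv i _ = (flat m.+2 \o u + cst (- m%:R) * (flat m.+1 \o u)) * pderiv i u).
    by do ![apply: Smooth_add|apply: Smooth_mul|apply: Smooth_flat|exact: Smooth_cst].
  apply/funext => x; rewrite /pderiv; have dF := is_derive_flat m (u x).
  rewrite (@derive_comp1 _ (fun y => flat m.+2 y - m%:R * flat m.+1 y)) //.
  + by rewrite /= -mulNr.
  + exact: smooth_expr_diff.
Qed.

Lemma smooth_exprP u : smooth_expr u -> smooth u.
Proof.
move=> ue s x; apply: smooth_expr_diff.
by elim: s => //= i s; exact: smooth_expr_pderiv.
Qed.

(** The mean value theorem in direction [i], then in direction [j]. The left-hand side is symmetric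
    in [i] and [j], the right-hand side is not. *)
Lemma pderiv_second_difference u (i j : 'I_n) (x : 'rV[R]_n) (h : R) : smooth u -> 0 < h ->
  exists s t : R, [/\ 0 < s < h, 0 < t < h &
    u (x + h *: delta_mx 0 i + h *: delta_mx 0 j) - u (x + h *: delta_mx 0 i)
    - (u (x + h *: delta_mx 0 j) - u x) =
    h ^+ 2 * pderiv j (pderiv i u) (x + s *: delta_mx 0 i + t *: delta_mx 0 j)].
Proof.
move=> us h0.
have line (w : 'rV[R]_n -> R) (y d : 'rV[R]_n) (s : R) : smooth w ->
    is_derive s 1 (fun s : R => w (y + s *: d)) ('D_d w (y + s *: d)).
  move=> ws; have L (r : R) : y + (r *: (1 : R) + s) *: d = r *: d + (y + s *: d).
    by rewrite scalerDl [r *: 1]mulr1 addrCA.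
  have [E D] := derive_affine_comp (L := fun s : R => y + s *: d) w L.
  by apply: DeriveDef => //; apply: D; exact: smooth_derivable.
pose phi (s : R) := u (x + h *: delta_mx 0 j + s *: delta_mx 0 i) - u (x + s *: delta_mx 0 i).
have dphi (s : R) : is_derive s 1 phi (pderiv i u (x + h *: delta_mx 0 j + s *: delta_mx 0 i)
    - pderiv i u (x + s *: delta_mx 0 i)).
  by apply: is_deriveB; exact: line.
have is_derive_cont (g dg : R -> R) : (forall s : R, is_derive s 1 g (dg s)) -> continuous g.
  by move=> gd s; apply/differentiable_continuous/derivable1_diffP; have [] := gd s.
have [s] := MVT h0 (fun s _ => dphi s) (continuous_subspaceT (is_derive_cont _ _ dphi)).
rewrite in_itv /= => sh; rewrite {1 2}/phi !scale0r !addr0 subr0 => Es.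
pose psi (t : R) := pderiv i u (x + s *: delta_mx 0 i + t *: delta_mx 0 j).
have dpsi (t : R) : is_derive t 1 psi (pderiv j (pderiv i u) (x + s *: delta_mx 0 i + t *: delta_mx 0 j)).
  by apply: line; exact: smooth_pderiv.
have [t] := MVT h0 (fun s _ => dpsi s) (continuous_subspaceT (is_derive_cont _ _ dpsi)).
rewrite in_itv /= => th; rewrite {1 2}/psi scale0r addr0 subr0 => Et.
exists s, t; split => //.
rewrite (addrAC x (h *: delta_mx 0 i)) Es (addrAC x (h *: delta_mx 0 j)) Et.
by rewrite expr2 mulrC mulrA mulrAC.
Qed.

(** Near [x] the two mixed derivatives take a common value, the symmetric second difference over
    h^2, though possibly at different points; continuity at [x] concludes. *)
Lemma pderivC u i j : smooth u -> pderiv i (pderiv j u) = pderiv j (pderiv i u).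
Proof.
move=> us; apply/funext => x; apply/eqP; rewrite -subr_eq0 -normr_le0.
apply/ler_addgt0Pl => e e0; rewrite addr0.
have cont k l : \forall y \near x, `|pderiv k (pderiv l u) x - pderiv k (pderiv l u) y| < e / 2.
  have /smooth_continuous/(_ x)/cvgrPdist_lt : smooth (pderiv k (pderiv l u)).
    by do 2!apply: smooth_pderiv.
  by apply; rewrite divr_gt0.
have [r /= r0 rB] := (nbhs_ballP _ _).1 (filterI (cont i j) (cont j i)).
(* When [i = j] the two displacements add up along one axis, so the ball must contain [h + h]. *)
pose h := r / 3; have h0 : 0 < h by rewrite divr_gt0.
have hh : h + h <= r by rewrite /h; clear -r0; lra.
have inb (s t : R) (k l : 'I_n) : 0 < s < h -> 0 < t < h ->
    ball x r (x + s *: delta_mx 0 k + t *: delta_mx 0 l).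
  move=> /andP[s0 sh] /andP[t0 th]; rewrite mx_norm_ball /ball_ /= -addrA opprD addrA subrr sub0r normrN.
  apply: rV_norm_lt => // m; rewrite !mxE eqxx /=.
  apply: le_lt_trans (ler_normD _ _) _; rewrite !normrM !normr_nat !gtr0_norm //.
  have H (b : bool) (z : R) : 0 < z -> z * b%:R <= z by move=> z0; case: b; rewrite ?mulr1 // mulr0 ltW.
  apply: le_lt_trans (lerD (H _ _ s0) (H _ _ t0)) _.
  exact: lt_le_trans (ltrD sh th) hh.
have [s [t [sh th E]]] := pderiv_second_difference i j x us h0.
have [s' [t' [sh' th' E']]] := pderiv_second_difference j i x us h0.
have EE : pderiv j (pderiv i u) (x + s *: delta_mx 0 i + t *: delta_mx 0 j) =
    pderiv i (pderiv j u) (x + s' *: delta_mx 0 j + t' *: delta_mx 0 i).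
  move: E E'; rewrite (addrAC x (h *: delta_mx 0 j)); clearbody h.
  move: (u (_ + _ + _)) (u (x + h *: delta_mx 0 i)) (u (x + h *: delta_mx 0 j)) (u x).
  move: (pderiv j _ _) (pderiv i _ _) => a b c1 c2 c3 c4 E E'.
  apply: (mulfI (x := h ^+ 2)); first by rewrite expf_neq0 ?lt0r_neq0.
  by apply: etrans (esym E) (etrans _ E'); ring.
have [H1 _] := rB _ (inb _ _ j i sh' th'); have [_ H2] := rB _ (inb _ _ i j sh th).
rewrite EE in H2; rewrite distrC in H2.
apply: le_trans (ler_distD (pderiv i (pderiv j u) (x + s' *: delta_mx 0 j + t' *: delta_mx 0 i)) _ _) _.
by rewrite [leRHS](splitr e); apply: ltW; exact: ltrD H1 H2.
Qed.

End smooth_functions.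

(** * Bounded integrands on a bounded open set *)

Section bounded_integrands.
Context {R : realType} {n : nat} (W : set 'rV[R]_n).
Hypotheses (oW : open W) (bW : bounded_set W).
Implicit Types g h u : 'rV[R]_n -> R.
Let mu : {measure set 'rV[R]_n -> \bar R} := lebesgue_rV n.

Lemma measurable_region : measurable W.
Proof. exact: open_rV_measurable. Qed.
Let mW := measurable_region.

Lemma lebesgue_region_lty : (mu W < +oo)%E.
Proof.
have [M [_ MW]] := bW; pose r := `|M| + 2.
have r0 : 0 <= r by rewrite addr_ge0.
have : (lebesgue_rV n (rV_box 0 r) < +oo)%E by rewrite lebesgue_rV_box // ltry.
apply: le_lt_trans; apply: le_measure; rewrite ?inE //; first exact: measurable_rV_box.
move=> x /(MW (`|M| + 1)) xM i; rewrite mxE subr0 (le_lt_trans (rV_norm_coord _ _)) //.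
rewrite (le_lt_trans (xM _)) ?ltrD2l ?ltr1n // (le_lt_trans (ler_norm M)) //.
by rewrite ltrDl.
Qed.
Let fW := lebesgue_region_lty.

Lemma Linfty_cst c : Linfty W (fun=> c).
Proof.
split; first exact: measurable_cst.
by exists `|c|; apply: aeW.
Qed.

Lemma LinftyD g h : Linfty W g -> Linfty W h -> Linfty W (fun x => g x + h x).
Proof.
move=> [mg [M gM]] [mh [N hN]]; split; first exact: measurable_funD.
exists (M + N); near=> x => Wx; apply: le_trans (ler_normD _ _) _.
by rewrite lerD //; [have : W x by []; near: x|have : W x by []; near: x].
Unshelve. all: by end_near. Qed.

Lemma LinftyM g h : Linfty W g -> Linfty W h -> Linfty W (fun x => g x * h x).
Proof.
move=> [mg [M gM]] [mh [N hN]]; split; first exact: measurable_funM.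
exists (M * N); near=> x => Wx; rewrite normrM.
by rewrite ler_pM //; [have : W x by []; near: x|have : W x by []; near: x].
Unshelve. all: by end_near. Qed.

Lemma Linfty_sum I (r : seq I) (P : pred I) (h : I -> 'rV[R]_n -> R) :
  (forall i, P i -> Linfty W (h i)) -> Linfty W (fun x => \sum_(i <- r | P i) h i x).
Proof.
move=> hL; elim: r => [|i r IH].
  by rewrite (_ : (fun _ => _) = fun=> 0); [exact: Linfty_cst|apply/funext => x; rewrite big_nil].
have [Pi|Pi] := boolP (P i); last first.
  by rewrite (_ : (fun _ => _) = fun x => \sum_(i <- r | P i) h i x) //;
    apply/funext => x; rewrite big_cons (negPf Pi).
rewrite (_ : (fun _ => _) = fun x => h i x + \sum_(i <- r | P i) h i x).
  by apply: LinftyD => //; exact: hL.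
by apply/funext => x; rewrite big_cons Pi.
Qed.

Lemma Linfty_integrable h : Linfty W h -> mu.-integrable W (EFin \o h).
Proof.
move=> [mh [M hM]]; apply/integrableP; split; first exact/measurable_EFinP.
have : (\int[mu]_(x in W) (cst `|M|%:E x) < +oo)%E.
  rewrite integral_cst //; apply: lte_mul_pinfty => //.
apply: le_lt_trans; apply: ae_ge0_le_integral => //.
- by apply/measurable_EFinP; apply: measurableT_comp.
- by move=> x _; rewrite lee_fin.
- near=> x => Wx; rewrite /= lee_fin (le_trans _ (ler_norm M)) //.
  by have : W x by []; near: x.
Unshelve. all: by end_near. Qed.

Definition Int h := \int[mu]_(x in W) h x.

Lemma IntD g h : Linfty W g -> Linfty W h -> Int (fun x => g x + h x) = Int g + Int h.
Proof. by move=> gL hL; apply: RintegralD => //; exact: Linfty_integrable. Qed.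

Lemma IntZ c h : Linfty W h -> Int (fun x => c * h x) = c * Int h.
Proof. by move=> hL; apply: RintegralZl => //; exact: Linfty_integrable. Qed.

Lemma IntN h : Linfty W h -> Int (fun x => - h x) = - Int h.
Proof.
move=> hL; rewrite -mulN1r -IntZ //; congr Int.
by apply/funext => x; rewrite mulN1r.
Qed.

Lemma Int_sum I (r : seq I) (P : pred I) (h : I -> 'rV[R]_n -> R) :
  (forall i, P i -> Linfty W (h i)) ->
  Int (fun x => \sum_(i <- r | P i) h i x) = \sum_(i <- r | P i) Int (h i).
Proof.
move=> hL; elim: r => [|i r IH].
  rewrite big_nil (_ : (fun _ => _) = fun=> 0); last by apply/funext => x; rewrite big_nil.
  by rewrite /Int Rintegral_cst // mul0r.
rewrite big_cons -IH; have [Pi|Pi] := boolP (P i); last first.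
  by congr Int; apply/funext => x; rewrite big_cons (negPf Pi).
rewrite -IntD; [|exact: hL|exact: Linfty_sum].
by congr Int; apply/funext => x; rewrite big_cons Pi.
Qed.

Lemma Linfty_norm h : Linfty W h -> Linfty W (fun x => `|h x|).
Proof.
move=> [mh [M hM]]; split; first exact: measurableT_comp.
by exists M; apply: filterS hM => x H /H; rewrite normr_id.
Qed.

Lemma Int_norm_le g h M : Linfty W g -> Linfty W h -> 0 <= M ->
  {ae mu, forall x, W x -> `|h x| <= M} -> `|Int (fun x => g x * h x)| <= M * Int (fun x => `|g x|).
Proof.
move=> gL hL M0 hM; have ghL := LinftyM gL hL.
apply: le_trans (le_normr_Rintegral mW (Linfty_integrable ghL)) _.
rewrite -IntZ; last exact: Linfty_norm.
apply: fine_le.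
- apply: integrable_fin_num => //; exact: Linfty_integrable (Linfty_norm ghL).
- apply: integrable_fin_num => //.
  by apply: Linfty_integrable; apply: LinftyM; [exact: Linfty_cst|exact: Linfty_norm].
apply: ae_ge0_le_integral => //.
- by apply/measurable_EFinP; have [] := Linfty_norm ghL.
- by move=> x _; rewrite lee_fin mulr_ge0.
- by apply/measurable_EFinP; apply: measurable_funM => //; have [] := Linfty_norm gL.
near=> x => Wx; rewrite lee_fin normrM mulrC ler_wpM2r //.
by have : W x by []; near: x.
Unshelve. all: by end_near. Qed.

(** L^1 convergence of one factor against a fixed bounded one. A family is treated at once because
    the approximations satisfy only the summed identity. *)
Lemma Int_limit (I : finType) (g h : I -> 'rV[R]_n -> R) (p : nat -> I -> 'rV[R]_n -> R) :
  (forall i, Linfty W (g i)) -> (forall i, Linfty W (h i)) ->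
  (forall m i, Linfty W (p m i)) ->
  (forall i, (\int[mu]_(x in W) `|p m i x - g i x|%:E)%E @[m --> \oo] --> 0%E) ->
  (forall m, \sum_i Int (fun x => p m i x * h i x) = 0) ->
  \sum_i Int (fun x => g i x * h i x) = 0.
Proof.
move=> gL hL pL pg p0; apply/eqP; rewrite -normr_le0; apply/ler_addgt0Pr => e e0; rewrite add0r.
have dL m i : Linfty W (fun x => p m i x - g i x).
  rewrite (_ : (fun _ => _) = fun x => p m i x + (-1) * g i x).
    by apply: LinftyD => //; apply: LinftyM => //; exact: Linfty_cst.
  by apply/funext => x; rewrite mulN1r.
have hM i : exists M : R, 0 < M /\ {ae mu, forall x, W x -> `|h i x| <= M}.
  have [_ [M hM]] := hL i; exists (`|M| + 1); split; first by rewrite ltr_wpDl.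
  by apply: filterS hM => x H /H /le_trans; apply; rewrite (le_trans (ler_norm M)) // lerDl.
have /all_sig[M MP] i := cid (hM i).
pose d m i := Int (fun x => `|p m i x - g i x|).
have dE m i : (\int[mu]_(x in W) `|p m i x - g i x|%:E)%E = (d m i)%:E.
  rewrite fineK //; apply: integrable_fin_num => //.
  exact: Linfty_integrable (Linfty_norm (dL m i)).
have card0 : (0 : R) < #|I|.+1%:R by [].
(* The tolerance [e] is shared among the indices; [#|I|.+1] is nonzero even for an empty family. *)
have [m mP] : exists m, forall i, d m i < e / (M i * #|I|.+1%:R).
  have : \forall m \near \oo, forall i, d m i < e / (M i * #|I|.+1%:R).
    apply: filter_forall => i; have := pg i; under eq_fun do rewrite dE.
    move=> /fine_cvgP[_] /cvgr_lt; apply; apply: divr_gt0 => //.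
    by rewrite mulr_gt0 //; have [] := MP i.
  by move=> /filter_ex.
have -> : \sum_i Int (fun x => g i x * h i x) =
    - \sum_i Int (fun x => (p m i x - g i x) * h i x).
  apply/eqP; rewrite -addr_eq0 -[X in _ == X](p0 m) -big_split /=; apply/eqP.
  apply: eq_bigr => i _; rewrite -IntD; try exact: LinftyM.
  by congr Int; apply/funext => x; ring.
rewrite normrN; apply: le_trans (ler_norm_sum _ _ _) _.
apply: (@le_trans _ _ (\sum_(i : I) e / #|I|.+1%:R)).
  apply: ler_sum => i _; have [Mi0 Mi] := MP i.
  apply: le_trans (Int_norm_le (dL m i) (hL i) (ltW Mi0) Mi) _.
  rewrite mulrC -ler_pdivlMr // -mulrA -invfM [_ * M i]mulrC; exact/ltW/mP.
rewrite sumr_const -[leLHS]mulr_natr -mulrA ler_piMr ?ltW //.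
by rewrite ltr_pdivrMl // mulr1 ltr_nat.
Qed.

Lemma continuous_Linfty h M : continuous h -> vanishes_off M h -> Linfty W h.
Proof.
move=> hc hM; have [B hB] := vanishes_off_bounded hc hM; split.
  by apply: measurable_funTS; exact: continuous_rV_measurable.
by exists B; apply: aeW => x _; exact: hB.
Qed.

End bounded_integrands.

(** * Test functions and integration by parts *)

Section test_functions.
Context {R : realType} {n : nat} (W : set 'rV[R]_n).
Hypotheses (oW : open W) (bW : bounded_set W).
Implicit Types u v : 'rV[R]_n -> R.

Lemma smoothM u v : smooth u -> smooth v -> smooth (fun x => u x * v x).
Proof. by move=> us vs; apply: smooth_exprP; apply: Smooth_mul; exact: Smooth_base. Qed.

Lemma test_functionM u v : test_function W u -> smooth v ->
  test_function W (fun x => u x * v x).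
Proof.
move=> [us cu uW] vs; have S : closure [set x | u x * v x != 0] `<=` closure [set x | u x != 0].
  by apply: closure_subset => x /=; rewrite mulf_eq0 negb_or => /andP[].
split; first exact: smoothM.
  by apply: subclosed_compact cu _ => //; exact: closed_closure.
exact: subset_trans uW.
Qed.

Lemma test_vanishes u : test_function W u -> exists M, vanishes_off M u.
Proof.
move=> [us cu uW]; have [M [_ Mu]] := compact_bounded cu.
exists (`|M| + 1) => x i xi; apply/eqP/negPn/negP => ux.
have : `|x| <= `|M| + 1.
  apply: Mu; last exact: subset_closure.
  by rewrite (le_lt_trans (ler_norm M)) // ltrDl.
by rewrite leNgt (lt_le_trans xi) // rV_norm_coord.
Qed.

Lemma test_Linfty u : test_function W u -> Linfty W u.
Proof.
move=> tu; have [M Mu] := test_vanishes tu.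
apply: (continuous_Linfty _ _ Mu) => //; apply: smooth_continuous; by case: tu.
Qed.

Lemma test_pderiv_Linfty u i : test_function W u -> Linfty W (pderiv i u).
Proof.
move=> tu; have [M Mu] := test_vanishes tu.
apply: (continuous_Linfty _ _ (vanishes_off_pderiv i Mu)) => //.
by apply: smooth_continuous; apply: smooth_pderiv; case: tu.
Qed.

Lemma pderiv_off_support u i x : ~ closure [set x | u x != 0] x -> pderiv i u x = 0.
Proof.
move=> ux; rewrite /pderiv -[RHS](@derive_cst R _ _ 0 x (delta_mx 0 i)).
apply: near_eq_derive.
have : nbhs x (~` closure [set x | u x != 0]).
  by apply: open_nbhs_nbhs; split => //; apply: closed_openC; exact: closed_closure.
apply: filterS => y yu; apply/eqP/negPn/negP => uy; apply: yu.
exact: subset_closure.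
Qed.

(** The support lies in [W], so the integral over [W] is one over the whole space. *)
Lemma Int_pderiv u i : test_function W u -> Int W (pderiv i u) = 0.
Proof.
move=> tu; have [us _ uW] := tu; have [M Mu] := test_vanishes tu.
rewrite /Int Rintegral_mkcond (_ : _ \_ _ = pderiv i u); last first.
  apply/funext => x; rewrite patchE; case: ifPn => // /negP xW.
  by rewrite pderiv_off_support // => /uW Wx; apply: xW; rewrite inE.
rewrite /Rintegral (@integral_pderiv_eq0 _ _ M) //.
- by move=> x j; exact: smooth_derivable.
- by move=> j; apply: smooth_continuous; exact: smooth_pderiv.
Qed.

Lemma pderivM u v i x : smooth u -> smooth v ->
  pderiv i (fun x => u x * v x) x = u x * pderiv i v x + v x * pderiv i u x.
Proof.
by move=> us vs; rewrite /pderiv [LHS]deriveM //; exact: smooth_derivable.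
Qed.

End test_functions.

(** * Powers of closed forms are null Lagrangians *)

Section null_lagrangian.
Context {R : realType} {n k : nat} (k_gt0 : (0 < k)%N) (W : set 'rV[R]_n).
Hypotheses (oW : open W) (bW : bounded_set W).
Variables (xi : ext_form R n k) (w : 'rV[R]_n -> ext_form R n k.-1)
  (dw : 'I_n -> 'rV[R]_n -> ext_form R n k.-1).
Hypothesis wW : W1infty0_form W w dw.
Implicit Types (C : seq 'I_n -> R) (phi : 'rV[R]_n -> R).

Local Notation coefk1 := {ffun 'I_k.-1 -> 'I_n}.

Let eta x := xi + ext_cast (prednK k_gt0) (ext_d dw x).

(** All components of [eta^s] at once. Keeping [C] as a parameter means that expanding a factor of
    the power merely prefixes letters to [C]. *)
Definition lagr s C (x : 'rV[R]_n) : R := ctr C (wedge_exp (eta x) s).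

Lemma ctr_eta C x : altseq C -> ctr C (eta x) = ctr C xi +
  \sum_(i < n) \sum_(I : coefk1 | increasing I) C (i :: codom I) * ext_coef I (dw i x).
Proof.
move=> aC; rewrite ctrDr; congr (_ + _); rewrite ctr_ext_cast.
rewrite (_ : ctr C (ext_d dw x) = \sum_i ctr C (wedge (dual_form i) (dw i x))); last first.
  by rewrite -ctr_sumr.
apply: eq_bigr => i _; rewrite ctr_wedge // ctr_dual ctr_increasing //.
exact: (altseq_catl [:: i]).
Qed.

Lemma lagrS s C x : altseq C -> lagr s.+1 C x =
  \sum_(J : {ffun 'I_k -> 'I_n} | increasing J)
     ext_coef J xi * lagr s (fun l => C (codom J ++ l)) x +
  \sum_(i < n) \sum_(I : coefk1 | increasing I)
     ext_coef I (dw i x) * lagr s (fun l => C (i :: codom I ++ l)) x.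
Proof.
move=> aC; rewrite /lagr ctr_wedge_expS // ctr_eta; last exact: altseq_ctr.
congr (_ + _).
  rewrite ctr_increasing; last exact: altseq_ctr.
  by apply: eq_bigr => J _; rewrite mulrC.
by apply: eq_bigr => i _; apply: eq_bigr => I _; rewrite mulrC.
Qed.

Lemma lagrN s C x : lagr s (fun l => - C l) x = - lagr s C x.
Proof. exact: ctrNl. Qed.

Lemma dw_Linfty i (I : coefk1) : increasing I -> Linfty W (fun x => ext_coef I (dw i x)).
Proof. by move=> iI; have [[_ /(_ i)[+ _]] _] := wW iI. Qed.

Lemma lagr_Linfty s C : altseq C -> Linfty W (lagr s C).
Proof.
elim: s C => [|s IH] C aC.
  rewrite (_ : lagr 0 C = fun=> C [::]); first exact: Linfty_cst.
  by apply/funext => x; rewrite /lagr /= ctr_cst mulr1.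
rewrite (funext (fun x => lagrS s x aC)).
apply: LinftyD => //.
  apply: Linfty_sum => // J _; apply: LinftyM => //; first exact: Linfty_cst.
  by apply: IH; exact: altseq_catl.
apply: Linfty_sum => // i _; apply: Linfty_sum => // I iI; apply: LinftyM => //.
  exact: dw_Linfty.
by apply: IH; exact: (altseq_catl (i :: codom I)).
Qed.

Lemma altseq_scale C c : altseq C -> altseq (fun l => c * C l).
Proof. by move=> aC p i j r; rewrite aC mulrN. Qed.

Lemma sum_antisym (A : 'I_n -> 'I_n -> R) : (forall i l, A i l = - A l i) ->
  \sum_i \sum_l A i l = 0.
Proof.
move=> AN; apply: eq_opp0; rewrite {1}exchange_big /= -sumrN; apply: eq_bigr => i _.
by rewrite -sumrN; apply: eq_bigr => l _; rewrite AN.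
Qed.

(* The weak form of "d (eta^s) = 0". *)
Definition weakly_closed s := forall C phi, altseq C -> test_function W phi ->
  \sum_(i < n) Int W (fun x => pderiv i phi x * lagr s (fun l => C (i :: l)) x) = 0.

(** Weak closedness tested with a component of [w] instead of a test function: gradients of its
    approximations converge in L^1, and [eta^s] is bounded. *)
Lemma weakly_closed_limit s (I : coefk1) C : weakly_closed s -> increasing I -> altseq C ->
  \sum_(i < n) Int W (fun x => ext_coef I (dw i x) * lagr s (fun l => C (i :: l)) x) = 0.
Proof.
move=> cs iI aC; have [_ [_ [phi [tphi _ phiw]]]] := wW iI.
apply: (@Int_limit _ _ _ oW bW _ _ _ (fun m i => pderiv i (phi m))).
- by move=> i; exact: dw_Linfty.
- by move=> i; apply: lagr_Linfty; exact: (altseq_catl [:: i]).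
- by move=> m i; exact: test_pderiv_Linfty.
- by move=> i; exact: phiw.
- by move=> m; exact: cs.
Qed.

(* d phi /\ d psi /\ eta^s = d (psi d phi) /\ eta^s up to sign, by Schwarz. *)
Lemma weakly_closed_dd s C phi psi : weakly_closed s -> altseq C ->
    test_function W phi -> test_function W psi ->
  \sum_(i < n) \sum_(l < n) Int W (fun x => pderiv l psi x *
    (pderiv i phi x * lagr s (fun r => C (i :: l :: r)) x)) = 0.
Proof.
move=> cs aC tphi tpsi; have [phis _ _] := tphi; have [psis _ _] := tpsi.
pose H i l := lagr s (fun r => C (i :: l :: r)).
have HL i l : Linfty W (H i l) by apply: lagr_Linfty; exact: (altseq_catl [:: i; l]).
have HN i l : H i l = fun x => - H l i x.
  by apply/funext => x; rewrite -lagrN; apply: eq_ctr => r _; rewrite (aC [::]).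
have E i l : Int W (fun x => pderiv l psi x * (pderiv i phi x * H i l x)) =
    Int W (fun x => pderiv l (fun x => psi x * pderiv i phi x) x * H i l x) -
    Int W (fun x => psi x * pderiv l (pderiv i phi) x * H i l x).
  have tL := test_Linfty tpsi; have d1 := @test_pderiv_Linfty R n W.
  have tm : test_function W (fun x => psi x * pderiv i phi x).
    by apply: test_functionM => //; exact: smooth_pderiv.
  have tm' : test_function W (fun x => psi x * pderiv l (pderiv i phi) x).
    by apply: test_functionM => //; do 2!apply: smooth_pderiv.
  suff -> : Int W (fun x => pderiv l (fun x => psi x * pderiv i phi x) x * H i l x) =
      Int W (fun x => pderiv l psi x * (pderiv i phi x * H i l x)) +
      Int W (fun x => psi x * pderiv l (pderiv i phi) x * H i l x) by rewrite addrK.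
  rewrite -IntD //; try by do ?[apply: LinftyM => //]; exact: d1 || exact: test_Linfty.
    congr Int; apply/funext => x; rewrite pderivM //; last exact: smooth_pderiv.
    by ring.
  by apply: LinftyM => //; exact: test_Linfty tm'.
under eq_bigr => i _ do under eq_bigr => l _ do rewrite E.
under eq_bigr => i _ do rewrite sumrB.
rewrite sumrB big1 ?sub0r => [|i _]; last first.
  apply: (cs (fun r => C (i :: r))); first exact: (altseq_catl [:: i]).
  by apply: test_functionM => //; exact: smooth_pderiv.
rewrite sum_antisym ?oppr0 // => i l; rewrite -IntN //; last first.
  apply: LinftyM => //; apply: test_Linfty => //; apply: test_functionM => //.
  by do 2!apply: smooth_pderiv.
congr Int; apply/funext => x; rewrite (pderivC _ _ phis) HN /= mulrN.
by [].
Qed.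

Lemma altseq_front C i p r : altseq C -> C (i :: p ++ r) = (-1) ^+ size p * C (p ++ i :: r).
Proof. exact: (@altseq_move _ _ C [::]). Qed.

(** Two letters cross [p], so the two signs cancel. *)
Lemma altseq_front2 C i l p r : altseq C -> C (i :: l :: p ++ r) = C (p ++ i :: l :: r).
Proof.
move=> aC; rewrite (altseq_front l p r (altseq_catl [:: i] aC)) /= altseq_front //.
by rewrite mulrA -expr2 sqrr_sign mul1r.
Qed.

Lemma weakly_closedP s : weakly_closed s.
Proof.
elim: s => [|s IH] C phi aC tphi.
  apply: big1 => i _; rewrite (_ : (fun _ => _) = fun x => C [:: i] * pderiv i phi x).
    by rewrite IntZ ?Int_pderiv ?mulr0 //; exact: test_pderiv_Linfty.
  by apply/funext => x; rewrite /lagr /= ctr_cst mulr1 mulrC.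
have dL i : Linfty W (pderiv i phi) by exact: test_pderiv_Linfty.
have lL p : Linfty W (lagr s (fun l => C (p ++ l))) by apply: lagr_Linfty; exact: altseq_catl.
pose A i (J : {ffun 'I_k -> 'I_n}) := Int W (fun x => pderiv i phi x *
  lagr s (fun l => C (i :: codom J ++ l)) x).
pose B i l (I : coefk1) := Int W (fun x => ext_coef I (dw l x) * (pderiv i phi x *
  lagr s (fun r => C (i :: l :: codom I ++ r)) x)).
have E i : Int W (fun x => pderiv i phi x * lagr s.+1 (fun l => C (i :: l)) x) =
    \sum_(J : {ffun 'I_k -> 'I_n} | increasing J) ext_coef J xi * A i J +
    \sum_(l < n) \sum_(I : coefk1 | increasing I) B i l I.
  have AL J : Linfty W (fun x => pderiv i phi x * lagr s (fun l => C (i :: codom J ++ l)) x).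
    by apply: LinftyM => //; exact: (lL (i :: codom J)).
  have BL l (I : coefk1) : increasing I -> Linfty W (fun x => ext_coef I (dw l x) *
      (pderiv i phi x * lagr s (fun r => C (i :: l :: codom I ++ r)) x)).
    move=> iI; apply: LinftyM; first exact: dw_Linfty.
    by apply: LinftyM => //; exact: (lL (i :: l :: codom I)).
  have xL J : Linfty W (fun x => ext_coef J xi *
      (pderiv i phi x * lagr s (fun l => C (i :: codom J ++ l)) x)).
    by apply: LinftyM; [exact: Linfty_cst|exact: AL].
  transitivity (Int W (fun x =>
      \sum_(J : {ffun 'I_k -> 'I_n} | increasing J) ext_coef J xi *
        (pderiv i phi x * lagr s (fun l => C (i :: codom J ++ l)) x) +
      \sum_(l < n) \sum_(I : coefk1 | increasing I) ext_coef I (dw l x) *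
        (pderiv i phi x * lagr s (fun r => C (i :: l :: codom I ++ r)) x))).
    congr Int; apply/funext => x; rewrite lagrS; last exact: (altseq_catl [:: i]).
    rewrite mulrDr !mulr_sumr; congr (_ + _).
      by apply: eq_bigr => J _; rewrite mulrCA.
    by apply: eq_bigr => l _; rewrite mulr_sumr; apply: eq_bigr => I _; rewrite mulrCA.
  rewrite IntD //; [|exact: Linfty_sum|by apply: Linfty_sum => l _; apply: Linfty_sum => I; exact: BL].
  congr (_ + _).
    by rewrite Int_sum //; apply: eq_bigr => J _; rewrite IntZ.
  rewrite Int_sum // => [|l _]; last by apply: Linfty_sum => I; exact: BL.
  by apply: eq_bigr => l _; rewrite Int_sum // => I; exact: BL.
under eq_bigr => i _ do rewrite E.
(* In the [xi] part, moving the [k] letters of [J] ahead of [i] costs (-1)^k and leaves the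
   induction hypothesis for the tensor prefixed by [J]. *)
rewrite big_split /= exchange_big big1 ?add0r => [|J _]; last first.
  rewrite -mulr_sumr; set S := (X in _ * X); suff -> : S = 0 by rewrite mulr0.
  rewrite -[RHS](IH _ phi (altseq_scale ((-1) ^+ k) (altseq_catl (codom J) aC)) tphi).
  apply: eq_bigr => i _; congr Int; apply/funext => x; congr (_ * lagr s _ x).
  by apply/funext => l; rewrite altseq_front // size_codom card_ord.
under eq_bigr => i _ do rewrite exchange_big.
rewrite exchange_big big1 // => I iI.
rewrite pair_bigA /=.
have [_ [_ [psi [tpsi _ psiw]]]] := wW iI.
(* Only the [dw] of the expanded factor is approximated; its cofactor [d phi /\ eta^s] stays fixed
   and bounded. *)
apply: (@Int_limit _ _ _ oW bW _ (fun il x => ext_coef I (dw il.2 x)) _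
  (fun m il => pderiv il.2 (psi m))).
- by move=> il; exact: dw_Linfty.
- by move=> il; apply: LinftyM => //; exact: (lL (il.1 :: il.2 :: codom I)).
- by move=> m il; exact: test_pderiv_Linfty.
- by move=> il; exact: psiw.
move=> m; rewrite -[RHS](weakly_closed_dd IH (altseq_catl (codom I) aC) tphi (tpsi m)).
rewrite pair_bigA /=; apply: eq_bigr => il _; congr Int; apply/funext => x.
by congr (_ * (_ * lagr s _ x)); apply/funext => r; rewrite altseq_front2.
Qed.

Lemma Int_lagr s C : altseq C -> Int W (lagr s C) = ctr C (wedge_exp xi s) * fine (lebesgue_rV n W).
Proof.
elim: s C => [|s IH] C aC.
  rewrite (_ : lagr 0 C = fun=> C [::]); last first.
    by apply/funext => x; rewrite /lagr /= ctr_cst mulr1.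
  rewrite /Int Rintegral_cst; last exact: measurable_region.
  by rewrite /= ctr_cst mulr1.
have lL p : Linfty W (lagr s (fun l => C (p ++ l))) by apply: lagr_Linfty; exact: altseq_catl.
have dL i (I : coefk1) : increasing I -> Linfty W (fun x => ext_coef I (dw i x) *
    lagr s (fun l => C (i :: codom I ++ l)) x).
  by move=> iI; apply: LinftyM; [exact: dw_Linfty|exact: (lL (i :: codom I))].
have xL (J : {ffun 'I_k -> 'I_n}) : Linfty W (fun x => ext_coef J xi *
    lagr s (fun l => C (codom J ++ l)) x).
  by apply: LinftyM => //; exact: Linfty_cst.
have dsL i : Linfty W (fun x => \sum_(I : coefk1 | increasing I) ext_coef I (dw i x) *
    lagr s (fun l => C (i :: codom I ++ l)) x).
  by apply: Linfty_sum => I; exact: dL.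
rewrite (funext (fun x => lagrS s x aC)) IntD //; [|exact: Linfty_sum|exact: Linfty_sum].
rewrite [X in X + _]Int_sum // [X in _ + X]Int_sum //.
rewrite [X in _ + X](_ : _ = 0) ?addr0.
  rewrite ctr_wedge_expS // ctr_increasing; last exact: altseq_ctr.
  rewrite mulr_suml; apply: eq_bigr => J _; rewrite IntZ // IH; last exact: altseq_catl.
  by rewrite mulrA [X in X * _]mulrC.
rewrite (eq_bigr _ (fun i _ => Int_sum oW bW _ (dL i))) /=.
(* Summed over [i], the [dw] terms of a fixed [I] are, up to (-1)^(k-1), weak closedness of [eta^s]
   tested with that component of [w]. *)
rewrite exchange_big big1 // => I iI.
rewrite -[RHS](weakly_closed_limit (@weakly_closedP s) iI
  (altseq_scale ((-1) ^+ k.-1) (altseq_catl (codom I) aC))).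
apply: eq_bigr => i _; congr Int; apply/funext => x; congr (_ * lagr s _ x).
by apply/funext => l; rewrite altseq_front // size_codom card_ord.
Qed.

End null_lagrangian.

(** * Continuity, measurability and boundedness of polynomials in a form *)

Section form_topology.
Context {R : realType} {n k : nat}.
Implicit Types (f : ext_form R n k -> R) (xi eta : ext_form R n k).

(** The neighbourhood filter of the norm, used as a bare filter: this suffices for the limit lemmas
    on sums and products. *)
Definition form_nbhs xi : set_system (ext_form R n k) :=
  [set A | exists2 d, 0 < d & forall eta, ext_norm (eta - xi) < d -> A eta].

Global Instance form_nbhs_filter xi : Filter (form_nbhs xi).
Proof.
split.
- by exists 1.
- move=> A B [d d0 dA] [e e0 eB]; exists (Num.min d e); first by rewrite lt_min d0.
  by move=> eta; rewrite lt_min => /andP[/dA ? /eB ?].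
- by move=> A B AB [d d0 dA]; exists d => // eta /dA /AB.
Qed.

Definition form_continuous f := forall xi, f @ form_nbhs xi --> f xi.

Lemma ext_coef_norm (I : {ffun 'I_k -> 'I_n}) xi : increasing I ->
  `|ext_coef I xi| <= ext_norm xi.
Proof.
move=> iI; rewrite -sqrtr_sqr ler_wsqrtr // /ext_dot (bigD1 I) //= -expr2 lerDl.
by apply: sumr_ge0 => J _; rewrite -expr2 sqr_ge0.
Qed.

Lemma ext_coefB (I : {ffun 'I_k -> 'I_n}) xi eta :
  ext_coef I (xi - eta) = ext_coef I xi - ext_coef I eta.
Proof. by []. Qed.

Lemma ext_norm_le xi : ext_norm xi <=
  \sum_(I : {ffun 'I_k -> 'I_n} | increasing I) `|ext_coef I xi|.
Proof.
have S0 : 0 <= \sum_(I : {ffun 'I_k -> 'I_n} | increasing I) `|ext_coef I xi|.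
  by apply: sumr_ge0.
rewrite -[leRHS](ger0_norm S0) -sqrtr_sqr ler_wsqrtr // expr2 mulr_sumr /ext_dot.
apply: ler_sum => I iI; rewrite -normr_id -expr2 -[leLHS](ger0_norm (sqr_ge0 _)) normrX expr2.
by rewrite normr_id mulrC ler_wpM2r // (bigD1 I) //= lerDl sumr_ge0.
Qed.

Lemma ext_coef_continuous (I : {ffun 'I_k -> 'I_n}) : increasing I ->
  form_continuous (ext_coef I).
Proof.
move=> iI xi; apply/cvgrPdist_lt => e e0; exists e => // eta H /=.
by rewrite distrC -ext_coefB (le_lt_trans (ext_coef_norm _ iI)).
Qed.

Lemma form_continuous_sum J (r : seq J) (P : pred J) (g : J -> ext_form R n k -> R) :
  (forall j, P j -> form_continuous (g j)) ->
  form_continuous (fun xi => \sum_(j <- r | P j) g j xi).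
Proof.
move=> gc xi; elim: r => [|j r IH].
  by under eq_fun do rewrite big_nil; rewrite big_nil; exact: cvg_cst.
rewrite big_cons; under eq_fun do rewrite big_cons.
by case: ifP => [/gc gj|//]; apply: cvgD; [exact: gj|exact: IH].
Qed.

Lemma form_continuousM f g : form_continuous f -> form_continuous g ->
  form_continuous (fun xi => f xi * g xi).
Proof. by move=> fc gc xi; apply: cvgM; [exact: fc|exact: gc]. Qed.

Lemma ctr_wedge_exp_continuous s C : altseq C ->
  form_continuous (fun xi => ctr C (wedge_exp xi s)).
Proof.
elim: s C => [|s IH] C aC; first by move=> xi /=; exact: (cvg_cst (ctr C (cst_form 1))).
rewrite (_ : (fun xi => _) = fun xi => \sum_(J : {ffun 'I_k -> 'I_n} | increasing J)
    ctr (fun l => C (codom J ++ l)) (wedge_exp xi s) * ext_coef J xi).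
  apply: form_continuous_sum => J iJ; apply: form_continuousM.
    by apply: IH; exact: altseq_catl.
  exact: ext_coef_continuous.
apply/funext => xi; rewrite ctr_wedge_expS // ctr_increasing //.
exact: altseq_ctr.
Qed.

Lemma form_continuous_open f (A : set R) : form_continuous f -> open A ->
  @ext_open R n k (f @^-1` A).
Proof.
move=> fc oA xi Ax; have : nbhs (f xi) A by exact: open_nbhs_nbhs.
by move=> /(fc xi) [d d0 dA]; exists d.
Qed.

Lemma form_continuous_measurable f : form_continuous f -> borel_measurable f.
Proof.
move=> fc; apply: (measurability _ (RGenOpens.measurableE R)).
move=> _ [_ [a [b ->] <-]]; rewrite setTI; apply: sub_sigma_algebra.
by apply: form_continuous_open => //; exact: interval_open.
Qed.

Lemma form_continuous_bounded f : form_continuous f -> locally_bounded f.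
Proof.
move=> fc xi; have /cvgrPdist_lt/(_ 1 ltr01) [d d0 H] := fc xi.
exists d, (`|f xi| + 1); split => // eta /H /= /ltW.
rewrite distrC => H1; rewrite -[f eta](subrK (f xi)) addrC.
by apply: le_trans (ler_normD _ _) _; rewrite lerD2l.
Qed.

End form_topology.

Lemma sum_quasiaffine (R : realType) (n k : nat) (k_gt0 : (0 < k)%N)
    (f : ext_form R n k -> R) :
  (exists c : forall s : 'I_(n %/ k).+1, ext_form R n (s * k),
    forall xi, f xi = \sum_(s < (n %/ k).+1) ext_dot (c s) (wedge_exp xi s)) ->
  ext_quasiaffine k_gt0 f.
Proof.
move=> [c fc].
have fE : f = fun xi => \sum_(s < (n %/ k).+1) ctr (seqform (c s)) (wedge_exp xi s).
  by apply/funext => xi; rewrite fc; apply: eq_bigr => s _; rewrite ext_dot_ctr.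
have fcont : form_continuous f.
  rewrite fE; apply: form_continuous_sum => s _.
  by apply: ctr_wedge_exp_continuous; exact: altseq_seqform.
split; [exact: form_continuous_measurable|exact: form_continuous_bounded|].
move=> W oW bW xi w dw wW.
have lL (s : 'I_(n %/ k).+1) : Linfty W (lagr k_gt0 xi dw s (seqform (c s))).
  by apply: (lagr_Linfty k_gt0 xi wW); exact: altseq_seqform.
pose F x := \sum_(s < (n %/ k).+1) lagr k_gt0 xi dw s (seqform (c s)) x.
have FL : Linfty W F by exact: Linfty_sum.
have -> : (\int[lebesgue_rV n]_(x in W)
       (f (xi + ext_cast (prednK k_gt0) (ext_d dw x)))%:E = (Int W F)%:E)%E.
  rewrite fineK; first by apply: eq_integral => x _; rewrite fE.
  by apply: integrable_fin_num; [exact: measurable_region|exact: Linfty_integrable].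
rewrite Int_sum // (eq_bigr (fun s : 'I_(n %/ k).+1 =>
  ctr (seqform (c s)) (wedge_exp xi s) * fine (lebesgue_rV n W))); last first.
  move=> s _; apply: (Int_lagr k_gt0 oW bW xi wW); exact: altseq_seqform.
rewrite -mulr_suml EFinM fE fineK //.
by rewrite ge0_fin_numE //; exact: lebesgue_region_lty.
Qed.

(** * Test functions with gradients at the vertices of a simplex *)

Section ramp.
Context {R : realType}.

Lemma flat0_homo : {homo @flat R 0 : x y / x <= y}.
Proof.
move=> x y xy; have [x0|x0] := leP x 0; first by rewrite (flat_le0 _ x0) flat_ge0.
rewrite /flat x0 (lt_le_trans x0 xy) !expr0 !mul1r ler_expR lerN2.
by rewrite lef_pV2 // posrE // (lt_le_trans x0).
Qed.

Let c0 : R := flat 0 1.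

Let c0_gt0 : 0 < c0.
Proof. by rewrite /c0 /flat ltr01 mulr_gt0 ?expR_gt0 ?exprn_gt0 ?invr_gt0. Qed.

Let fc_gt0 : 0 < flat 0 c0.
Proof. by rewrite /flat c0_gt0 mulr_gt0 ?expR_gt0 ?exprn_gt0 ?invr_gt0. Qed.

(** A smooth passage from 0 on [x <= 0] to 1 on [x >= 1]: at [x = 1] the inner [flat] reaches [c0],
    where the outer argument stops being positive. Nesting takes the place of the usual quotient
    because [smooth_expr] is closed under composition with [flat] but contains no division. *)
Definition step (x : R) : R := 1 - (flat 0 c0)^-1 * flat 0 (c0 - flat 0 x).

Definition dstep (x : R) : R := (flat 0 c0)^-1 * (flat 2 (c0 - flat 0 x) * flat 2 x).

Lemma step_le0 x : x <= 0 -> step x = 0.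
Proof. by move=> x0; rewrite /step (flat_le0 0 x0) subr0 mulVf ?subrr ?lt0r_neq0. Qed.

Lemma step_ge1 x : 1 <= x -> step x = 1.
Proof.
by move=> x1; rewrite /step [flat 0 (_ - _)]flat_le0 ?mulr0 ?subr0 // subr_le0; exact: flat0_homo.
Qed.

Lemma step_itv x : 0 <= step x <= 1.
Proof.
apply/andP; split; last by rewrite gerBl mulr_ge0 ?flat_ge0 // invr_ge0 ltW.
rewrite subr_ge0 ler_pdivrMl // mulr1; apply: flat0_homo.
by rewrite gerBl flat_ge0.
Qed.

Lemma is_derive_step (x : R) : is_derive x 1 step (dstep x).
Proof.
have df (y : R) : is_derive y 1 (@flat R 0) (flat 2 y).
  by apply: (is_derive_eq (is_derive_flat 0 y)); rewrite mul0r subr0.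
have d1 : is_derive x 1 (fun x => c0 - flat 0 x) (- flat 2 x).
  by apply: (is_derive_eq (is_deriveB (is_derive_cst c0 x 1) (df x))); rewrite sub0r.
have d2 := is_derive1_comp (f := flat 0) (g := fun x => c0 - flat 0 x) (df (c0 - flat 0 x)) d1.
have d3 := is_deriveZ (flat 0 c0)^-1 d2.
have D : is_derive x 1 step _ := is_deriveB (is_derive_cst (1 : R) x 1) d3.
apply: (is_derive_eq D).
by rewrite /dstep sub0r mulrN -[_ *: _]/(_ * _) mulrN opprK.
Qed.

(** A smooth substitute for max(0, t), exact outside []0, d[]. Its derivative depends on [t / d]
    alone and is hence bounded uniformly in [d]. *)
Definition ramp d (t : R) : R := t * step (t / d).

Definition dramp (s : R) : R := step s + s * dstep s.

Lemma is_derive_ramp d (t : R) : is_derive t 1 (ramp d) (dramp (t / d)).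
Proof.
have d1 : is_derive t 1 (fun t => t / d) d^-1.
  have D : is_derive t 1 (fun t => t / d) _ :=
    is_deriveM (is_derive_id t 1) (is_derive_cst (d^-1 : R) t 1).
  by apply: (is_derive_eq D); rewrite scaler0 add0r [LHS]mulr1.
have D : is_derive t 1 (ramp d) _ := is_deriveM (is_derive_id t 1)
  (is_derive1_comp (f := step) (g := fun t => t / d) (is_derive_step (t / d)) d1).
apply: (is_derive_eq D); rewrite /dramp /=.
by rewrite -![_ *: _]/(_ * _) mulr1 addrC mulrA mulrAC.
Qed.

Lemma dramp_le0 s : s <= 0 -> dramp s = 0.
Proof. by move=> s0; rewrite /dramp /dstep step_le0 // (flat_le0 2 s0) !mulr0 addr0. Qed.

Lemma dramp_ge1 s : 1 <= s -> dramp s = 1.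
Proof.
move=> s1; rewrite /dramp /dstep step_ge1 // [flat 2 (_ - _)]flat_le0 ?mul0r ?mulr0 ?addr0 //.
by rewrite subr_le0; exact: flat0_homo.
Qed.

Lemma dramp_bounded : exists2 K : R, 1 <= K & forall s, `|dramp s| <= K.
Proof.
(* The bound [flat 2 y <= 4! y^2] of [flat_le], once with [y <= c0] and once with [y <= 1]. *)
pose K : R := 1 + (flat 0 c0)^-1 * (4`!%:R * c0 ^+ 2 * 4`!%:R).
have K0 : 0 <= (flat 0 c0)^-1 * (4`!%:R * c0 ^+ 2 * 4`!%:R).
  by rewrite !mulr_ge0 ?invr_ge0 ?sqr_ge0 ?ler0n // ltW.
exists K => [|s]; first by rewrite lerDl.
have [s0|s0] := leP s 0; first by rewrite dramp_le0 // normr0 addr_ge0.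
have [s1|s1] := leP 1 s; first by rewrite dramp_ge1 // normr1 lerDl.
have /andP[S0 S1] := step_itv s.
have D0 : 0 <= dstep s by rewrite !mulr_ge0 ?flat_ge0 ?invr_ge0 // ltW.
rewrite /dramp ger0_norm; last by rewrite addr_ge0 // mulr_ge0 // ltW.
rewrite lerD //; apply: le_trans (ler_piMl D0 (ltW s1)) _.
rewrite ler_wpM2l ?invr_ge0 ?(ltW fc_gt0) //; apply: ler_pM; rewrite ?flat_ge0 //.
- apply: le_trans (flat_le _ _) _; rewrite ler_wpM2l ?ler0n //.
  have [h|h] := leP 0 (c0 - flat 0 s).
    by rewrite lerXn2r ?nnegrE ?(ltW c0_gt0) // gerBl flat_ge0.
  by move: h; rewrite ltNge subr_ge0 => /negP[]; exact: flat0_homo (ltW s1).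
- apply: le_trans (flat_le _ _) _; rewrite -[leRHS]mulr1 ler_wpM2l ?ler0n //.
  by rewrite expr_le1 // ltW.
Qed.

Lemma ramp_le0 d t : 0 < d -> t <= 0 -> ramp d t = 0.
Proof. by move=> d0 t0; rewrite /ramp step_le0 ?mulr0 // pmulr_lle0 ?invr_gt0. Qed.

Lemma ramp_itv d t : 0 < d -> Num.max 0 t - d <= ramp d t <= Num.max 0 t.
Proof.
move=> d0; have [t0|t0] := leP t 0.
  by rewrite ramp_le0 // lexx sub0r oppr_le0 ltW.
have /andP[S0 S1] := step_itv (t / d).
rewrite /ramp; apply/andP; split; last by rewrite ler_piMr // ltW.
have [td|td] := leP d t.
  by rewrite step_ge1 ?mulr1 ?gerBl ?(ltW d0) // ler_pdivlMr // mul1r.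
by rewrite (@le_trans _ _ 0) ?subr_le0 ?(ltW td) // mulr_ge0 // ltW.
Qed.

Lemma ramp_smooth_expr n d (u : 'rV[R]_n -> R) : smooth_expr u ->
  smooth_expr (fun x => ramp d (u x)).
Proof.
move=> us; rewrite (_ : (fun x => _) = u * (cst 1 + cst (- (flat 0 c0)^-1) *
    (flat 0 \o (cst c0 + cst (- 1) * (flat 0 \o (u * cst d^-1)))))).
  by do ![apply: Smooth_mul|apply: Smooth_add|apply: Smooth_flat|exact: us|exact: Smooth_cst].
by apply/funext => x; rewrite /ramp /step !fctE /= mulN1r mulNr.
Qed.

Lemma pderiv_ramp n d (u : 'rV[R]_n -> R) i x : differentiable u x ->
  pderiv i (fun x => ramp d (u x)) x = dramp (u x / d) * pderiv i u x.
Proof.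
move=> ud; have D := is_derive_ramp d (u x).
exact: (@derive_comp1 _ _ (ramp d) (fun t => dramp (t / d))).
Qed.

End ramp.

(** * Smooth approximation of a maximum of coordinates *)

Section smooth_maximum.
Context {R : realType} {n : nat} (W : set 'rV[R]_n).
Hypotheses (oW : open W) (bW : bounded_set W).

Lemma open_layer (h : 'rV[R]_n -> R) (d : R) : continuous h ->
  open (W `&` [set x | (0 < h x < d)%R]).
Proof.
move=> hc; apply: openI => //; rewrite (_ : [set x | _] = h @^-1` `]0, d[%classic).
  by move/continuousP : hc => /(_ _ (interval_open _ _)); apply.
by apply/seteqP; split => x /=; rewrite in_itv.
Qed.

(** The layers [0 < h < 1/(m+1)] decrease to the empty set inside a set of finite measure.
    Strictness at 0 matters, as the level set [h = 0] may have positive measure. *)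
Lemma thin_layer (h : 'rV[R]_n -> R) (e : R) : continuous h -> 0 < e ->
  exists2 d : R, 0 < d & (lebesgue_rV n (W `&` [set x | (0 < h x < d)%R]) < e%:E)%E.
Proof.
move=> hc e0; pose E m := W `&` [set x | 0 < h x < m.+1%:R^-1].
have oE m : open (E m) by exact: open_layer.
have mE m : measurable (E m) by exact: open_rV_measurable.
have E0 : \bigcap_m E m = set0.
  rewrite -subset0 => x H; have [_ /= /andP[hx _]] := H 0%N I.
  have : \forall m \near \oo, m.+1%:R^-1 < (PosNum hx)%:num by exact: near_infty_natSinv_lt.
  move=> /filter_ex[m /= mh]; have [_ /= /andP[_]] := H m I.
  by rewrite ltNge (ltW mh).
have E0lty : (lebesgue_rV n (E 0%N) < +oo)%E.
  apply: le_lt_trans (lebesgue_region_lty oW bW); apply: le_measure; rewrite ?inE //.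
    exact: open_rV_measurable.
  by move=> x [].
have niE : nonincreasing_seq E.
  move=> m m' mm'; apply/subsetPset => x [Wx /= /andP[h0 hm]]; split => //=.
  rewrite h0 (lt_le_trans hm) // lef_pV2 ?posrE ?ltr0n // ler_nat.
  by rewrite ltnS.
have mE0 : measurable (\bigcap_m E m) by rewrite E0.
have := nonincreasing_cvg_mu E0lty mE mE0 niE; rewrite E0 measure0.
move=> /fine_cvgP[fin /cvgr_lt /(_ _ e0) lte].
have [m [mfin me]] := filter_ex (filterI fin lte).
exists m.+1%:R^-1; first by rewrite invr_gt0.
by change ((lebesgue_rV n \o E) m < e%:E)%E; rewrite -(fineK mfin) lte_fin.
Qed.

Definition max0N (s : seq 'I_n) (x : 'rV[R]_n) : R :=
  foldr (fun j t => Num.max t (- x 0 j)) 0 s.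

(** The values meant are the vertices 0 and -e_j, that is, the gradients of [max0N] wherever it is
    differentiable. *)
Definition grad_in_simplex (u : 'rV[R]_n -> R) x :=
  (forall i, pderiv i u x = 0) \/ exists j, forall i, pderiv i u x = - (j == i)%:R.

Lemma pderiv_coord i j (x : 'rV[R]_n) : pderiv i (fun x => - x 0 j) x = - (j == i)%:R.
Proof.
have Lh (h : R) : (- (h *: delta_mx 0 i + x : 'rV[R]_n) 0 j : R^o) =
    h *: (- (j == i)%:R : R^o) + - x 0 j by rewrite !mxE eqxx opprD scalerN.
by have [+ _] := derive_affine_comp (L := fun y : 'rV[R]_n => - y 0 j : R^o) id Lh; rewrite derive_id.
Qed.

(** A coordinate is added by [u + ramp d (- x_j - u)], whose gradient is that of [u] or -e_j outside
    the transition layer of the ramp. The bound [G] precedes [e] in the quantifiers: shrinking the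
    exceptional set does not make the gradients grow. *)
Lemma smooth_max (s : seq 'I_n) : exists2 G : R, 0 <= G & forall e : R, 0 < e ->
  exists u A, [/\ smooth_expr u, forall x, max0N s x - e <= u x <= max0N s x,
    forall i x, `|pderiv i u x| <= G,
    measurable A /\ (lebesgue_rV n A < e%:E)%E &
    forall x, W x -> ~ A x -> grad_in_simplex u x].
Proof.
elim: s => [|j s [G G0 IH]].
  exists 0 => // e e0; exists (cst 0), set0; split => //.
  - exact: Smooth_cst.
  - by move=> x; rewrite /= lexx sub0r oppr_le0 ltW.
  - by move=> i x; rewrite /pderiv derive_cst normr0.
  - by rewrite measure0 lte_fin.
  - by move=> x _ _; left => i; rewrite /pderiv derive_cst.
have [K K1 Kd] := @dramp_bounded R.
exists (G + K * (1 + G)) => [|e e0].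
  by rewrite addr_ge0 // mulr_ge0 // ?addr_ge0 // (le_trans _ K1).
have e20 : 0 < e / 2 by rewrite divr_gt0.
have [u [A [us uU uG [mA Ae] Ag]]] := IH _ e20.
pose h (x : 'rV[R]_n) := - x 0 j - u x.
have cs : smooth_expr (fun x : 'rV[R]_n => - x 0 j).
  rewrite (_ : (fun _ => _) = cst (- 1) * (fun x : 'rV[R]_n => x 0 j)).
    by apply: Smooth_mul; [exact: Smooth_cst|exact: Smooth_coord].
  by apply/funext => x; rewrite !fctE mulN1r.
have hs : smooth_expr h.
  rewrite (_ : h = (fun x : 'rV[R]_n => - x 0 j) + cst (- 1) * u).
    by apply: Smooth_add => //; apply: Smooth_mul => //; exact: Smooth_cst.
  by apply/funext => x; rewrite !fctE mulN1r.
have hc : continuous h by apply: smooth_continuous; exact: smooth_exprP.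
have [d1 d10 d1e] := thin_layer hc e20.
(* [d1] controls the measure of the new layer, [e / 2] the new error in the value. *)
pose d := Num.min d1 (e / 2); have d0 : 0 < d by rewrite lt_min d10.
pose v x := u x + ramp d (h x).
have vp i x : pderiv i v x = pderiv i u x + dramp (h x / d) * (- (j == i)%:R - pderiv i u x).
  have D (w : 'rV[R]_n -> R) : smooth_expr w -> derivable w x (delta_mx 0 i).
    by move=> ws; exact/diff_derivable/smooth_expr_diff.
  have -> : pderiv i v x = pderiv i u x + pderiv i (fun x => ramp d (h x)) x.
    by rewrite /pderiv -deriveD //; apply: D => //; exact: ramp_smooth_expr.
  rewrite pderiv_ramp; last exact: smooth_expr_diff.
  by rewrite -(pderiv_coord i j x) /pderiv -deriveB //; exact: D.
exists v, (A `|` (W `&` [set x | 0 < h x < d])); split.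
- by apply: Smooth_add => //; exact: ramp_smooth_expr.
- move=> x /=; have /andP[u1 u2] := uU x; have /andP[r1 r2] := ramp_itv (h x) d0.
  have de : d <= e / 2 by rewrite ge_min lexx orbT.
  move: u1 u2 r1 r2; rewrite /v /h; set M := max0N s x; set a := - x 0 j.
  have [] := leP 0 (a - u x); have [] := leP M a => *; apply/andP; split; lra.
- move=> i x; rewrite vp; apply: le_trans (ler_normD _ _) _; rewrite lerD // normrM.
  apply: ler_pM => //; apply: le_trans (ler_normB _ _) _; rewrite lerD //.
  by rewrite normrN normr_nat lern1 leq_b1.
- have mL r : measurable (W `&` [set x | (0 < h x < r)%R]).
    by apply: open_rV_measurable; exact: open_layer.
  split; first exact: measurableU.
  have H := measureU2 (lebesgue_rV n) mA (mL d). apply: (le_lt_trans H).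
  rewrite [e]splitr EFinD; apply: lteD => //; apply: le_lt_trans d1e.
  apply: le_measure; rewrite ?inE //.
  move=> x [Wx /= /andP[h0 hd]]; split => //=; rewrite h0 (lt_le_trans hd) //.
  by rewrite ge_min lexx.
- move=> x Wx /not_orP[Ax /not_andP[//|hx]].
  have [h0|h0] := leP (h x) 0.
    have E i : pderiv i v x = pderiv i u x.
      by rewrite vp dramp_le0 ?mul0r ?addr0 // pmulr_lle0 ?invr_gt0.
    by case: (Ag x Wx Ax) => [H|[j' H]]; [left|right; exists j'] => i; rewrite E.
  have hd : 1 <= h x / d.
    rewrite ler_pdivlMr // mul1r leNgt; apply/negP => hd; apply: hx.
    by rewrite /= h0.
  by right; exists j => i; rewrite vp (dramp_ge1 hd) mul1r addrC subrK.
Qed.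

End smooth_maximum.

(** * Functions of a gradient with exact averages are affine *)

Section quasiaffine_scalar.
Context {R : realType} {n : nat}.
Variable p : 'rV[R]_n -> R.

Definition grad (u : 'rV[R]_n -> R) (x : 'rV[R]_n) : 'rV[R]_n := \row_i pderiv i u x.

Hypothesis p_bounded : forall M, exists B, forall y, `|y| <= M -> `|p y| <= B.
Hypothesis p_measurable : forall g : 'rV[R]_n -> 'rV[R]_n,
  continuous g -> measurable_fun setT (p \o g).
Hypothesis p_quasiaffine : forall (W : set 'rV[R]_n) phi v,
  open W -> bounded_set W -> test_function W phi ->
  (\int[lebesgue_rV n]_(x in W) (p (v + grad phi x))%:E = (p v)%:E * lebesgue_rV n W)%E.

Section simplex.
Variables (L L' : R) (v : 'rV[R]_n).
Hypotheses (L'0 : 0 < L') (Lv : forall i, - L < v 0 i)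
  (vL' : \sum_i (v 0 i + L) < L').

Let v0 : 'rV[R]_n := const_mx (- L).
Let vtx j : 'rV[R]_n := v0 + L' *: delta_mx 0 j.
Let w i := v 0 i + L.
Let q (y : 'rV[R]_n) : R := p v0 + \sum_j (y 0 j + L) / L' * (p (vtx j) - p v0).
(* A pyramid over W: its gradients are the v0 - v and vtx j - v. *)
Let phi0 (x : 'rV[R]_n) := 1 - \sum_i w i * x 0 i - L' * max0N (enum 'I_n) x.
Let W := [set x | 0 < phi0 x].

Let w_gt0 i : 0 < w i.
Proof. by rewrite /w -ltrBlDr sub0r; exact: Lv. Qed.

Let q_v0 : q v0 = p v0.
Proof. by rewrite /q big1 ?addr0 // => j _; rewrite mxE addNr !mul0r. Qed.

Let q_vtx j : q (vtx j) = p (vtx j).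
Proof.
rewrite /q (bigD1 j) //= big1 => [|l lj].
  by rewrite !mxE !eqxx mulr1 addrAC addNr add0r divff ?lt0r_neq0 // mul1r addr0 addrC subrK.
by rewrite !mxE eqxx (negPf lj) mulr0 addr0 addNr !mul0r.
Qed.

Lemma max0N_ge0 s (x : 'rV[R]_n) : 0 <= max0N s x.
Proof. by elim: s => //= j s IH; rewrite le_max IH. Qed.

Lemma max0N_ge s (x : 'rV[R]_n) j : j \in s -> - x 0 j <= max0N s x.
Proof.
elim: s => //= l s IH; rewrite inE le_max => /orP[/eqP ->|/IH ->//].
by rewrite lexx orbT.
Qed.

Lemma max0N_continuous s : continuous (@max0N R n s).
Proof.
elim: s => [|j s IH] x; first exact: (@cst_continuous _ _ (0 : R) x).
apply: (@continuous_max _ _ (@max0N R n s) (fun x : 'rV[R]_n => - x 0 j)); first exact: IH.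
exact: (@continuous_comp _ _ _ (fun x : 'rV[R]_n => x 0 j) -%R x
  (@rV_coord_continuous R n j x) (@oppr_continuous _ R^o _)).
Qed.

Lemma smooth_linear (a : 'I_n -> R) : smooth_expr (fun x : 'rV[R]_n => \sum_i a i * x 0 i).
Proof.
elim: (index_enum _) => [|i r IH].
  rewrite (_ : (fun _ => _) = cst 0); first exact: Smooth_cst.
  by apply/funext => x; rewrite big_nil.
rewrite (_ : (fun _ => _) = cst (a i) * (fun x : 'rV[R]_n => x 0 i) +
  (fun x : 'rV[R]_n => \sum_(i <- r) a i * x 0 i)).
  by apply: Smooth_add => //; apply: Smooth_mul; [exact: Smooth_cst|exact: Smooth_coord].
by apply/funext => x; rewrite big_cons.
Qed.

Lemma pderiv_linear (a : 'I_n -> R) i x : pderiv i (fun x : 'rV[R]_n => \sum_i a i * x 0 i) x = a i.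
Proof.
have Lh (h : R) : (\sum_l a l * (h *: delta_mx 0 i + x : 'rV[R]_n) 0 l : R^o) =
    h *: (a i : R^o) + \sum_l a l * x 0 l.
  under eq_bigr => l _ do rewrite !mxE eqxx /= mulrDr.
  rewrite big_split /= (bigD1 i) //= eqxx mulr1 big1 ?addr0 ?[a i * h]mulrC // => l li.
  by rewrite (negPf li) !mulr0.
by have [+ _] := derive_affine_comp (L := fun y : 'rV[R]_n => \sum_l a l * y 0 l : R^o) id Lh;
  rewrite derive_id.
Qed.

Let lin (x : 'rV[R]_n) := 1 - \sum_i w i * x 0 i.

Let lin_smooth : smooth_expr lin.
Proof.
rewrite (_ : lin = cst 1 + cst (- 1) * (fun x : 'rV[R]_n => \sum_i w i * x 0 i)).
  by do ![apply: Smooth_add|apply: Smooth_mul|exact: Smooth_cst|exact: smooth_linear].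
by apply/funext => x; rewrite !fctE mulN1r.
Qed.

Let phi0_continuous : continuous phi0.
Proof.
move=> x; apply: (@continuousB _ R^o _ lin (fun x => L' * max0N (enum 'I_n) x)).
  by apply: smooth_continuous; exact: smooth_exprP.
by apply: (@continuousM _ _ (cst L')); [exact: cst_continuous|exact: max0N_continuous].
Qed.

Let open_W : open W.
Proof.
rewrite (_ : W = phi0 @^-1` `]0, +oo[%classic).
  by move/continuousP : phi0_continuous => /(_ _ (interval_open _ _)); apply.
by apply/seteqP; split => x /=; rewrite in_itv /= andbT.
Qed.

(** This is where [v] has to be interior. On [W], [L' * U < 1 - \sum_i w i * x 0 i <= 1 + U * \sum_i
    w i] with [\sum_i w i < L'] bounds [U], hence every coordinate from below; positivity of each
    [w j] then bounds it from above. *)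
Let W_bound : exists M, forall x, W x -> `|x| <= M.
Proof.
pose sg := (\sum_i w i) / L'.
have sg1 : sg < 1 by rewrite ltr_pdivrMr // mul1r.
have w0 : 0 <= \sum_i w i by apply: sumr_ge0 => i _; exact: ltW.
pose C := (L' * (1 - sg))^-1.
have C0 : 0 < C by rewrite invr_gt0 mulr_gt0 // subr_gt0.
exists (C + \sum_i (1 + L' * C) / w i) => x Wx.
have LC : 0 <= 1 + L' * C by rewrite addr_ge0 // mulr_ge0 // ltW.
have S0 (P : pred 'I_n) : 0 <= \sum_(i | P i) (1 + L' * C) / w i.
  by apply: sumr_ge0 => i _; apply: divr_ge0 => //; exact: ltW.
pose U := max0N (enum 'I_n) x; have U0 : 0 <= U by exact: max0N_ge0.
have xU j : - x 0 j <= U by apply: max0N_ge; rewrite mem_enum.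
have Wx' : \sum_i w i * x 0 i + L' * U < 1.
  by move: Wx; rewrite /W /= /phi0 -/U; lra.
have UC : U <= C.
  rewrite /C -[_^-1]mul1r ler_pdivlMr ?mulr_gt0 ?subr_gt0 //.
  have : - \sum_i w i * U <= \sum_i w i * x 0 i.
    rewrite -sumrN; apply: ler_sum => i _; rewrite -mulrN ler_pM2l //.
    by rewrite lerNl.
  rewrite -mulr_suml (_ : \sum_i w i = sg * L'); last by rewrite divfK ?lt0r_neq0.
  by move: Wx'; lra.
apply: rV_norm_le => [|j]; first by rewrite addr_ge0 // ltW.
rewrite ler_norml; apply/andP; split.
  by rewrite lerNl (le_trans (xU j)) // (le_trans UC) // lerDl.
rewrite (@le_trans _ _ ((1 + L' * C) / w j)) //.
  rewrite ler_pdivlMr // mulrC.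
  have : - \sum_(i | i != j) w i * C <= \sum_(i | i != j) w i * x 0 i.
    rewrite -sumrN; apply: ler_sum => i _; rewrite -mulrN ler_pM2l //.
    by rewrite lerNl (le_trans (xU i)).
  have : \sum_(i | i != j) w i * C <= L' * C.
    rewrite -mulr_suml ler_pM2r // (le_trans _ (ltW vL')) // [leRHS](bigD1 j) //= lerDr.
    exact: ltW (w_gt0 j).
  have LU : 0 <= L' * U by rewrite mulr_ge0 // ltW.
  by move: Wx'; rewrite (bigD1 j) //=; move: LU; lra.
by rewrite [X in _ <= _ + X](bigD1 j) //= addrCA lerDl addr_ge0 ?(ltW C0).
Qed.

Let bounded_W : bounded_set W.
Proof.
have [M MW] := W_bound; exists M; split; first exact: num_real.
by move=> N MN x /MW /le_trans; apply; exact: ltW.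
Qed.

Let W_pos : (0 < lebesgue_rV n W)%E.
Proof.
have /nbhs_ballP[r /= r0 rW] : nbhs (0 : 'rV[R]_n) W.
  apply: open_nbhs_nbhs; split => //; rewrite /W /= /phi0.
  rewrite big1 ?subr0 => [|i _]; last by rewrite mxE mulr0.
  rewrite (_ : max0N _ _ = 0) ?mulr0 ?subr0 //.
  by elim: (enum _) => //= j s ->; rewrite mxE oppr0 maxxx.
apply: (@lt_le_trans _ _ (lebesgue_rV n (rV_box 0 r))).
  by rewrite lebesgue_rV_box ?(ltW r0) // lte_fin exprn_gt0 // mulrn_wgt0.
apply: le_measure; rewrite ?inE; [exact: measurable_rV_box|exact: open_rV_measurable|].
move=> x xr; apply: rW; rewrite mx_norm_ball /ball_ /= sub0r normrN.
by apply: rV_norm_lt => // i; have := xr i; rewrite mxE subr0.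
Qed.

(** A smooth [z] slightly above the pyramid is lowered by [c] and cut off at 0 by the ramp. The
    lowering pushes the support into a compact subset of [W], at the price of a thin layer along the
    boundary. *)
Let pyramids : exists2 G, 0 <= G & forall e : R, 0 < e ->
  exists phi A, [/\ test_function W phi, forall i x, `|pderiv i phi x| <= G,
    measurable A /\ (lebesgue_rV n A < e%:E)%E &
    forall x, W x -> ~ A x ->
      v + grad phi x = v0 \/ exists j, v + grad phi x = vtx j].
Proof.
have [G0 G00 umax] := smooth_max open_W bounded_W (enum 'I_n).
have [K K1 Kd] := @dramp_bounded R; have K0 : 0 <= K by exact: le_trans K1.
have w0 : 0 <= \sum_i w i by apply: sumr_ge0 => i _; exact: ltW.
exists (K * (\sum_i w i + L' * G0)) => [|e e0].
  by rewrite mulr_ge0 // addr_ge0 // mulr_ge0 // ltW.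
have e20 : 0 < e / 2 by rewrite divr_gt0.
have [d d0 de] := thin_layer open_W bounded_W phi0_continuous e20.
(* The ramp applied to [z - c] has full slope from [z = 2c = d] on, and [z >= phi0]. *)
pose c := d / 2; have c0 : 0 < c by rewrite divr_gt0.
(* The second bound gives [L' * eps <= c / 2], so that [z > c] forces [phi0 >= c / 2], well inside
   [W]. *)
pose eps := Num.min (e / 2) (c / (2 * L')).
have eps0 : 0 < eps by rewrite lt_min e20 divr_gt0 // mulr_gt0.
have [u [A [us uU uG [mA Ae] Ag]]] := umax _ eps0.
pose z x := lin x - L' * u x.
have zs : smooth_expr z.
  rewrite (_ : z = lin + cst (- L') * u); last by apply/funext => x; rewrite !fctE mulNr.
  by apply: Smooth_add; [exact: lin_smooth|apply: Smooth_mul; [exact: Smooth_cst|exact: us]].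
have zphi x : phi0 x <= z x <= phi0 x + c / 2.
  have /andP[u1 u2] := uU x.
  have Le : L' * eps <= c / 2.
    rewrite (_ : c / 2 = L' * (c / (2 * L'))); last by field; rewrite lt0r_neq0.
    by rewrite ler_pM2l // ge_min lexx orbT.
  have Lu : L' * u x <= L' * max0N (enum 'I_n) x by rewrite ler_pM2l.
  have Ll : L' * (max0N (enum 'I_n) x - eps) <= L' * u x by rewrite ler_pM2l.
  by rewrite /z /phi0 /lin; apply/andP; split; move: Lu Ll Le; lra.
have pz i x : pderiv i z x = - w i - L' * pderiv i u x.
  have D (g : 'rV[R]_n -> R) : smooth_expr g -> derivable g x (delta_mx 0 i).
    by move=> gs; exact/diff_derivable/smooth_expr_diff.
  have Du := D _ us; have Dl := D _ (smooth_linear w); have Dc := D _ (Smooth_cst 1).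
  rewrite (_ : z = cst 1 - (fun x : 'rV[R]_n => \sum_i w i * x 0 i) - L' \*: u) //.
  have E1 := deriveB (derivableB Dc Dl) (@derivableZ _ _ _ _ L' _ _ Du).
  have E2 := deriveB Dc Dl; have E3 := @deriveZ _ _ _ _ L' _ _ Du.
  rewrite /pderiv; apply: etrans E1 _; rewrite E2 E3 derive_cst sub0r.
  by congr (- _ - _); exact: pderiv_linear.
pose phi x := ramp c (z x - c).
have zcs : smooth_expr (fun x => z x - c).
  by rewrite (_ : (fun _ => _) = z + cst (- c)) //; apply: Smooth_add => //; exact: Smooth_cst.
have pphi i x : pderiv i phi x = dramp ((z x - c) / c) * (- w i - L' * pderiv i u x).
  rewrite pderiv_ramp; last exact: smooth_expr_diff.
  congr (_ * _); rewrite -pz.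
  have Dz : derivable (z : _ -> R^o) x (delta_mx 0 i) by exact/diff_derivable/smooth_expr_diff.
  have Dc : derivable (cst c : _ -> R^o) x (delta_mx 0 i).
    exact/diff_derivable/smooth_expr_diff/Smooth_cst.
  by apply: etrans (deriveB Dz Dc) _; rewrite derive_cst subr0.
pose F := [set x | c / 2 <= phi0 x].
have FW : F `<=` W by move=> x; apply: lt_le_trans; rewrite divr_gt0.
have suppF : closure [set x | phi x != 0] `<=` F.
  have cF : closed F.
    rewrite (_ : F = phi0 @^-1` `[c / 2, +oo[%classic).
      by apply: closed_comp => //; exact: rray_closed.
    by apply/seteqP; split => x /=; rewrite in_itv /= andbT.
  apply: (@subset_trans _ (closure F)); last by rewrite -((closure_id F).1 cF).
  apply: closure_subset => x /= px.
  have zc : c < z x.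
    rewrite ltNge; apply/negP => zc; case/eqP: px; rewrite /phi ramp_le0 //.
    by rewrite subr_le0.
  by have /andP[_ z2] := zphi x; rewrite /F /=; move: zc z2; lra.
exists phi, (A `|` (W `&` [set x | (0 < phi0 x < d)%R])); split.
- split; first by apply: smooth_exprP; exact: ramp_smooth_expr.
    apply: bounded_closed_compact; last exact: closed_closure.
    have [M [Mr MW]] := bounded_W; exists M; split => // N MN x xS.
    by apply: MW MN _ _; apply: FW; exact: suppF.
  by apply: subset_trans FW.
- move=> i x; rewrite pphi normrM; apply: ler_pM => //.
  apply: le_trans (ler_normB _ _) _; rewrite normrN normrM (gtr0_norm (w_gt0 i)) (gtr0_norm L'0).
  rewrite lerD //; first by rewrite (bigD1 i) //= lerDl sumr_ge0 // => l _; exact: ltW.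
  by rewrite ler_pM2l.
- have mL : measurable (W `&` [set x | (0 < phi0 x < d)%R]).
    by apply: open_rV_measurable; exact: open_layer.
  split; first exact: measurableU.
  have H := measureU2 (lebesgue_rV n) mA mL; apply: (le_lt_trans H).
  rewrite [e]splitr EFinD; apply: lteD => //; apply: lt_le_trans Ae _.
  by rewrite lee_fin ge_min lexx.
- move=> x Wx /not_orP[Ax /not_andP[//|hx]].
  have dphi : d <= phi0 x.
    by rewrite leNgt; apply/negP => hd; apply: hx; rewrite /= hd andbT.
  have D1 : dramp ((z x - c) / c) = 1.
    apply: dramp_ge1; rewrite ler_pdivlMr // mul1r.
    have /andP[z1 _] := zphi x; move: z1 dphi; rewrite /c; lra.
  have [H|[j H]] := Ag x Wx Ax; [left|right; exists j]; apply/rowP => i.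
    by rewrite !mxE pphi D1 H mulr0 subr0 mul1r /w opprD addNKr.
  rewrite !mxE pphi D1 H mul1r /w mulrN opprK opprD addrA addNKr.
  by rewrite eqxx /= [i == j]eq_sym.
Qed.

(** The interpolant [q] averages exactly too, being affine, so [p - q] along the slopes has integral
    [D * mW]. But it vanishes where the slopes are vertices and is bounded on the rest, whose
    measure is arbitrarily small; hence [D = 0]. *)
Lemma affine_on_simplex :
  p v = p v0 + \sum_j (v 0 j + L) / L' * (p (vtx j) - p v0).
Proof.
rewrite -/(q v); apply/eqP; rewrite -subr_eq0; apply/negPn/negP => D0.
set D := p v - q v in D0.
have fW : (lebesgue_rV n W < +oo)%E by exact: lebesgue_region_lty open_W bounded_W.
pose mW := fine (lebesgue_rV n W).
have mW0 : 0 < mW by rewrite fine_gt0 // W_pos fW.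
have [G G0 pyr] := pyramids.
have [B0 pB] := p_bounded (`|v| + G).
pose Q : R := `|p v0| + \sum_j (`|v| + G + `|L|) / L' * `|p (vtx j) - p v0|.
pose B := `|B0| + Q.
have Q0 : 0 <= Q.
  rewrite addr_ge0 // sumr_ge0 // => j _; rewrite mulr_ge0 // divr_ge0 ?(ltW L'0) //.
  by rewrite !addr_ge0.
have B00 : 0 <= B by rewrite addr_ge0.
(* Chosen so that [B * e < |D| * mW]; this is not circular, since [B] depends on [G] but not on the
   pyramid. *)
pose e := `|D| * mW / (B + 1).
have e0 : 0 < e by rewrite divr_gt0 ?mulr_gt0 ?normr_gt0 // ltr_wpDl.
have [phi [A [tphi phiG [mA Ae] Ag]]] := pyr e e0.
have [phis _ _] := tphi.
pose y x := v + grad phi x.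
have yB x : `|y x| <= `|v| + G.
  apply: le_trans (ler_normD _ _) _; rewrite lerD2l; apply: rV_norm_le => // i.
  by rewrite mxE.
have pL : Linfty W (fun x => p (y x)).
  split; last by exists B0; apply: aeW => x _; apply: pB.
  apply: measurable_funTS; apply: p_measurable => x.
  apply: (@continuousD _ _ _ (cst v) (grad phi) x); first exact: cst_continuous.
  apply: (rV_continuous (f := grad phi)) => i.
  rewrite (_ : (fun _ => _) = pderiv i phi); last by apply/funext => t; rewrite mxE.
  by apply: smooth_continuous; exact: smooth_pderiv.
pose a j := (p (vtx j) - p v0) / L'.
have qE x : q (y x) = q v + \sum_j a j * pderiv j phi x.
  rewrite /q -addrA -big_split /=; congr (_ + _); apply: eq_bigr => j _.
  by rewrite !mxE /a; ring.
have aL j : Linfty W (fun x => a j * pderiv j phi x).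
  by apply: LinftyM; [exact: Linfty_cst|exact: test_pderiv_Linfty].
have qL : Linfty W (fun x => q (y x)).
  rewrite (funext qE); apply: LinftyD => //; [exact: Linfty_cst|exact: Linfty_sum].
pose F x := p (y x) - q (y x).
have FL : Linfty W F.
  rewrite (_ : F = fun x => p (y x) + (-1) * q (y x)).
    by apply: LinftyD => //; apply: LinftyM => //; exact: Linfty_cst.
  by apply/funext => x; rewrite mulN1r.
have mWm : measurable W by exact: open_rV_measurable.
have IF : Int W F = D * mW.
  rewrite (_ : F = fun x => p (y x) + (-1) * q (y x)); last by apply/funext => x; rewrite mulN1r.
  rewrite IntD // ?IntZ //; last by apply: LinftyM => //; exact: Linfty_cst.
  rewrite {1}/Int /Rintegral p_quasiaffine // fineM //; last by rewrite ge0_fin_numE.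
  rewrite (funext qE) IntD //; [|exact: Linfty_cst|exact: Linfty_sum].
  rewrite /Int Rintegral_cst // -/(Int W _) Int_sum // big1 ?addr0 => [|j _].
    by rewrite /D mulN1r mulrBl.
  by rewrite IntZ ?Int_pderiv ?mulr0 //; exact: test_pderiv_Linfty.
have FB x : `|F x| <= B.
  apply: le_trans (ler_normB _ _) _; rewrite lerD //.
    by apply: le_trans (pB _ (yB x)) _; rewrite ler_norm.
  apply: le_trans (ler_normD _ _) _; rewrite lerD2l.
  apply: le_trans (ler_norm_sum _ _ _) _; apply: ler_sum => j _.
  rewrite normrM ler_wpM2r // normrM normfV (gtr0_norm L'0) ler_pM2r ?invr_gt0 //.
  apply: le_trans (ler_normD _ _) _; rewrite lerD2r.
  exact: le_trans (rV_norm_coord _ _) (yB x).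
have AL : Linfty W (\1_A : _ -> R).
  split; first exact: measurable_funTS.
  by exists 1; apply: aeW => x _; rewrite indicE; case: (_ \in _); rewrite ?normr1 ?normr0.
have FA : Int W F = Int W (fun x => \1_A x * F x).
  apply: eq_Rintegral => x; rewrite inE => Wx; rewrite indicE.
  case: (boolP (x \in A)) => [_|]; first by rewrite mul1r.
  move=> /negP xA; rewrite mul0r /F /y.
  have nA : ~ A x by move=> Ax; apply: xA; rewrite inE.
  by have [->|[j ->]] := Ag x Wx nA; rewrite ?q_v0 ?q_vtx subrr.
have := Int_norm_le open_W bounded_W AL FL B00 (aeW _ (fun x _ => FB x)).
rewrite -FA IF normrM (gtr0_norm mW0) leNgt => /negP; apply.
have IA : Int W (fun x => `|\1_A x : R|) <= e.
  rewrite (_ : (fun _ => _) = \1_A); last first.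
    by apply/funext => x; rewrite indicE; case: (_ \in _); rewrite ?normr1 ?normr0.
  rewrite /Int /Rintegral integral_indic // -lee_fin fineK.
    apply: le_trans (ltW Ae); apply: le_measure; rewrite ?inE //; exact: measurableI.
  by rewrite ge0_fin_numE // (le_lt_trans _ (lt_trans Ae (ltry _))) // le_measure ?inE //; exact: measurableI.
apply: (@le_lt_trans _ _ (B * e)); first by rewrite ler_wpM2l.
rewrite /e mulrA ltr_pdivrMr ?ltr_wpDl // mulrC ltr_pM2l ?ltrDl //.
by rewrite mulr_gt0 ?normr_gt0.
Qed.

End simplex.

(** A single simplex has [0], [b] and [t *: b] in its interior: [N] exceeds their norms and [L']
    exceeds [2 N n]. At all three points [p] is then given by the same affine interpolant. *)
Lemma affine_on_lines (b : 'rV[R]_n) t : p (t *: b) = (1 - t) * p 0 + t * p b.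
Proof.
pose N := 1 + `|b| + `|t *: b|; pose L' := N *+ 2 *+ n + 1.
have N0 : 0 < N by rewrite /N -addrA ltr_pwDl // addr_ge0.
have L'0 : 0 < L' by rewrite ltr_wpDl // mulrn_wge0 // mulrn_wge0 // ltW.
have aff (y : 'rV[R]_n) : `|y| < N -> p y = p (const_mx (- N)) + \sum_j (y 0 j + N) / L' *
    (p (const_mx (- N) + L' *: delta_mx 0 j) - p (const_mx (- N))).
  move=> yN; have yi i : - N < y 0 i /\ y 0 i < N.
    by apply/andP; rewrite -ltr_norml (le_lt_trans (rV_norm_coord _ _)).
  apply: affine_on_simplex => //; first by move=> i; have [] := yi i.
  apply: (@le_lt_trans _ _ (\sum_(i < n) N *+ 2)).
    by apply: ler_sum => i _; rewrite mulr2n lerD2r; have [_ /ltW] := yi i.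
  by rewrite sumr_const card_ord ltrDl.
have H0 : `|0 : 'rV[R]_n| < N by rewrite normr0.
have Hb : `|b| < N by rewrite /N -addrA addrCA ltrDl ltr_pwDl.
have Ht : `|t *: b| < N by rewrite /N ltrDr ltr_pwDl.
rewrite (aff _ H0) (aff _ Hb) (aff _ Ht).
rewrite mulrDr [t * (_ + _)]mulrDr addrACA -mulrDl subrK mul1r; congr (_ + _).
by rewrite !mulr_sumr -big_split; apply: eq_bigr => j _ /=; rewrite !mxE; ring.
Qed.

End quasiaffine_scalar.

(** * Quasiaffine functions are one affine *)

Section quasiaffine_one_affine.
Context {R : realType} {n k : nat} (k_gt0 : (0 < k)%N).
Implicit Types (a : ext_form R n k.-1) (xi : ext_form R n k).

Definition dual_wedge a (i : 'I_n) : ext_form R n k :=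
  ext_cast (prednK k_gt0) (wedge (dual_form i) a).

Lemma ctr_dual_wedge C a i : altseq C ->
  ctr C (dual_wedge a i) = ctr (fun l => C (i :: l)) a.
Proof.
move=> aC; rewrite ctr_ext_cast.
by rewrite [LHS](ctr_wedge (dual_form i) a aC) ctr_dual.
Qed.

Lemma ext_d_scale (g : 'I_n -> 'rV[R]_n -> R) a x :
  ext_cast (prednK k_gt0) (ext_d (fun i x => g i x *: a) x) =
  \sum_i g i x *: dual_wedge a i.
Proof.
apply: ctr_inj => C aC; rewrite ctr_ext_cast /ext_d !ctr_sumr; apply: eq_bigr => i _.
rewrite ctrZr ctr_dual_wedge // [LHS](ctr_wedge (dual_form i) (g i x *: a) aC).
by rewrite ctr_dual ctrZr.
Qed.

Lemma dual_form_sum (b : ext_form R n 1) : b = \sum_i ext_coef [ffun=> i] b *: dual_form i.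
Proof.
apply: ctr_inj => C aC; rewrite ctr_sumr {1}/ctr invr1 mul1r.
rewrite (reindex (fun i : 'I_n => [ffun=> i] : {ffun 'I_1 -> 'I_n})) /=; last first.
  exists (fun J => J 0) => [i _|J _]; first by rewrite ffunE.
  by apply/ffunP => j; rewrite ffunE (ord1 j).
apply: eq_bigr => i _; rewrite -/(ctr C _) ctrZr ctr_dual mulrC; congr (_ * C _).
by rewrite /codom /image_mem enum_ordSl enum_ord0 /= ffunE.
Qed.

(** The sign comes from moving the 1-form past the [k.-1] factors of [a], the exterior derivative
    putting it in front and one-affinity behind. *)
Lemma wdg_dual_wedge a (b : ext_form R n 1) :
  wdg k_gt0 a b = \sum_i ((-1) ^+ k.-1 * ext_coef [ffun=> i] b) *: dual_wedge a i.
Proof.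
apply: ctr_inj => C aC; rewrite ctr_wdg // ctr_sumr.
rewrite (@eq_ctr _ _ _ _ (fun l => \sum_i
  ctr (fun l' => C (l ++ l')) (ext_coef [ffun=> i] b *: dual_form i))); last first.
  by move=> l _; rewrite -ctr_sumr -dual_form_sum.
rewrite ctr_suml; apply: eq_bigr => i _; rewrite ctrZr ctr_dual_wedge //.
rewrite -ctrZl; apply: eq_ctr => l sl; rewrite ctrZr ctr_dual.
have := altseq_move [::] i l [::] aC; rewrite !cats0 sl /= => ->.
by rewrite mulrACA -expr2 sqrr_sign mul1r.
Qed.

Variables (f : ext_form R n k -> R) (xi : ext_form R n k) (a : ext_form R n k.-1).

(** With the vector [y] read as the 1-form with these coordinates, [D y] is [xi + y /\ a]. *)
Let D (y : 'rV[R]_n) := xi + \sum_i y 0 i *: dual_wedge a i.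

Let D_lip : exists2 S : R, 0 < S & forall x y, ext_norm (D y - D x) <= S * `|y - x|.
Proof.
pose S : R := \sum_(I : {ffun 'I_k -> 'I_n} | increasing I) \sum_i `|ext_coef I (dual_wedge a i)|.
have S0 : 0 <= S by rewrite sumr_ge0 // => I _; rewrite sumr_ge0.
exists (S + 1) => [|x y]; first by rewrite ltr_wpDl.
apply: (@le_trans _ _ (S * `|y - x|)); last by rewrite ler_wpM2r // lerDl.
apply: le_trans (ext_norm_le _) _; rewrite mulr_suml; apply: ler_sum => I _.
have -> : D y - D x = \sum_i (y - x) 0 i *: dual_wedge a i.
  rewrite /D opprD addrACA subrr add0r -sumrB; apply: eq_bigr => i _.
  by rewrite !mxE scalerBl.
have -> : ext_coef I (\sum_i (y - x) 0 i *: dual_wedge a i) =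
    \sum_i (y - x) 0 i * ext_coef I (dual_wedge a i).
  by elim/big_rec2 : _ => // i r u _ <-.
apply: le_trans (ler_norm_sum _ _ _) _; rewrite mulr_suml; apply: ler_sum => i _.
by rewrite normrM mulrC ler_wpM2l // rV_norm_coord.
Qed.

Hypothesis fq : ext_quasiaffine k_gt0 f.

(** Closed balls of R^n are compact and [D] is Lipschitz, so finitely many local bounds of [f]
    suffice. *)
Lemma quasiaffine_slice_bounded M : exists B, forall y : 'rV[R]_n, `|y| <= M -> `|f (D y)| <= B.
Proof.
have [_ fb _] := fq; have [S S0 DS] := D_lip.
have cK : compact [set y : 'rV[R]_n | `|y| <= M].
  apply: bounded_closed_compact.
    by exists M; split; [exact: num_real|move=> N MN y /le_trans; apply; exact: ltW].
  rewrite (_ : [set y | _] = (fun y : 'rV[R]_n => `|y|) @^-1` `]-oo, M]%classic).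
    by apply: closed_comp => [y _|]; [exact: norm_continuous|exact: lray_closed].
  by apply/seteqP; split => y /=; rewrite in_itv.
have : \forall B \near +oo, [set y : 'rV[R]_n | `|y| <= M] `<=` (fun y => `|f (D y)| <= B).
  move/compact_near_coveringP : cK; apply => x _.
  have [r [B [r0 HB]]] := fb (D x).
  exists (ball x (r / S), [set B' | B <= B']) => /=.
    by split; [apply: nbhsx_ballx; exact: divr_gt0|apply: nbhs_pinfty_ge; exact: num_real].
  move=> [y B'] /= [xy BB']; apply: le_trans BB'; apply: HB.
  apply: le_lt_trans (DS _ _) _; rewrite mulrC -ltr_pdivlMr //.
  by move: xy; rewrite mx_norm_ball /ball_ /= distrC.
move=> [B [_ HB]]; exists (B + 1) => y yM; apply: (HB (B + 1)) => //.
by rewrite ltrDl.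
Qed.

(** The sets of forms with measurable preimage under [D \o g] are a sigma-algebra, and it contains
    the open sets because [D \o g] is continuous. *)
Lemma quasiaffine_slice_measurable (g : 'rV[R]_n -> 'rV[R]_n) : continuous g ->
  measurable_fun setT ((fun y => f (D y)) \o g).
Proof.
have [fm _ _] := fq; have [S S0 DS] := D_lip; move=> gc _ A mA.
have : @measurable _ (g_sigma_algebraType (@ext_open R n k)) (f @^-1` A).
  by rewrite -[_ @^-1` _]setTI; exact: fm.
move=> mfA; rewrite setTI comp_preimage.
suff : [set B | measurable ((fun y => D (g y)) @^-1` B)] (f @^-1` A) by [].
apply: mfA; split.
  split => /= [|B mB|F mF].
  - by rewrite preimage_set0.
  - by rewrite setTD preimage_setC; exact: measurableC.
  - by rewrite preimage_bigcup; exact: bigcupT_measurable.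
move=> U oU /=; apply: open_rV_measurable; rewrite openE => x Ux.
have [r r0 rU] := oU _ Ux.
have /cvgrPdist_lt/(_ (r / S)) gx := gc x.
apply: filterS (gx _) => [y gxy|]; last by rewrite divr_gt0.
apply: rU; apply: le_lt_trans (DS _ _) _.
by rewrite mulrC -ltr_pdivlMr // distrC.
Qed.

(** The components are themselves test functions, so the constant sequence witnesses the zero
    boundary values, and the weak derivatives come from integrating the derivative of a product. *)
Let test_W1infty0 (W : set 'rV[R]_n) phi : open W -> bounded_set W -> test_function W phi ->
  W1infty0_form W (fun x => phi x *: a) (fun i x => pderiv i phi x *: a).
Proof.
move=> oW bW tphi I iI /=; pose c := ext_coef I a.
have [phis _ _] := tphi.
have cs : smooth (fun _ : 'rV[R]_n => c) by apply: smooth_exprP; exact: Smooth_cst.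
have tu : test_function W (fun x => phi x * c) by exact: test_functionM.
have du i x : pderiv i (fun x => phi x * c) x = pderiv i phi x * c.
  rewrite pderivM // (_ : pderiv i (fun=> c) x = 0); last exact: derive_cst.
  by rewrite mulr0 add0r mulrC.
have uL : Linfty W (fun x => phi x * c) by exact: test_Linfty.
have gL i : Linfty W (fun x => pderiv i phi x * c).
  by rewrite -(funext (du i)); exact: test_pderiv_Linfty.
have wp i : weak_pderiv W i (fun x => phi x * c) (fun x => pderiv i phi x * c).
  move=> psi tpsi; have [psis _ _] := tpsi; have [us _ _] := tu.
  apply/eqP; rewrite -addr_eq0; apply/eqP.
  have pL : Linfty W psi by exact: test_Linfty.
  have pdL : Linfty W (pderiv i psi) by exact: test_pderiv_Linfty.
  rewrite -(IntD oW bW (LinftyM uL pdL) (LinftyM (gL i) pL)).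
  rewrite -[RHS](Int_pderiv i (test_functionM tu psis)); congr Int; apply/funext => x.
  by rewrite pderivM // du [psi x * _]mulrC.
have L1L h : Linfty W h -> L1 W h by exact: Linfty_integrable.
pose u x := phi x * c; pose g i x := pderiv i phi x * c.
suff : W1infty W u g /\ W110 W u g by [].
split; [by split => // i; split; [exact: gL|exact: wp]|split].
  by split; [exact: L1L|move=> i; split; [apply: L1L; exact: gL|exact: wp]].
exists (fun=> fun x => phi x * c); split => // [|i].
  rewrite (_ : (fun _ => _) = cst 0%E); first exact: cvg_cst.
  by apply/funext => m; apply: integral0_eq => x _; rewrite subrr normr0.
rewrite (_ : (fun _ => _) = cst 0%E); first exact: cvg_cst.
by apply/funext => m; apply: integral0_eq => x _; rewrite du subrr normr0.
Qed.

Lemma quasiaffine_slice (W : set 'rV[R]_n) phi v : open W -> bounded_set W -> test_function W phi ->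
  (\int[lebesgue_rV n]_(x in W) (f (D (v + grad phi x)))%:E = (f (D v))%:E * lebesgue_rV n W)%E.
Proof.
move=> oW bW tphi; have [_ _ qa] := fq.
rewrite -(qa W oW bW (D v) _ _ (test_W1infty0 oW bW tphi)).
apply: eq_integral => x _; rewrite ext_d_scale /D -addrA -big_split /=.
by congr (f (_ + _))%:E; apply: eq_bigr => i _; rewrite !mxE scalerDl.
Qed.

Lemma quasiaffine_lines b : exists c0 c1 : R, forall t : R,
  f (xi + t *: wdg k_gt0 a b) = c0 + c1 * t.
Proof.
(* The coordinates of (-1)^(k-1) b: since [a /\ b] is (-1)^(k-1) [b /\ a], the line in direction
   [a /\ b] is the image under [D] of the line through [y]. *)
pose y : 'rV[R]_n := \row_i ((-1) ^+ k.-1 * ext_coef [ffun=> i] b).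
exists (f (D 0)), (f (D y) - f (D 0)) => t.
have -> : xi + t *: wdg k_gt0 a b = D (t *: y).
  rewrite wdg_dual_wedge scaler_sumr; congr (_ + _); apply: eq_bigr => i _.
  by rewrite !mxE scalerA.
rewrite (affine_on_lines (p := fun y => f (D y))); first by ring.
- exact: quasiaffine_slice_bounded.
- exact: quasiaffine_slice_measurable.
- exact: quasiaffine_slice.
Qed.

End quasiaffine_one_affine.

Lemma quasiaffine_one_affine (R : realType) (n k : nat) (k_gt0 : (0 < k)%N)
    (f : ext_form R n k -> R) :
  ext_quasiaffine k_gt0 f -> ext_one_affine k_gt0 f.
Proof. by move=> fq xi a b; exact: quasiaffine_lines. Qed.

Theorem theorem3p3 (R : realType) (n k : nat) (k_gt0 : (0 < k)%N)
    (k_le_n : (k <= n)%N) (f : ext_form R n k -> R) :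
  [<-> ext_polyaffine f;
       ext_quasiaffine k_gt0 f;
       ext_one_affine k_gt0 f;
       exists c : forall s : 'I_(n %/ k).+1, ext_form R n (s * k),
         forall xi : ext_form R n k,
           f xi = \sum_(s < (n %/ k).+1) ext_dot (c s) (wedge_exp xi s)].
Proof.
tfae.
- by move=> fp; apply: sum_quasiaffine; exact: ext_polyaffine_sum.
- exact: quasiaffine_one_affine.
- exact: one_affine_sum.
- exact: sum_ext_polyaffine.
Qed.
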